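(* Let $\mathbb K$ be a field of characteristic zero, $\omega=(B_{pq})_{p,q\ge 0}\in\mathcal B(\mathbb K[[\hbar]])$ and $\mathfrak g$ a Lie algebra over $\mathbb K$. Then: (1) $(\mathrm{Sh}^\omega(\mathfrak g),m,\Delta,\varepsilon,S)$ is a (topological) Hopf algebra over $\mathbb K[[\hbar]]$. (2) If $\omega\in\mathcal B(\mathbb K[[\hbar]])_{1/2}$, then the subspace of $\mathrm{Sh}^\omega(\mathfrak g)$ of all symmetric tensors is a Hopf subalgebra, canonically isomorphic with $U\mathfrak g[[\hbar]]$. (3) The mapping $\mathfrak g\mapsto\mathrm{Sh}^\omega(\mathfrak g)$ defines a functor from the category of Lie algebras to that of Hopf algebras. (4) If $\omega$ and $\omega'$ are equivalent elements of $\mathcal B(\mathbb K[[\hbar]])$ (same orbit under $\mathcal G(\mathbb K[[\hbar]])$), then the Hopf algebras $\mathrm{Sh}^\omega(\mathfrak g)$ and $\mathrm{Sh}^{\omega'}(\mathfrak g)$ are canonically isomorphic, the isomorphisms depending functorially on $\mathfrak g$.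
   Context: $FL_n(R)$ is the part of the free Lie algebra over a commutative ring $R$ on $n$ generators, homogeneous of degree one in each generator. For $\lambda\in R$, $\mathcal B(R)_\lambda$ is the set of families $(B_{pq})_{p,q\ge0}$, $B_{pq}\in FL_{p+q}(R)$ written $B_{pq}(x_1,\dots,x_p|y_1,\dots,y_q)$, with $B_{10}(x)=B_{01}(x)=x$, $B_{p0}=B_{0p}=0$ for $p\ne1$, $B_{11}(x|y)=\lambda[x,y]$, and for all $p,q,r>0$ $$\sum_{\alpha>0}\sum B_{\alpha r}\big(B_{p_1q_1}(x_{I_1}|y_{J_1}),\dots,B_{p_\alpha q_\alpha}(x_{I_\alpha}|y_{J_\alpha})\big|z_1,\dots,z_r\big)=\sum_{\alpha>0}\sum B_{p\alpha}\big(x_1,\dots,x_p\big|B_{q_1r_1}(y_{J_1}|z_{K_1}),\dots,B_{q_\alpha r_\alpha}(y_{J_\alpha}|z_{K_\alpha})\big),$$ the inner sums being over $\alpha$-tuples of nonnegative integers with $\sum p_\beta=p$, $\sum q_\beta=q$ (resp. $\sum q_\beta=q$, $\sum r_\beta=r$), and $x_{I_1},x_{I_2},\dots$ denoting the consecutive blocks of $(x_1,\dots,x_p)$ of lengths $p_1,p_2,\dots$ (similarly $y,z$). $\mathcal B(R)=\coprod_\lambda\mathcal B(R)_\lambda$. $\mathcal G(R)$ is the set of $(P_n)_{n\ge1}\in\prod_nFL_n(R)$ with $P_1(x)=x$, a group under substitution. Families $B,B'\in\mathcal B(R)$ are in the same orbit if there is $(P_n)\in\mathcal G(R)$ such that for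 all $p,q$ $$\sum_{\alpha>0}\sum P_\alpha\big(B_{p_1q_1}(x_{I_1}|y_{J_1}),\dots,B_{p_\alpha q_\alpha}(x_{I_\alpha}|y_{J_\alpha})\big)=\sum_{\alpha,\beta\ge0}\sum B'_{\alpha\beta}\big(P_{p_1}(x_{I_1}),\dots,P_{p_\alpha}(x_{I_\alpha})\big|P_{q_1}(y_{J_1}),\dots,P_{q_\beta}(y_{J_\beta})\big),$$ the inner sum on the left over nonnegative, and on the right over positive, block lengths adding up to $p$ and $q$. $\mathrm{Sh}^\omega(\mathfrak g)=T(\mathfrak g)[[\hbar]]$ as a $\mathbb K[[\hbar]]$-module; $(x_1\dots x_n)$ denotes $x_1\otimes\cdots\otimes x_n$ ($x_i\in\mathfrak g$). Product: $m((x_1\dots x_n)\otimes(y_1\dots y_m))=\sum_{k\ge0}\sum_{\sum p_i=n,\sum q_i=m}\big(B_{p_1q_1}(x_{I_1}|y_{J_1})\dots B_{p_kq_k}(x_{I_k}|y_{J_k})\big)$. Coproduct: $\Delta((x_1\dots x_n))=\sum_{i=0}^n(x_1\dots x_i)\otimes(x_{i+1}\dots x_n)$ (values in the $\hbar$-adically completed tensor square). $\varepsilon$ is the identity on tensor degree $0$ and zero on positive degrees. $S$ is defined inductively by $S(1)=1$, $S((x_1\dots x_n))=-\sum_{i=0}^{n-1}S((x_1\dots x_i))(x_{i+1}\dots x_n)$. *)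

(* Defs.v *)
From HB Require Import structures.
From mathcomp Require Import all_boot all_order all_algebra perm.
From mathcomp Require Import boolp.
From mathcomp.multinomials Require Import freeg.

Set Implicit Arguments.
Unset Strict Implicit.
Unset Printing Implicit Defensive.

Import GRing.Theory.
Local Open Scope ring_scope.
Local Open Scope quotient_scope.

(** * Modules given by generators and relations *)

Section Span.
Variables (R : nzRingType) (V : lmodType R).

Definition relspan (S : V -> Prop) : {pred V} := fun v =>
  `[< exists s : seq (R * V),
        (forall x, x \in s -> S x.2) /\ v = \sum_(x <- s) x.1 *: x.2 >].

Variable S : V -> Prop.

Lemma relspan_submod : submod_closed (relspan S).
Proof.
split; first by apply/asboolP; exists [::]; rewrite big_nil.
move=> a u v /asboolP[s [Ss ->]] /asboolP[t [St ->]]; apply/asboolP.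
exists ([seq (a * x.1, x.2) | x <- s] ++ t); split.
  by move=> x; rewrite mem_cat => /orP[/mapP[y /Ss ? ->]|/St].
rewrite big_cat big_map scaler_sumr; congr (_ + _).
by apply: eq_bigr => x _; rewrite scalerA.
Qed.

Lemma mem_relspan v : S v -> v \in relspan S.
Proof.
move=> Sv; apply/asboolP; exists [:: (1, v)]; split; last first.
  by rewrite big_seq1 scale1r.
by move=> x; rewrite inE => /eqP->.
Qed.

HB.instance Definition _ := GRing.isSubmodClosed.Build R V (relspan S) relspan_submod.

Definition lquot := Quotient.quot (relspan S : zmodClosed V).

HB.instance Definition _ := GRing.Zmodule.on lquot.
HB.instance Definition _ := Quotient.on lquot.

Definition lcls (v : V) : lquot := \pi_lquot v.
Definition lrep (q : lquot) : V := repr q.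

Lemma lrepK : cancel lrep lcls.
Proof. by move=> q; rewrite /lcls reprK. Qed.

Lemma lclsP u v : reflect (lcls u = lcls v) (u - v \in relspan S).
Proof. by rewrite Quotient.idealrBE; apply: eqP. Qed.

Lemma lclsD : {morph lcls : u v / u + v}.
Proof. by move=> u v; rewrite /lcls [LHS]Quotient.pi_add. Qed.

Definition lquot_scale (a : R) (x : lquot) : lquot := lcls (a *: lrep x).

Lemma lquot_scaleE a v : lquot_scale a (lcls v) = lcls (a *: v).
Proof. by apply/lclsP; rewrite -scalerBr rpredZ //; apply/lclsP; rewrite lrepK. Qed.

Lemma lquot_scaleA a b x :
  lquot_scale a (lquot_scale b x) = lquot_scale (a * b) x.
Proof. by rewrite -(lrepK x) !lquot_scaleE scalerA. Qed.

Lemma lquot_scale1 : left_id 1 lquot_scale.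
Proof. by move=> x; rewrite -(lrepK x) lquot_scaleE scale1r. Qed.

Lemma lquot_scaleDr : right_distributive lquot_scale +%R.
Proof.
move=> a x y; rewrite -(lrepK x) -(lrepK y) -lclsD !lquot_scaleE.
by rewrite scalerDr lclsD.
Qed.

Lemma lquot_scaleDl x : {morph lquot_scale^~ x : a b / a + b}.
Proof.
by move=> a b /=; rewrite -(lrepK x) !lquot_scaleE scalerDl lclsD.
Qed.

HB.instance Definition _ := GRing.Zmodule_isLmodule.Build R lquot
  lquot_scaleA lquot_scale1 lquot_scaleDr lquot_scaleDl.

Lemma lcls_is_linear : linear lcls.
Proof. by move=> a u v; rewrite lclsD -lquot_scaleE. Qed.

HB.instance Definition _ :=
  GRing.isLinear.Build R V lquot *:%R lcls lcls_is_linear.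

End Span.

(* The linear map [x] |-> f x out of a module presented by generators X; only
   meaningful when f respects the relations S. *)
Definition lquot_lift (R : nzRingType) (X : choiceType)
  (S : {freeg X / R} -> Prop) (W : lmodType R) (f : X -> W) (q : lquot S) : W :=
  fglift f (lrep q).

Section FreegLift.
Variables (R : nzRingType) (X : choiceType) (W : lmodType R) (f : X -> W).

HB.instance Definition _ := GRing.isZmodMorphism.Build {freeg X / R} W
  (fglift f) (lift_is_additive f).

Lemma fglift_is_scalable : scalable (fglift f : {freeg X / R} -> W).
Proof.
move=> a u; have -> : a *: u = \sum_(x <- dom u) << a * coeff x u *g x >> by [].
rewrite -[u in RHS]freeg_sumE !raddf_sum /=.
by apply: eq_bigr => x _; rewrite (liftU f) (liftU f) scalerA.
Qed.

HB.instance Definition _ := GRing.isScalable.Build R {freeg X / R} W *:%R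
  (fglift f) fglift_is_scalable.

Lemma fgliftE (u : {freeg X / R}) :
  fglift f u = \sum_(x <- fgenum u) x.1 *: f x.2.
Proof. by rewrite -[in LHS](Freeg_enum u) fglift_Freeg. Qed.

End FreegLift.

(** * Lie algebras *)

HB.mixin Record Lmodule_isLie (R : nzRingType) L of GRing.Lmodule R L := {
  lbr : L -> L -> L;
  lbr_linearl : forall y, linear (lbr^~ y);
  lbr_linearr : forall x, linear (lbr x);
  lbrxx : forall x, lbr x x = 0;
  lbr_jacobi : forall x y z,
    lbr x (lbr y z) + lbr y (lbr z x) + lbr z (lbr x y) = 0
}.

#[short(type="lieAlgType")]
HB.structure Definition LieAlgebra (R : nzRingType) :=
  { L of Lmodule_isLie R L & GRing.Lmodule R L }.

(** * Formal power series *)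

Record fps (V : Type) := Fps { fcoef :> nat -> V }.

Lemma fpsP V (u v : fps V) : (forall n, u n = v n) -> u = v.
Proof. by case: u v => [u] [v] /= /funext->. Qed.

HB.instance Definition _ V := gen_eqMixin (fps V).
HB.instance Definition _ V := gen_choiceMixin (fps V).

Section FpsZmod.
Variable V : zmodType.
Implicit Types u v w : fps V.

Definition fps0 : fps V := Fps (fun=> 0).
Definition fpsN u : fps V := Fps (fun n => - u n).
Definition fpsD u v : fps V := Fps (fun n => u n + v n).

Lemma fpsDA : associative fpsD.
Proof. by move=> u v w; apply: fpsP => n; rewrite /= addrA. Qed.
Lemma fpsDC : commutative fpsD.
Proof. by move=> u v; apply: fpsP => n; rewrite /= addrC. Qed.
Lemma fps0D : left_id fps0 fpsD.
Proof. by move=> u; apply: fpsP => n; rewrite /= add0r. Qed.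
Lemma fpsND : left_inverse fps0 fpsN fpsD.
Proof. by move=> u; apply: fpsP => n; rewrite /= addNr. Qed.

HB.instance Definition _ :=
  GRing.isZmodule.Build (fps V) fpsDA fpsDC fps0D fpsND.

Definition fconst (x : V) : fps V := Fps (fun n => if n is 0%N then x else 0).

End FpsZmod.

Lemma fps_sumE (V : zmodType) I (r : seq I) (P : pred I) (F : I -> fps V) n :
  (\sum_(i <- r | P i) F i) n = \sum_(i <- r | P i) F i n.
Proof. by elim/big_rec2: _ => //= i _ y _ <-. Qed.

(* The hbar-bilinear extension of a bilinear map b. *)
Definition fbil (U V W : zmodType) (b : U -> V -> W)
  (u : fps U) (v : fps V) : fps W :=
  Fps (fun n => \sum_(i < n.+1) b (u i) (v (n - i)%N)).

Section FbilTheory.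
Variables U V W : zmodType.

Definition biadd (b : U -> V -> W) :=
  (forall v, {morph b^~ v : x y / x + y}) /\ (forall u, {morph b u : x y / x + y}).

Variable b : U -> V -> W.
Hypothesis badd : biadd b.

Lemma biadd0l v : b 0 v = 0.
Proof. by apply: (@addrI _ (b 0 v)); rewrite -badd.1 !addr0. Qed.
Lemma biadd0r u : b u 0 = 0.
Proof. by apply: (@addrI _ (b u 0)); rewrite -badd.2 !addr0. Qed.
Lemma biadd_suml I (r : seq I) P F v :
  b (\sum_(i <- r | P i) F i) v = \sum_(i <- r | P i) b (F i) v.
Proof. by apply: (big_morph (b^~ v) (badd.1 v) (biadd0l v)). Qed.
Lemma biadd_sumr I (r : seq I) P F u :
  b u (\sum_(i <- r | P i) F i) = \sum_(i <- r | P i) b u (F i).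
Proof. by apply: (big_morph (b u) (badd.2 u) (biadd0r u)). Qed.

Lemma fbilDl v : {morph (fbil b)^~ v : x y / x + y}.
Proof.
move=> x y; apply: fpsP => n /=; rewrite -big_split /=.
by apply: eq_bigr => i _; rewrite badd.1.
Qed.

Lemma fbilDr u : {morph fbil b u : x y / x + y}.
Proof.
move=> x y; apply: fpsP => n /=; rewrite -big_split /=.
by apply: eq_bigr => i _; rewrite badd.2.
Qed.

Lemma fbil_pairs N u v n : (n < N)%N ->
  fbil b u v n = \sum_(i < N) \sum_(j < N | (i + j == n)%N) b (u i) (v j).
Proof.
move=> ltnN; rewrite /= (big_ord_widen N (fun i => b (u i) (v (n - i)%N)) ltnN).
rewrite big_mkcond; apply: eq_bigr => i _; rewrite ltnS; case: leqP => [lein|ltni].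
  have ltniN : (n - i < N)%N by rewrite (leq_ltn_trans (leq_subr _ _)).
  rewrite (big_pred1 (Ordinal ltniN)) // => j /=.
  by rewrite -val_eqE /= -{1}(subnKC lein) eqn_add2l.
rewrite big_pred0 // => j; apply/eqP => eqn.
by move: ltni; rewrite -eqn ltnNge leq_addr.
Qed.

Lemma fbil_constl x v n : fbil b (fconst x) v n = b x (v n).
Proof.
rewrite /= big_ord_recl /= subn0 big1 ?addr0 // => i _.
by rewrite biadd0l.
Qed.

Lemma fbilC u v : fbil b u v = fbil (fun y x => b x y) v u.
Proof.
apply: fpsP => n /=; rewrite (reindex_inj rev_ord_inj) /=.
by apply: eq_bigr => i _; rewrite subSS subKn // -ltnS.
Qed.

End FbilTheory.

Lemma fbil_triples (U1 U2 U3 V Z : zmodType) (d : U1 -> V -> Z)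
    (e : U2 -> U3 -> V) x y z n : biadd d ->
  fbil d x (fbil e y z) n =
  \sum_(i < n.+1) \sum_(j < n.+1) \sum_(k < n.+1)
     (if (i + (j + k) == n)%N then d (x i) (e (y j) (z k)) else 0).
Proof.
move=> dadd /=; apply: eq_bigr => i _.
rewrite -[\sum_(_ < _) _]/(fbil e y z (n - i)%N).
rewrite (@fbil_pairs _ _ _ e n.+1) ?ltnS ?leq_subr // (biadd_sumr dadd).
apply: eq_bigr => j _; rewrite (biadd_sumr dadd) big_mkcond.
apply: eq_bigr => k _; have lein : (i <= n)%N by rewrite -ltnS.
have -> // : (i + (j + k) == n)%N = (j + k == n - i)%N.
by rewrite -[RHS](eqn_add2l i) subnKC.
Qed.

Lemma fbilA (U1 U2 U3 V W Z : zmodType) (b : V -> U3 -> Z) (c : U1 -> U2 -> V)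
    (d : U1 -> W -> Z) (e : U2 -> U3 -> W) :
  biadd b -> biadd d -> (forall x y z, b (c x y) z = d x (e y z)) ->
  forall x y z, fbil b (fbil c x y) z = fbil d x (fbil e y z).
Proof.
move=> badd dadd bcde x y z; apply: fpsP => n.
rewrite fbilC fbil_triples; last by split; [apply: badd.2 | apply: badd.1].
rewrite fbil_triples // exchange_big; apply: eq_bigr => i _ /=.
rewrite exchange_big; apply: eq_bigr => j _ /=.
by apply: eq_bigr => k _; rewrite [(k + _)%N]addnC -addnA bcde.
Qed.

Section FpsRing.
Variable R : comNzRingType.

Lemma biadd_mul : biadd ( *%R : R -> R -> R).
Proof. by split=> [v x y|u x y]; rewrite (mulrDl, mulrDr). Qed.

Definition fps_mul : fps R -> fps R -> fps R := fbil *%R.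

Lemma fps_mulA : associative fps_mul.
Proof.
move=> u v w; apply/esym/fbilA; try exact: biadd_mul.
by move=> x y z; rewrite mulrA.
Qed.

Lemma fps_mulC : commutative fps_mul.
Proof.
move=> u v; rewrite /fps_mul fbilC; apply: fpsP => n /=.
by apply: eq_bigr => i _; rewrite mulrC.
Qed.

Lemma fps_mul1 : left_id (fconst 1) fps_mul.
Proof.
by move=> u; apply: fpsP => n; rewrite (fbil_constl biadd_mul) mul1r.
Qed.

Lemma fps_mulDl : left_distributive fps_mul +%R.
Proof. by move=> u v w; rewrite /fps_mul (fbilDl biadd_mul). Qed.

Lemma fps_1neq0 : fconst (1 : R) != 0.
Proof.
apply/eqP => /(congr1 (fun u : fps R => u 0%N)) /= /eqP.
by rewrite oner_eq0.
Qed.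

HB.instance Definition _ := GRing.Zmodule_isComNzRing.Build (fps R)
  fps_mulA fps_mulC fps_mul1 fps_mulDl fps_1neq0.

End FpsRing.

Section FpsModule.
Variables (R : comNzRingType) (V : lmodType R).

Lemma biadd_scale : biadd ( *:%R : R -> V -> V).
Proof. by split=> [v x y|u x y]; rewrite (scalerDl, scalerDr). Qed.

Definition fps_scale : fps R -> fps V -> fps V := fbil *:%R.

Lemma fps_scaleA a b u : fps_scale a (fps_scale b u) = fps_scale (a * b) u.
Proof.
apply/esym/fbilA; try exact: biadd_scale.
by move=> x y z; rewrite scalerA.
Qed.

Lemma fps_scale1 : left_id 1 fps_scale.
Proof.
by move=> u; apply: fpsP => n; rewrite (fbil_constl biadd_scale) scale1r.
Qed.

Lemma fps_scaleDr : right_distributive fps_scale +%R.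
Proof. by move=> a u v; apply: fbilDr; apply: biadd_scale. Qed.

Lemma fps_scaleDl u : {morph fps_scale^~ u : a b / a + b}.
Proof. by move=> a b; apply: (fbilDl biadd_scale). Qed.

HB.instance Definition _ := GRing.Zmodule_isLmodule.Build (fps R) (fps V)
  fps_scaleA fps_scale1 fps_scaleDr fps_scaleDl.

End FpsModule.

Section FpsLie.
Variables (R : comNzRingType) (g : lieAlgType R).

Lemma biadd_lbr : biadd (@lbr R g).
Proof.
split=> [v x y|u x y].
  by have := @lbr_linearl R g v 1 x y; rewrite !scale1r.
by have := @lbr_linearr R g u 1 x y; rewrite !scale1r.
Qed.

Lemma lbrZl (a : R) (x y : g) : lbr (a *: x) y = a *: lbr x y.
Proof.
have := @lbr_linearl R g y a x 0.
by rewrite !(biadd0l biadd_lbr) !addr0.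
Qed.

Lemma lbrZr (a : R) (x y : g) : lbr x (a *: y) = a *: lbr x y.
Proof.
have := @lbr_linearr R g x a y 0.
by rewrite !(biadd0r biadd_lbr) !addr0.
Qed.

Lemma lbrC (x y : g) : lbr y x = - lbr x y.
Proof.
apply/eqP; rewrite -addr_eq0; apply/eqP.
have := lbrxx (x + y); rewrite biadd_lbr.1 !biadd_lbr.2 !lbrxx.
by rewrite add0r addr0 addrC.
Qed.

Definition fps_lbr : fps g -> fps g -> fps g := fbil (@lbr R g).

Lemma fps_lbrZl a u v : fps_lbr (a *: u) v = a *: fps_lbr u v.
Proof.
apply: fbilA; [exact: biadd_lbr|exact: biadd_scale|].
by move=> x y z; rewrite lbrZl.
Qed.

Lemma fps_lbrC u v : fps_lbr v u = - fps_lbr u v.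
Proof.
rewrite {1}/fps_lbr fbilC; apply: fpsP => n /=; rewrite -sumrN.
by apply: eq_bigr => i _; rewrite lbrC.
Qed.

Lemma fps_lbr_linearl v : linear (fps_lbr^~ v).
Proof. by move=> a x y /=; rewrite /fps_lbr (fbilDl biadd_lbr) -fps_lbrZl. Qed.

Lemma fps_lbr_linearr u : linear (fps_lbr u).
Proof.
move=> a x y; rewrite fps_lbrC fps_lbr_linearl (fps_lbrC x u) (fps_lbrC y u).
by rewrite scalerN -opprD.
Qed.

Lemma fps_lbrxx u : fps_lbr u u = 0.
Proof.
apply: fpsP => n; rewrite /fps_lbr (@fbil_pairs _ _ _ _ n.+1) //.
rewrite pair_big_dep /= (bigID (fun p : 'I_n.+1 * 'I_n.+1 => p.1 == p.2)) /=.
rewrite big1 ?add0r; last by case=> i j /= /andP[_ /eqP->]; rewrite lbrxx.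
rewrite (bigID (fun p : 'I_n.+1 * 'I_n.+1 => p.1 < p.2)%N) /=.
set A := \sum_(_ | _) _; set C := \sum_(_ | _) _.
suff -> : C = - A by rewrite subrr.
rewrite /C (reindex_inj (h := fun p : 'I_n.+1 * 'I_n.+1 => (p.2, p.1))) /=; last first.
  by move=> [i j] [k l] /= [-> ->].
rewrite -sumrN; apply: eq_big => [[i j]|[i j] _] /=; last by rewrite lbrC.
by rewrite addnC -andbA -andbA -!val_eqE /= -leqNgt leq_eqVlt; case: ltngtP; rewrite ?andbF.
Qed.

Lemma fps_jacobi u v w :
  fps_lbr u (fps_lbr v w) + fps_lbr v (fps_lbr w u) + fps_lbr w (fps_lbr u v)
    = 0.
Proof.
apply: fpsP => n; have E a b c := fbil_triples (@lbr R g) a b c n biadd_lbr.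
transitivity (fps_lbr u (fps_lbr v w) n + fps_lbr v (fps_lbr w u) n
              + fps_lbr w (fps_lbr u v) n) => //.
rewrite /fps_lbr !E.
under [X in _ + X + _]eq_bigr do rewrite exchange_big.
rewrite [X in _ + X + _]exchange_big [X in _ + _ + X]exchange_big.
rewrite -!big_split big1 //= => i _.
rewrite [X in _ + _ + X]exchange_big -!big_split big1 //= => j _.
rewrite -!big_split big1 //= => k _.
have -> : (j + (k + i) = i + (j + k))%N by rewrite addnA addnC.
have -> : (k + (i + j) = i + (j + k))%N by rewrite addnC addnA.
by case: ifP; rewrite ?addr0 // lbr_jacobi.
Qed.

HB.instance Definition _ := Lmodule_isLie.Build (fps R) (fps g)
  fps_lbr_linearl fps_lbr_linearr fps_lbrxx fps_jacobi.

End FpsLie.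

(** * Free Lie algebras *)

Inductive ltree (n : nat) := Leaf of 'I_n | Node of ltree n & ltree n.
Arguments Leaf {n}.
Arguments Node {n}.

HB.instance Definition _ n := gen_eqMixin (ltree n).
HB.instance Definition _ n := gen_choiceMixin (ltree n).

Fixpoint leaves n (t : ltree n) : seq 'I_n :=
  match t with Leaf i => [:: i] | Node t u => leaves t ++ leaves u end.

Section FreeLie.
Variables (R : comNzRingType) (n : nat).

Definition free_magma_alg := {freeg (ltree n) / R}.
Local Notation M := free_magma_alg.

Definition node_mul (a b : M) : M :=
  fglift (fun t => fglift (fun u => << Node t u >> : M) b) a.

(* The two-sided ideal of the free nonassociative algebra generated by the
   values of [a, a] and of the Jacobi identity. *)
Inductive lie_rel : M -> Prop :=
| LieAlt a : lie_rel (node_mul a a)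
| LieJacobi a b c : lie_rel (node_mul a (node_mul b c)
    + node_mul b (node_mul c a) + node_mul c (node_mul a b))
| LieMull a r : lie_rel r -> lie_rel (node_mul a r)
| LieMulr a r : lie_rel r -> lie_rel (node_mul r a).

Definition freeLie := lquot lie_rel.
HB.instance Definition _ := GRing.Lmodule.on freeLie.

Lemma node_mul_linearl b : linear (node_mul^~ b).
Proof. by move=> c x y; rewrite /node_mul linearP. Qed.

Lemma node_mul_linearr a : linear (node_mul a).
Proof.
move=> c x y; rewrite /node_mul !fgliftE scaler_sumr -big_split /=.
apply: eq_bigr => t _; rewrite linearP scalerDr !scalerA.
by rewrite [t.1 * c]mulrC.
Qed.

Lemma biadd_node_mul : biadd node_mul.
Proof.
split=> [v x y|u x y].
  by have := node_mul_linearl v 1 x y; rewrite !scale1r.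
by have := node_mul_linearr u 1 x y; rewrite !scale1r.
Qed.

Lemma node_mul_idealr a r : r \in relspan lie_rel -> node_mul a r \in relspan lie_rel.
Proof.
move=> /asboolP[s [Ss ->]]; rewrite (biadd_sumr biadd_node_mul).
rewrite big_seq rpred_sum // => x xs; rewrite -[_ *: _]addr0 node_mul_linearr.
rewrite (biadd0r biadd_node_mul) addr0 rpredZ // mem_relspan //.
by apply: LieMull; apply: Ss.
Qed.

Lemma node_mul_ideall a r : r \in relspan lie_rel -> node_mul r a \in relspan lie_rel.
Proof.
move=> /asboolP[s [Ss ->]]; rewrite (biadd_suml biadd_node_mul).
rewrite big_seq rpred_sum // => x xs; rewrite -[_ *: _]addr0 node_mul_linearl.
rewrite (biadd0l biadd_node_mul) addr0 rpredZ // mem_relspan //.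
by apply: LieMulr; apply: Ss.
Qed.

Definition freeLie_br (x y : freeLie) : freeLie :=
  lcls _ (node_mul (lrep x) (lrep y)).

Lemma freeLie_brE a b :
  freeLie_br (lcls _ a) (lcls _ b) = lcls _ (node_mul a b).
Proof.
apply/lclsP; set a' := lrep _; set b' := lrep _.
have -> : node_mul a' b' - node_mul a b
    = node_mul (a' - a) b' + node_mul a (b' - b).
  have [Dl Dr] := biadd_node_mul; apply/eqP; rewrite subr_eq -addrA -Dr subrK.
  by rewrite -Dl subrK.
apply: rpredD; [apply: node_mul_ideall | apply: node_mul_idealr].
  by apply/lclsP; rewrite lrepK.
by apply/lclsP; rewrite lrepK.
Qed.

Lemma freeLie_br_linearl y : linear (freeLie_br^~ y).
Proof.
move=> c x x'; rewrite -(lrepK x) -(lrepK x') -(lrepK y) -linearP.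
by rewrite !freeLie_brE node_mul_linearl linearP.
Qed.

Lemma freeLie_br_linearr x : linear (freeLie_br x).
Proof.
move=> c y y'; rewrite -(lrepK x) -(lrepK y) -(lrepK y') -linearP.
by rewrite !freeLie_brE node_mul_linearr linearP.
Qed.

Lemma freeLie_brxx x : freeLie_br x x = 0.
Proof.
rewrite -(lrepK x) freeLie_brE -(linear0 (lcls lie_rel)).
by apply/lclsP; rewrite subr0 mem_relspan //; apply: LieAlt.
Qed.

Lemma freeLie_jacobi x y z :
  freeLie_br x (freeLie_br y z) + freeLie_br y (freeLie_br z x)
    + freeLie_br z (freeLie_br x y) = 0.
Proof.
rewrite -(lrepK x) -(lrepK y) -(lrepK z) !freeLie_brE -!lclsD.
rewrite -(linear0 (lcls lie_rel)).
by apply/lclsP; rewrite subr0 mem_relspan //; apply: LieJacobi.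
Qed.

HB.instance Definition _ := Lmodule_isLie.Build R freeLie
  freeLie_br_linearl freeLie_br_linearr freeLie_brxx freeLie_jacobi.

Definition lgen (i : 'I_n) : freeLie := lcls _ << Leaf i >>.

(* Homogeneous of degree one in each of the n generators. *)
Definition multilinear (x : freeLie) : Prop :=
  exists2 a : M, (forall t, t \in dom a -> perm_eq (leaves t) (enum 'I_n))
               & x = lcls _ a.

Fixpoint teval (L : lieAlgType R) (v : 'I_n -> L) (t : ltree n) : L :=
  match t with Leaf i => v i | Node t u => lbr (teval v t) (teval v u) end.

(* The Lie algebra morphism lgen i |-> v i. *)
Definition leval (L : lieAlgType R) (v : 'I_n -> L) (x : freeLie) : L :=
  lquot_lift (teval v) x.

End FreeLie.

(** * The sets B(R)_lambda and the group G(R) *)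

(* All ways of cutting s into k consecutive, possibly empty, blocks. *)
Fixpoint splits T (k : nat) (s : seq T) : seq (seq (seq T)) :=
  if k is k'.+1 then
    flatten [seq [seq take i s :: bs | bs <- splits k' (drop i s)]
            | i <- iota 0 (size s).+1]
  else if s is [::] then [:: [::]] else [::].

(* All ways of cutting s into k consecutive nonempty blocks. *)
Definition psplits T (k : nat) (s : seq T) : seq (seq (seq T)) :=
  [seq bs <- splits k s | all (fun b => ~~ nilp b) bs].

Section Families.
Variable R : comNzRingType.

Definition Bfamily := forall p q, freeLie R (p + q).
Definition Pfamily := forall n, freeLie R n.

Section Evaluation.
Variables (B : Bfamily) (P : Pfamily) (L : lieAlgType R).

(* B_pq(x_1, ..., x_p | y_1, ..., y_q), with p and q the lengths of the lists:
   the generators are numbered x_1, ..., x_p, y_1, ..., y_q. *)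
Definition Bev (xs ys : seq L) : L :=
  leval (fun k => nth 0 (xs ++ ys) k) (B (size xs) (size ys)).

Definition Pev (xs : seq L) : L := leval (fun k => nth 0 xs k) (P (size xs)).

Definition Bblocks (I J : seq (seq L)) : seq L :=
  [seq Bev b.1 b.2 | b <- zip I J].

End Evaluation.

Definition lgens n : seq (freeLie R n) := [seq lgen R i | i <- enum 'I_n].

(* The number alpha of blocks is bounded by the total length: with more blocks,
   some pair (p_beta, q_beta) is (0, 0), and B_00 = 0. *)
Definition B_assoc (B : Bfamily) (p q r : nat) : Prop :=
  let xs := take p (lgens (p + q + r)) in
  let ys := take q (drop p (lgens (p + q + r))) in
  let zs := drop (p + q) (lgens (p + q + r)) in
  \sum_(1 <= k < (p + q).+1) \sum_(I <- splits k xs) \sum_(J <- splits k ys)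
     Bev B (Bblocks B I J) zs
  = \sum_(1 <= k < (q + r).+1) \sum_(J <- splits k ys) \sum_(K <- splits k zs)
     Bev B xs (Bblocks B J K).

Record in_Blambda (lambda : R) (B : Bfamily) : Prop := InBlambda {
  B_multilinear : forall p q, multilinear (B p q);
  B_10 : B 1%N 0%N = lgen R ord0;
  B_01 : B 0%N 1%N = lgen R ord0;
  B_p0 : forall p, p != 1%N -> B p 0%N = 0;
  B_0p : forall p, p != 1%N -> B 0%N p = 0;
  B_11 : B 1%N 1%N = lambda *: lbr (lgen R ord0) (lgen R ord_max);
  B_assocP : forall p q r, (0 < p)%N -> (0 < q)%N -> (0 < r)%N -> B_assoc B p q r
}.

Definition in_B (B : Bfamily) : Prop := exists lambda, in_Blambda lambda B.

(* The term P_0 plays no role, as FL_0(R) = 0. *)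
Definition in_G (P : Pfamily) : Prop :=
  (forall n, multilinear (P n)) /\ P 1%N = lgen R ord0.

(* B and B' are in the same orbit when transports P B B' for some P in G(R). *)
Definition transports (P : Pfamily) (B B' : Bfamily) : Prop :=
  forall p q,
  let xs := take p (lgens (p + q)) in
  let ys := drop p (lgens (p + q)) in
  \sum_(1 <= k < (p + q).+1) \sum_(I <- splits k xs) \sum_(J <- splits k ys)
     Pev P (Bblocks B I J)
  = \sum_(0 <= k < p.+1) \sum_(0 <= l < q.+1)
    \sum_(I <- psplits k xs) \sum_(J <- psplits l ys)
     Bev B' [seq Pev P b | b <- I] [seq Pev P b | b <- J].

End Families.

(** * Tensor products and linear extension *)

Section Tensor.
Variables (K : comNzRingType) (V W : lmodType K).

Inductive tens_rel : {freeg (V * W)%type / K} -> Prop :=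
| TensLinl a x x' y :
    tens_rel (<< (a *: x + x', y) >> - a *: << (x, y) >> - << (x', y) >>)
| TensLinr a x y y' :
    tens_rel (<< (x, a *: y + y') >> - a *: << (x, y) >> - << (x, y') >>).

Definition tens := lquot tens_rel.
HB.instance Definition _ := GRing.Lmodule.on tens.

Definition tpure (x : V) (y : W) : tens := lcls _ << (x, y) >>.
Definition ftens : fps V -> fps W -> fps tens := fbil tpure.

End Tensor.

(* The K[[hbar]]-linear extension of the K-linear map [x] |-> f x. *)
Definition linext (K : comNzRingType) (X : choiceType)
  (S : {freeg X / K} -> Prop) (W : lmodType K) (f : X -> fps W)
  (a : fps (lquot S)) : fps W :=
  Fps (fun n =>
    \sum_(i < n.+1) lquot_lift (fun x => f x (n - i)%N) (a i)).

Definition tlinext (K : comNzRingType) (V W U : lmodType K)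
  (b : V -> W -> fps U) (t : fps (tens V W)) : fps U :=
  linext (fun p => b p.1 p.2) t.

(** * Topological Hopf algebras

   The K[[hbar]]-modules considered are of the form V[[hbar]]. Every
   K[[hbar]]-linear map between such modules is hbar-adically continuous, and
   the hbar-adic completion of V[[hbar]] (x) W[[hbar]] is (V (x) W)[[hbar]], in
   which ftens a b is a (x) b. *)

Section Hopf.
Variable K : comNzRingType.

Record hopfData (V : lmodType K) := HopfData {
  hone : fps V;
  hmul : fps V -> fps V -> fps V;
  hcomul : fps V -> fps (tens V V);
  hcounit : fps V -> fps K;
  hanti : fps V -> fps V
}.

(* f (x) g *)
Definition tensF (V V' W W' : lmodType K)
  (f : fps V -> fps V') (g : fps W -> fps W') :
  fps (tens V W) -> fps (tens V' W') :=
  tlinext (fun x y => ftens (f (fconst x)) (g (fconst y))).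

Definition tensA (V : lmodType K) :
  fps (tens (tens V V) V) -> fps (tens V (tens V V)) :=
  tlinext (fun t z => tlinext (fun x y => fconst (tpure x (tpure y z)))
                              (fconst t)).

(* (x (x) y) (x' (x) y') = x x' (x) y y' *)
Definition tens_mul (V : lmodType K) (m : fps V -> fps V -> fps V)
  (s t : fps (tens V V)) : fps (tens V V) :=
  tlinext (fun x y => tlinext (fun x' y' =>
    ftens (m (fconst x) (fconst x')) (m (fconst y) (fconst y'))) t) s.

Record is_hopf (V : lmodType K) (H : hopfData V) : Prop := IsHopf {
  hmul_linearl : forall b, linear ((hmul H)^~ b);
  hmul_linearr : forall a, linear (hmul H a);
  hmulA : associative (hmul H);
  hmul1l : left_id (hone H) (hmul H);
  hmul1r : right_id (hone H) (hmul H);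
  hcomul_linear : linear (hcomul H);
  hcomulA : forall a,
    tensA (tensF (hcomul H) idfun (hcomul H a))
      = tensF idfun (hcomul H) (hcomul H a);
  hcounit_linear : scalar (hcounit H);
  hcounitl : forall a,
    tlinext (fun x y => hcounit H (fconst x) *: fconst y) (hcomul H a) = a;
  hcounitr : forall a,
    tlinext (fun x y => hcounit H (fconst y) *: fconst x) (hcomul H a) = a;
  hcomulM : forall a b,
    hcomul H (hmul H a b) = tens_mul (hmul H) (hcomul H a) (hcomul H b);
  hcomul1 : hcomul H (hone H) = ftens (hone H) (hone H);
  hcounitM : {morph hcounit H : a b / hmul H a b >-> a * b};
  hcounit1 : hcounit H (hone H) = 1;
  hanti_linear : linear (hanti H);
  hantil : forall a,
    tlinext (fun x y => hmul H (hanti H (fconst x)) (fconst y)) (hcomul H a)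
      = hcounit H a *: hone H;
  hantir : forall a,
    tlinext (fun x y => hmul H (fconst x) (hanti H (fconst y))) (hcomul H a)
      = hcounit H a *: hone H
}.

Record hopf_morph (V V' : lmodType K) (H : hopfData V) (H' : hopfData V')
  (f : fps V -> fps V') : Prop := HopfMorph {
  hmorph_linear : linear f;
  hmorphM : {morph f : a b / hmul H a b >-> hmul H' a b};
  hmorph1 : f (hone H) = hone H';
  hmorph_comul : forall a, hcomul H' (f a) = tensF f f (hcomul H a);
  hmorph_counit : forall a, hcounit H' (f a) = hcounit H a;
  hmorph_anti : forall a, f (hanti H a) = hanti H' (f a)
}.

Definition hopf_iso (V V' : lmodType K) (H : hopfData V) (H' : hopfData V')
  (f : fps V -> fps V') : Prop := hopf_morph H H' f /\ bijective f.

(* The series all of whose coefficients lie in W. *)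
Definition fps_in (V : Type) (W : V -> Prop) (a : fps V) : Prop :=
  forall n, W (a n).

(* The image of W (x) W in V (x) V. *)
Definition tens_in (V : lmodType K) (W : V -> Prop) (t : tens V V) : Prop :=
  exists2 s : seq (V * V), (forall p, p \in s -> W p.1 /\ W p.2)
    & t = \sum_(p <- s) tpure p.1 p.2.

(* W[[hbar]] is a Hopf subalgebra of V[[hbar]]. *)
Record hopf_sub (V : lmodType K) (H : hopfData V) (W : V -> Prop) : Prop :=
  HopfSub {
  hsub0 : W 0;
  hsubP : forall a x y, W x -> W y -> W (a *: x + y);
  hsub1 : fps_in W (hone H);
  hsubM : forall a b, fps_in W a -> fps_in W b -> fps_in W (hmul H a b);
  hsub_comul : forall a, fps_in W a -> fps_in (tens_in W) (hcomul H a);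
  hsub_anti : forall a, fps_in W a -> fps_in W (hanti H a)
}.

End Hopf.

(** * Tensor algebra and enveloping algebra *)

Section TensorAlgebra.
Variables (K : comNzRingType) (V : lmodType K).

Inductive word_rel : {freeg (seq V) / K} -> Prop :=
| WordLin u v a x y :
    word_rel (<< u ++ (a *: x + y) :: v >> - a *: << u ++ x :: v >>
              - << u ++ y :: v >>).

Definition tensorAlg := lquot word_rel.
HB.instance Definition _ := GRing.Lmodule.on tensorAlg.

Definition tword (w : seq V) : tensorAlg := lcls _ << w >>.

Definition tcons (x : V) (t : tensorAlg) : tensorAlg :=
  lquot_lift (fun w => tword (x :: w)) t.

(* (a_1 ... a_k) in T(V)[[hbar]], for a_1, ..., a_k in V[[hbar]]. *)
Definition fword (s : seq (fps V)) : fps tensorAlg :=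
  foldr (fbil tcons) (fconst (tword [::])) s.

Definition perm_word n (s : 'S_n) (w : seq V) : seq V :=
  if size w == n then [seq nth 0 w (s i) | i <- enum 'I_n] else w.

(* For all n, the degree n component of t is invariant under the action of S_n
   on the n-th tensor power. *)
Definition symmetric_tensor (t : tensorAlg) : Prop :=
  forall n (s : 'S_n), lquot_lift (fun w => tword (perm_word s w)) t = t.

End TensorAlgebra.

Section Enveloping.
Variables (K : comNzRingType) (g : lieAlgType K).

Inductive env_rel : {freeg (seq g) / K} -> Prop :=
| EnvWord r : word_rel r -> env_rel r
| EnvBr u v x y :
    env_rel (<< u ++ x :: y :: v >> - << u ++ y :: x :: v >>
             - << u ++ lbr x y :: v >>).

Definition env := lquot env_rel.
HB.instance Definition _ := GRing.Lmodule.on env.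

Definition eword (w : seq g) : env := lcls _ << w >>.

(* Left multiplications by x in Ug and by x (x) 1 + 1 (x) x in Ug (x) Ug. *)
Definition econs (x : g) (t : env) : env :=
  lquot_lift (fun w => eword (x :: w)) t.
Definition eprim (x : g) (t : tens env env) : tens env env :=
  lquot_lift (fun p => tpure (econs x p.1) p.2 + tpure p.1 (econs x p.2)) t.

Definition env_hopf : hopfData env := HopfData
  (fconst (eword [::]))
  (fun a b => linext (fun v => linext (fun w => fconst (eword (v ++ w))) b) a)
  (linext (fun w => fconst (foldr eprim (tpure (eword [::]) (eword [::])) w)))
  (@linext K _ _ K^o (fun w => fconst (nilp w)%:R))
  (linext (fun w => fconst ((-1) ^+ size w *: eword (rev w)))).

End Enveloping.

(** * The quantized shuffle algebra *)

Section Shuffle.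
Variables (K : comNzRingType) (B : Bfamily (fps K)) (g : lieAlgType K).

(* Here also the number of blocks is bounded because B_00 = 0. *)
Definition sh_mul_word (xs ys : seq g) : fps (tensorAlg g) :=
  let fxs := map (@fconst g) xs in
  let fys := map (@fconst g) ys in
  \sum_(0 <= k < (size xs + size ys).+1)
  \sum_(I <- splits k fxs) \sum_(J <- splits k fys) fword (Bblocks B I J).

Definition sh_mul (a b : fps (tensorAlg g)) : fps (tensorAlg g) :=
  linext (fun xs => linext (fun ys => sh_mul_word xs ys) b) a.

Definition sh_comul_word (w : seq g) : tens (tensorAlg g) (tensorAlg g) :=
  \sum_(0 <= i < (size w).+1) tpure (tword (take i w)) (tword (drop i w)).

(* The recursion is on an upper bound fuel of the length of w. *)
Fixpoint sh_anti_rec (fuel : nat) (w : seq g) : fps (tensorAlg g) :=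
  if fuel is fuel'.+1 then
    if nilp w then fconst (tword [::]) else
    - \sum_(0 <= i < size w)
        sh_mul (sh_anti_rec fuel' (take i w)) (fconst (tword (drop i w)))
  else fconst (tword [::]).

Definition sh_hopf : hopfData (tensorAlg g) := HopfData
  (fconst (tword [::]))
  sh_mul
  (linext (fun w => fconst (sh_comul_word w)))
  (@linext K _ _ K^o (fun w => fconst (nilp w)%:R))
  (linext (fun w => sh_anti_rec (size w) w)).

(* (x_1 ... x_n) |-> \sum (P_n1(x_I1) ... P_nk(x_Ik)), over all the ways of
   cutting the word into nonempty blocks. *)
Definition sh_twist (P : Pfamily (fps K)) : fps (tensorAlg g) -> fps (tensorAlg g) :=
  linext (fun w : seq g =>
    \sum_(0 <= k < (size w).+1)
    \sum_(I <- psplits k (map (@fconst g) w)) fword [seq Pev P b | b <- I]).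

End Shuffle.

(* The action on Sh of a linear map f. *)
Definition sh_map (K : comNzRingType) (g h : lieAlgType K) (f : g -> h) :
  fps (tensorAlg g) -> fps (tensorAlg h) :=
  linext (fun w : seq g => fconst (tword (map f w))).

(* Main.v *)
Require Import Defs.
From HB Require Import structures.
From mathcomp Require Import all_boot all_order all_algebra perm.
From mathcomp Require Import boolp.
From mathcomp.multinomials Require Import freeg.

(* T(g)[[hbar]] is the cofree conilpotent coalgebra on g[[hbar]]: a coalgebra
   morphism into it is determined by its projection to words of length one. The
   product of Sh and the twist by an element of G are by construction the
   coalgebra morphisms with projections B and P. Hence associativity, and the
   multiplicativity of the twist, follow from the equality of two projections,
   which is the identity defining B, resp. the orbit relation, transported from a
   free Lie algebra. The twist is unipotent for the filtration by length.

   Lie polynomials of degree > 1 vanish when all their arguments are equal, so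
   x * x^(n) = (n + 1) x^(n+1), where x^(n) is the word x ... x. As
   x * y - y * x = 2 lambda [x, y] for letters, for lambda = 1/2 there is a
   morphism from U(g), with x^n |-> n! x^(n). In characteristic 0 the powers x^n
   span U(g) and the words x^(n) span the symmetric tensors, by polarization, so
   that sending the word x_1 ... x_n to (1/n!) x_1 ... x_n gives the inverse. *)

Set Implicit Arguments.
Unset Strict Implicit.
Unset Printing Implicit Defensive.

Import GRing.Theory.
Local Open Scope ring_scope.

(** * Power series with coefficients in a module *)

(** The coefficients of B are series in hbar, so the blocks in a product of words over g are letters
    of g[[hbar]]. The operations are defined on words over g, but the computations take place on
    words over g[[hbar]]; multilinearity in the letters connects the two ([wlift], [wliftE]). The
    coproduct is mostly handled through its values under bilinear maps ([sweedler]), and tensor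
    powers through tuples of words that are cut simultaneously ([cutm]). Uniqueness of coalgebra
    morphisms is then an induction on the total length of a tuple, which works because B and P
    vanish on empty blocks. The antipode is by definition only a left convolution inverse of the
    identity; that it is two-sided, and preserved by morphisms, comes from convolution identities.
    In (2), powers go to natural multiples of powers whatever the higher B_pq are, so the comparison
    with U(g) involves no hbar and is inverted coefficient by coefficient. Stability of the
    symmetric tensors under product and antipode then holds because they form the image of a
    morphism. *)

Section LinearMaps.
Variables (R : nzRingType) (U V W : lmodType R).

Lemma linD (f : U -> V) : linear f -> {morph f : x y / x + y}.
Proof. by move=> lf x y; have := lf 1 x y; rewrite !scale1r. Qed.

Lemma lin0 (f : U -> V) : linear f -> f 0 = 0.
Proof. by move=> lf; apply: (@addrI _ (f 0)); rewrite -linD // !addr0. Qed.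

Lemma linZ (f : U -> V) : linear f -> forall a, {morph f : x / a *: x}.
Proof. by move=> lf a x; have := lf a x 0; rewrite !(lin0 lf) !addr0. Qed.

Lemma linN (f : U -> V) : linear f -> {morph f : x / - x}.
Proof. by move=> lf x; rewrite -scaleN1r linZ // scaleN1r. Qed.

Lemma linB (f : U -> V) : linear f -> {morph f : x y / x - y}.
Proof. by move=> lf x y; rewrite linD // linN. Qed.

Lemma lin_sum (f : U -> V) I (r : seq I) P (F : I -> U) : linear f ->
  f (\sum_(i <- r | P i) F i) = \sum_(i <- r | P i) f (F i).
Proof. by move=> lf; apply: (big_morph f (linD lf) (lin0 lf)). Qed.

Lemma lin_comp (f : U -> V) (g : V -> W) :
  linear f -> linear g -> linear (fun x => g (f x)).
Proof. by move=> lf lg a x y; rewrite lf lg. Qed.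

Lemma lin_add (f g : U -> V) :
  linear f -> linear g -> linear (fun x => f x + g x).
Proof. by move=> lf lg a x y; rewrite lf lg scalerDr addrACA. Qed.

Lemma lin_opp (f : U -> V) : linear f -> linear (fun x => - f x).
Proof. by move=> lf a x y; rewrite lf opprD scalerN. Qed.

Lemma lin_zero : linear (fun _ : U => 0 : V).
Proof. by move=> a x y; rewrite scaler0 addr0. Qed.

Lemma lin_bigsum I (r : seq I) P (F : I -> U -> V) :
  (forall i, linear (F i)) -> linear (fun x => \sum_(i <- r | P i) F i x).
Proof.
move=> lF a x y; rewrite scaler_sumr -big_split /=.
by apply: eq_bigr => i _; rewrite lF.
Qed.

Lemma lin_id : linear (idfun : U -> U).
Proof. by []. Qed.

Definition bilin (b : U -> V -> W) :=
  (forall v, linear (b^~ v)) /\ (forall u, linear (b u)).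

End LinearMaps.

Lemma lin_scaler (R : comNzRingType) (U V : lmodType R) (f : U -> V) c :
  linear f -> linear (fun x => c *: f x).
Proof. by move=> lf a x y; rewrite lf scalerDr !scalerA mulrC. Qed.

Section FpsLinear.
Variables (K : comNzRingType) (V W : lmodType K).

Lemma fps_addE (u v : fps V) n : (u + v) n = u n + v n. Proof. by []. Qed.

Lemma fps_scaleE (a : fps K) (u : fps V) n :
  (a *: u) n = \sum_(i < n.+1) a i *: u (n - i)%N.
Proof. by []. Qed.

Lemma fps_scale_constE (a : K) (u : fps V) n : (fconst a *: u) n = a *: u n.
Proof. by rewrite [LHS](fbil_constl (@biadd_scale K V)). Qed.

Lemma fconst_linear (a : K) (x y : V) :
  fconst (a *: x + y) = fconst a *: fconst x + fconst y.
Proof.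
apply: fpsP => -[|n]; rewrite fps_addE fps_scale_constE //=.
by rewrite scaler0 addr0.
Qed.

Lemma fconstD : {morph @fconst V : x y / x + y}.
Proof. by move=> x y; apply: fpsP => -[|n] //=; rewrite addr0. Qed.

Lemma fconst0 : fconst (0 : V) = 0.
Proof. by apply: fpsP => -[|n]. Qed.

Lemma fconstN : {morph @fconst V : x / - x}.
Proof. by move=> x; apply: fpsP => -[|n] //=; rewrite oppr0. Qed.

Lemma fconst_sum I (r : seq I) P (F : I -> V) :
  fconst (\sum_(i <- r | P i) F i) = \sum_(i <- r | P i) fconst (F i).
Proof. exact: (big_morph _ fconstD fconst0). Qed.

Definition fhbar : fps K := Fps (fun n => (n == 1)%N%:R).
Definition ftail (u : fps V) : fps V := Fps (fun n => u n.+1).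

Lemma fhbar_scaleE (u : fps V) n :
  (fhbar *: u) n = if n is n'.+1 then u n' else 0.
Proof.
rewrite fps_scaleE big_ord_recl /= scale0r add0r.
case: n => [|n]; first by rewrite big_ord0.
by rewrite big_ord_recl /= scale1r subSS subn0 big1 ?addr0 // => i _; rewrite scale0r.
Qed.

Lemma fps_eta (u : fps V) : u = fconst (u 0%N) + fhbar *: ftail u.
Proof.
by apply: fpsP => -[|n]; rewrite fps_addE fhbar_scaleE /= ?addr0 ?add0r.
Qed.

End FpsLinear.

(* A K[[hbar]]-linear map commutes with hbar, so its n-th coefficients are
   determined, by induction on n, by its values on constant series. *)
Lemma fps_lin_ext (K : comNzRingType) (V W : lmodType K) (f g : fps V -> fps W) :
  linear f -> linear g -> (forall v, f (fconst v) = g (fconst v)) -> f =1 g.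
Proof.
move=> lf lg fg u; apply: fpsP => n.
elim: n u => [|n IHn] u; rewrite (fps_eta u) (linD lf) (linD lg) fg;
  rewrite (linZ lf) (linZ lg) !fps_addE !fhbar_scaleE //.
by rewrite IHn.
Qed.

Section Fbil.
Variables (K : comNzRingType) (U V W : lmodType K) (b : U -> V -> W).
Hypothesis lb : bilin b.

Lemma bilin_biadd : biadd b.
Proof.
by split=> [v|u]; [apply: (linD (lb.1 v)) | apply: (linD (lb.2 u))].
Qed.

Lemma fbil_bilin : bilin (fbil b).
Proof.
have bb := bilin_biadd; split=> [v|u] a x y /=.
  rewrite (fbilDl bb); congr (_ + _); apply: fbilA => //.
    exact: biadd_scale.
  by move=> c {}x {}y; rewrite (linZ (lb.1 y)).
rewrite (fbilDr bb); congr (_ + _).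
(* [fbilA] moves a scalar out of the left argument only, so the arguments are exchanged first. *)
rewrite fbilC [RHS](congr1 (fun t => a *: t) (fbilC b u x)); apply: fbilA => //.
- by split; [apply: bb.2 | apply: bb.1].
- exact: biadd_scale.
by move=> c {}x {}y; rewrite (linZ (lb.2 y)).
Qed.

Lemma fbil_const x y : fbil b (fconst x) (fconst y) = fconst (b x y).
Proof.
have bb := bilin_biadd; apply: fpsP => n; rewrite (fbil_constl bb).
by case: n => //= n; rewrite (biadd0r bb).
Qed.

End Fbil.

(** * Linear maps out of modules given by generators and relations *)

Section Presented.
Variables (R : comNzRingType) (X : choiceType) (S : {freeg X / R} -> Prop).
Implicit Type W : lmodType R.

Definition gen (x : X) : lquot S := lcls S << x >>.

Lemma lquot_ind (Q : lquot S -> Prop) : Q 0 ->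
  (forall a x y, Q x -> Q y -> Q (a *: x + y)) -> (forall x, Q (gen x)) ->
  forall x, Q x.
Proof.
move=> Q0 Ql Qg x; rewrite -(lrepK x) -(freeg_sumE (lrep x)).
rewrite (lin_sum _ _ _ (@lcls_is_linear _ _ S)).
elim/big_ind: _ => // [u v Qu Qv|z _]; first by rewrite -[u]scale1r; apply: Ql.
have -> : << coeff z (lrep x) *g z >> = coeff z (lrep x) *: (<< z >> : {freeg X / R}).
  by apply/eqP/freeg_eqP => t; rewrite coeffZ !coeffU mul1r.
rewrite (linZ (@lcls_is_linear _ _ S)) -[_ *: _]addr0; exact: Ql (Qg z) Q0.
Qed.

Lemma lquot_lin_ext W (f g : lquot S -> W) : linear f -> linear g ->
  (forall x, f (gen x) = g (gen x)) -> f =1 g.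
Proof.
move=> lf lg fg; apply: lquot_ind => // [|a x y fgx fgy].
  by rewrite !lin0.
by rewrite lf lg fgx fgy.
Qed.

Lemma fps_lquot_lin_ext W (f g : fps (lquot S) -> fps W) :
  linear f -> linear g -> (forall x, f (fconst (gen x)) = g (fconst (gen x))) ->
  f =1 g.
Proof.
move=> lf lg fg; apply: fps_lin_ext => //; apply: lquot_ind => //.
  by rewrite fconst0 !lin0.
by move=> a x y fgx fgy; rewrite !fconst_linear lf lg fgx fgy.
Qed.

(** [lquot_lift] evaluates at a chosen representative; under this condition the value is independent
    of the choice and the lift is linear. *)
Definition respects W (f : X -> W) := forall r, S r -> fglift f r = 0.

Lemma fglift_linear W (f : X -> W) : linear (fglift f : {freeg X / R} -> W).
Proof. by move=> a x y; rewrite linearP. Qed.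

Lemma lquot_liftE W (f : X -> W) : respects f ->
  forall a, lquot_lift f (lcls S a) = fglift f a.
Proof.
move=> Sf a; apply/eqP; rewrite -subr_eq0 -(linB (fglift_linear f)); apply/eqP.
have /lclsP/asboolP[s [Ss ->]] : lcls S (lrep (lcls S a)) = lcls S a.
  by rewrite lrepK.
rewrite (lin_sum _ _ _ (fglift_linear f)) big_seq big1 // => x /Ss Sx.
by rewrite (linZ (fglift_linear f)) Sf // scaler0.
Qed.

Lemma lquot_lift_gen W (f : X -> W) x : respects f -> lquot_lift f (gen x) = f x.
Proof. by move=> Sf; rewrite lquot_liftE // liftU scale1r. Qed.

Lemma lquot_lift_linear W (f : X -> W) : respects f ->
  linear (lquot_lift f : lquot S -> W).
Proof.
move=> Sf a x y; rewrite -(lrepK x) -(lrepK y) -(@lcls_is_linear _ _ S).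
by rewrite !lquot_liftE // fglift_linear.
Qed.

(** Both sides run over the triples of exponents of sum [n], grouped by the first two or by the last
    two. This associativity of convolution gives the K[[hbar]]-linearity of [linext]. *)
Lemma sum_triangle (W : zmodType) (H : nat -> nat -> nat -> W) n :
  \sum_(i < n.+1) \sum_(j < i.+1) H j (i - j)%N (n - i)%N =
  \sum_(j < n.+1) \sum_(i < (n - j).+1) H j i (n - j - i)%N.
Proof.
have widen m (G : nat -> W) : (m <= n)%N ->
    \sum_(i < m.+1) G i = \sum_(i < n.+1 | (i <= m)%N) G i.
  by move=> lemn; rewrite (big_ord_widen n.+1).
transitivity (\sum_(i < n.+1) \sum_(j < n.+1 | (j <= i)%N) H j (i - j)%N (n - i)%N).
  apply: eq_bigr => i _.
  exact: (widen i (fun j => H j (i - j)%N (n - i)%N) (ltnSE (ltn_ord i))).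
rewrite (exchange_big_dep xpredT) //=; apply: eq_bigr => j _.
pose F i := H j (i - j)%N (n - i)%N.
rewrite -(big_mkord (fun i => j <= i)%N F) (@big_cat_nat _ _ _ j) //=; last first.
  exact: ltnW.
rewrite big_nat_cond big1 ?add0r; last first.
  by move=> i /andP[/andP[_ ltij] leji]; move: ltij; rewrite ltnNge leji.
rewrite -{1}[j : nat]add0n big_addn subSn ?(ltnSE (ltn_ord j)) //.
rewrite -(big_mkord xpredT (fun i => H j i (n - j - i)%N)) big_mkcond.
by apply: eq_bigr => i _; rewrite leq_addl /F addnK [(i + j)%N]addnC subnDA.
Qed.

Lemma linextE W (f : X -> fps W) (a : fps (lquot S)) n :
  linext f a n = \sum_(i < n.+1) lquot_lift (fun x => f x (n - i)%N) (a i).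
Proof. by []. Qed.

Lemma linext_linear W (f : X -> fps W) : (forall n, respects (fun x => f x n)) ->
  linear (linext f : fps (lquot S) -> fps W).
Proof.
move=> Sf a u v; apply: fpsP => n.
have lG m : linear (lquot_lift (fun x => f x m) : lquot S -> W).
  exact: lquot_lift_linear.
rewrite fps_addE fps_scaleE !linextE.
under eq_bigr do rewrite fps_addE (linD (lG _)).
rewrite big_split /=; congr (_ + _).
under eq_bigr do rewrite (lin_sum _ _ _ (lG _)).
under eq_bigr do under eq_bigr do rewrite (linZ (lG _)).
rewrite (sum_triangle (fun j i k => a j *: lquot_lift (fun x => f x k) (u i))).
by apply: eq_bigr => j _; rewrite scaler_sumr.
Qed.

Lemma linext_gen W (f : X -> fps W) x : (forall n, respects (fun x => f x n)) ->
  linext f (fconst (gen x)) = f x.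
Proof.
move=> Sf; apply: fpsP => n /=; rewrite big_ord_recl big1 ?addr0 /=.
  by rewrite subn0 lquot_lift_gen.
by move=> i _; rewrite (lin0 (@lquot_lift_linear _ _ (Sf _))).
Qed.

End Presented.

(** * Tensor products and words *)

Arguments fword : simpl never.

Section TensorProduct.
Variables (K : comNzRingType) (V W : lmodType K).

Lemma tpure_bilin : bilin (@tpure K V W).
Proof.
split=> [y|x] a u v; apply/eqP; rewrite -subr_eq0 opprD addrA -(linZ (@lcls_is_linear _ _ _)).
  rewrite -!(linB (@lcls_is_linear _ _ _)) -(lin0 (@lcls_is_linear _ _ _)).
  by apply/eqP/lclsP; rewrite subr0 mem_relspan //; apply: TensLinl.
rewrite -!(linB (@lcls_is_linear _ _ _)) -(lin0 (@lcls_is_linear _ _ _)).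
by apply/eqP/lclsP; rewrite subr0 mem_relspan //; apply: TensLinr.
Qed.

Lemma ftens_bilin : bilin (@ftens K V W).
Proof. exact: fbil_bilin tpure_bilin. Qed.

Lemma ftens_const x y : ftens (fconst x) (fconst y) = fconst (tpure x y) :> fps (tens V W).
Proof. exact: fbil_const tpure_bilin _ _. Qed.

Variables (U : lmodType K) (b : fps V -> fps W -> fps U).
Hypothesis lb : bilin b.

(** Only constant series enter, but for a K[[hbar]]-bilinear [b] this is the map on the completed
    tensor product through which [b] factors, by [tliftE]. *)
Definition tlift : fps (tens V W) -> fps U :=
  tlinext (fun x y => b (fconst x) (fconst y)).

Lemma tlift_respects n : respects (@tens_rel K V W)
  (fun p => b (fconst p.1) (fconst p.2) n).
Proof.
move=> _ [a x x' y|a x y y']; rewrite !(linB (fglift_linear _)) (linZ (fglift_linear _)).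
  rewrite !liftU !scale1r /= fconst_linear (lb.1 _) fps_addE fps_scale_constE.
  by rewrite -addrA -opprD subrr.
rewrite !liftU !scale1r /= fconst_linear (lb.2 _) fps_addE fps_scale_constE.
by rewrite -addrA -opprD subrr.
Qed.

Lemma tlift_linear : linear tlift.
Proof. exact: linext_linear tlift_respects. Qed.

Lemma tliftE u v : tlift (ftens u v) = b u v.
Proof.
apply: (fps_lin_ext (f := fun u => tlift (ftens u v)) (g := b^~ v)) => {u}.
- by apply: lin_comp tlift_linear; apply: ftens_bilin.1.
- exact: lb.1.
move=> u; apply: (fps_lin_ext (f := fun v => tlift (ftens (fconst u) v))) => {v}.
- by apply: lin_comp tlift_linear; apply: ftens_bilin.2.
- exact: lb.2.
move=> v; rewrite ftens_const.
exact: (@linext_gen _ _ _ _ (fun p => b (fconst p.1) (fconst p.2)) (u, v) tlift_respects).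
Qed.

End TensorProduct.

Lemma tens_lin_ext (K : comNzRingType) (V W U : lmodType K)
    (f g : fps (tens V W) -> fps U) : linear f -> linear g ->
  (forall u v, f (ftens (fconst u) (fconst v)) = g (ftens (fconst u) (fconst v))) ->
  f =1 g.
Proof.
move=> lf lg fg; apply: (@fps_lquot_lin_ext _ _ _ _ f g) => // -[u v].
by have := fg u v; rewrite ftens_const.
Qed.

(* The action is a parameter because words over V[[hbar]] and words over V are
   both mapped to K[[hbar]]-modules. *)
Definition wlin (K : nzRingType) (V : lmodType K) (M : zmodType)
    (act : K -> M -> M) (F : seq V -> M) :=
  forall u v a x y,
    F (u ++ (a *: x + y) :: v) = act a (F (u ++ x :: v)) + F (u ++ y :: v).

Definition fscale (K : comNzRingType) (V : lmodType K) (a : K) (t : fps V) : fps V :=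
  fconst a *: t.
Arguments fscale {K V}.

(** * Sums over the factorizations of a word *)

Section Cuts.
Variables (T : Type) (M : zmodType).
Implicit Types (F G : seq T -> seq T -> M) (s : seq T).

(* The sum of F u v over all the factorizations s = u ++ v. *)
Fixpoint cut2 F s : M :=
  F [::] s + (if s is x :: s' then cut2 (fun u v => F (x :: u) v) s' else 0).

Lemma cut2_nil F : cut2 F [::] = F [::] [::]. Proof. by rewrite /= addr0. Qed.

Lemma cut2_cons F x s :
  cut2 F (x :: s) = F [::] (x :: s) + cut2 (fun u v => F (x :: u) v) s.
Proof. by []. Qed.

Lemma cut2E F s : cut2 F s = \sum_(0 <= i < (size s).+1) F (take i s) (drop i s).
Proof.
elim: s F => [|x s IHs] F; first by rewrite cut2_nil big_nat1.
by rewrite cut2_cons IHs [RHS]big_nat_recl.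
Qed.

Lemma eq_cut2 F G s :
  (forall u v, s = u ++ v -> F u v = G u v) -> cut2 F s = cut2 G s.
Proof.
elim: s F G => [|x s IHs] F G FG; first by rewrite !cut2_nil FG.
rewrite !cut2_cons FG //; congr (_ + _).
by apply: IHs => u v Es; apply: FG; rewrite Es.
Qed.

Lemma cut2D F G s : cut2 (fun u v => F u v + G u v) s = cut2 F s + cut2 G s.
Proof.
elim: s F G => [|x s IHs] F G; first by rewrite !cut2_nil.
by rewrite !cut2_cons IHs addrACA.
Qed.

Lemma cut20 s : cut2 (fun _ _ => 0) s = 0.
Proof. by elim: s => [|x s IHs]; rewrite ?cut2_nil // cut2_cons IHs addr0. Qed.

Lemma cut2_counitl F s : cut2 (fun u v => if nilp u then F u v else 0) s = F [::] s.
Proof. by case: s => [|x s]; rewrite ?cut2_nil // cut2_cons /= cut20 addr0. Qed.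

Lemma cut2_counitr F s : cut2 (fun u v => if nilp v then F u v else 0) s = F s [::].
Proof. by elim: s F => [|x s IHs] F; rewrite ?cut2_nil // cut2_cons /= IHs add0r. Qed.

(** Coassociativity of deconcatenation: both sides run over the factorizations of [s] into three
    words. *)
Lemma cut2A (H : seq T -> seq T -> seq T -> M) s :
  cut2 (fun u w => cut2 (fun v w => H u v w) w) s =
  cut2 (fun u w => cut2 (fun u v => H u v w) u) s.
Proof.
elim: s H => [|x s IHs] H; first by rewrite !cut2_nil.
rewrite !cut2_cons cut2_nil IHs -addrA; congr (_ + _).
by rewrite -cut2D; apply: eq_cut2 => u v _; rewrite cut2_cons.
Qed.

End Cuts.

Lemma cut2_morph T (M N : zmodType) (f : M -> N) (F : seq T -> seq T -> M) s :
  {morph f : x y / x + y} -> f (cut2 F s) = cut2 (fun u v => f (F u v)) s.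
Proof.
move=> fD; elim: s F => [|x s IHs] F; first by rewrite !cut2_nil.
by rewrite !cut2_cons fD IHs.
Qed.

Lemma cut2_exchange T T' (M : zmodType) (F : seq T -> seq T -> seq T' -> seq T' -> M) s t :
  cut2 (fun u v => cut2 (fun u' v' => F u v u' v') t) s =
  cut2 (fun u' v' => cut2 (fun u v => F u v u' v') s) t.
Proof.
elim: s F => [|x s IHs] F.
  by rewrite cut2_nil; apply: eq_cut2 => u v _; rewrite cut2_nil.
by rewrite cut2_cons IHs -cut2D; apply: eq_cut2 => u v _; rewrite cut2_cons.
Qed.

Lemma cut2_map T T' (M : zmodType) (h : T -> T') (F : seq T' -> seq T' -> M) s :
  cut2 F (map h s) = cut2 (fun u v => F (map h u) (map h v)) s.
Proof.
elim: s F => [|x s IHs] F; first by rewrite !cut2_nil.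
by rewrite map_cons !cut2_cons IHs.
Qed.

Section WordLinear.
Variables (K : nzRingType) (V : lmodType K) (M : zmodType) (act : K -> M -> M).
Hypothesis actD : forall a, {morph act a : x y / x + y}.

Lemma act0 a : act a 0 = 0.
Proof. by apply: (@addrI _ (act a 0)); rewrite -actD !addr0. Qed.

Lemma wlin_add F G : wlin act F -> wlin act G -> wlin (V := V) act (fun s => F s + G s).
Proof. by move=> lF lG u v a x y; rewrite lF lG actD addrACA. Qed.

Lemma wlin_zero : wlin (V := V) act (fun=> 0).
Proof. by move=> u v a x y; rewrite act0 addr0. Qed.

Lemma wlin_nilp (m : M) : wlin (V := V) act (fun s => if nilp s then m else 0).
Proof. by move=> [|? ?] v a x y /=; rewrite act0 addr0. Qed.

Lemma wlin_unless_nilp (F : seq V -> M) : wlin act F ->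
  wlin (V := V) act (fun s => if nilp s then 0 else F s).
Proof. by move=> lF u v a x y; rewrite lF; case: u. Qed.

(** In each factorization the distinguished letter lies in exactly one of the two pieces, where [F]
    is linear in it. *)
Lemma wlin_cut2 F : (forall v, wlin act (F^~ v)) -> (forall u, wlin act (F u)) ->
  wlin (V := V) act (cut2 F).
Proof.
move=> lFl lFr u; elim: u F lFl lFr => [|z u IHu] F lFl lFr v a x y.
  rewrite /= (lFr [::] [::]) actD addrACA; congr (_ + _).
  rewrite (cut2_morph _ _ (actD a)) -cut2D.
  by apply: eq_cut2 => u w _; rewrite (lFl _ [::]).
rewrite /= (lFr [::] (z :: u)) actD addrACA; congr (_ + _).
apply: IHu => [w|w] u1 v1 b x1 y1; first exact: (lFl w (z :: u1)).
exact: (lFr (z :: w)).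
Qed.

Lemma wlin_cut2_param T (F : seq V -> seq T -> seq T -> M) t :
  (forall u v, wlin act (fun s => F s u v)) ->
  wlin (V := V) act (fun s => cut2 (F s) t).
Proof.
move=> lF u v a x y; rewrite (cut2_morph _ _ (actD a)) -cut2D.
by apply: eq_cut2 => u' v' _; rewrite lF.
Qed.

End WordLinear.

Lemma wlin_comp (K : nzRingType) (V : lmodType K) (M N : zmodType)
    (actM : K -> M -> M) (actN : K -> N -> N) (f : M -> N) (F : seq V -> M) :
  {morph f : x y / x + y} -> (forall a x, f (actM a x) = actN a (f x)) ->
  wlin actM F -> wlin actN (fun s => f (F s)).
Proof. by move=> fD fZ lF u v a x y; rewrite lF fD fZ. Qed.

Lemma wlin_lin (K : nzRingType) (V M N : lmodType K) (f : M -> N) (F : seq V -> M) :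
  linear f -> wlin *:%R F -> wlin *:%R (fun s => f (F s)).
Proof. by move=> lf lF u v a x y; rewrite lF lf. Qed.

(** * Maps from the tensor algebra and multilinear functions of words *)

Section TensorAlgebraWords.
Variables (K : comNzRingType) (V : lmodType K).
Local Notation L := (fps V).
Local Notation T := (fps (tensorAlg V)).

Section Lift.
Variables (W : lmodType K) (f : seq V -> fps W).
Hypothesis lf : wlin fscale f.

Lemma word_respects n : respects (@word_rel K V) (fun w => f w n).
Proof.
move=> _ [u v a x y]; rewrite !(linB (fglift_linear _)) (linZ (fglift_linear _)).
rewrite !liftU !scale1r lf fps_addE fps_scale_constE.
by rewrite -addrA -opprD subrr.
Qed.

Lemma klift_linear : linear (linext f : T -> fps W).
Proof. exact: linext_linear word_respects. Qed.

Lemma kliftE w : linext f (fconst (tword w) : T) = f w.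
Proof. exact: (linext_gen _ word_respects). Qed.

End Lift.

Lemma tword_wlin : wlin *:%R (@tword K V).
Proof.
move=> u v a x y; apply/eqP; rewrite -subr_eq0 opprD addrA.
rewrite -(linZ (@lcls_is_linear _ _ _)) -!(linB (@lcls_is_linear _ _ _)).
rewrite -(lin0 (@lcls_is_linear _ _ _)).
by apply/eqP/lclsP; rewrite subr0 mem_relspan //; apply: WordLin.
Qed.

Lemma T_lin_ext (W : lmodType K) (f g : T -> fps W) : linear f -> linear g ->
  (forall w, f (fconst (tword w)) = g (fconst (tword w))) -> f =1 g.
Proof. by move=> lf lg fg; apply: fps_lquot_lin_ext. Qed.

Lemma tcons_respects x : respects (@word_rel K V) (fun w => tword (x :: w)).
Proof.
move=> _ [u v a y z]; rewrite !(linB (fglift_linear _)) (linZ (fglift_linear _)).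
rewrite !liftU !scale1r (tword_wlin (x :: u)) -addrA -opprD; exact: subrr.
Qed.

Lemma tconsE x w : tcons x (tword w : tensorAlg V) = tword (x :: w).
Proof. exact: (lquot_lift_gen _ (@tcons_respects x)). Qed.

Lemma tcons_bilin : bilin (@tcons K V).
Proof.
split=> [t|x]; last exact: lquot_lift_linear (@tcons_respects x).
move=> a x y; apply: (lquot_lin_ext
   (f := tcons (a *: x + y)) (g := fun t => a *: tcons x t + tcons y t)) => //.
- exact: lquot_lift_linear (@tcons_respects _).
- apply: lin_add; last exact: lquot_lift_linear (@tcons_respects _).
  by apply: lin_scaler; apply: lquot_lift_linear (@tcons_respects _).
by move=> w; rewrite !tconsE (tword_wlin [::]).
Qed.

Definition fcons : L -> T -> T := fbil (@tcons K V).

Lemma fcons_bilin : bilin fcons.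
Proof. exact: fbil_bilin tcons_bilin. Qed.

Lemma fcons0 t : fcons 0 t = 0.
Proof. exact: lin0 (fcons_bilin.1 t). Qed.

Lemma fword_cons x s : fword (x :: s) = fcons x (fword s). Proof. by []. Qed.

Lemma fword_wlin : wlin *:%R (@fword K V).
Proof.
elim=> [|z u IHu] v a x y; first exact: (fcons_bilin.1 (fword v)).
by have := congr1 (fcons z) (IHu v a x y); rewrite (fcons_bilin.2 z).
Qed.

Lemma fword_const w : fword (map (@fconst V) w) = fconst (tword w).
Proof.
elim: w => // x w IHw; rewrite map_cons fword_cons IHw /fcons.
by rewrite (fbil_const tcons_bilin) tconsE.
Qed.

Lemma word_ext (W : lmodType K) (F G : seq L -> fps W) :
  wlin *:%R F -> wlin *:%R G ->
  (forall w, F (map (@fconst V) w) = G (map (@fconst V) w)) -> F =1 G.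
Proof.
move=> lF lG FG s.
(* Letters are replaced by constant ones from left to right; [u] is the prefix already treated. *)
suff H u : F (map (@fconst V) u ++ s) = G (map (@fconst V) u ++ s) by apply: (H [::]).
elim: s u => [|x s IHs] u; first by rewrite cats0.
apply: (fps_lin_ext (f := fun x => F (map (@fconst V) u ++ x :: s))
  (g := fun x => G (map (@fconst V) u ++ x :: s))) => [a y z|a y z|y].
- exact: lF.
- exact: lG.
by have := IHs (rcons u y); rewrite map_rcons cat_rcons.
Qed.

(** The values of a multilinear [F] on words with constant letters determine all the others, by
    [word_ext], so keeping only these loses nothing. *)
Definition wlift (W : lmodType K) (F : seq L -> fps W) : T -> fps W :=
  linext (fun w => F (map (@fconst V) w)).

Section WordLift.
Variables (W : lmodType K) (F : seq L -> fps W).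
Hypothesis lF : wlin *:%R F.

Lemma wlin_const : wlin fscale (fun w => F (map (@fconst V) w)).
Proof.
by move=> u v a x y; rewrite !map_cat /= fconst_linear lF.
Qed.

Lemma wlift_linear : linear (wlift F).
Proof. exact: klift_linear wlin_const. Qed.

Lemma wliftE s : wlift F (fword s) = F s.
Proof.
apply: (word_ext (F := fun s => wlift F (fword s))) => // [|w].
  by apply: wlin_lin fword_wlin; apply: wlift_linear.
by rewrite fword_const [LHS](kliftE wlin_const).
Qed.

End WordLift.

Lemma T_word_ext (W : lmodType K) (f g : T -> fps W) : linear f -> linear g ->
  (forall s, f (fword s) = g (fword s)) -> f =1 g.
Proof. by move=> lf lg fg; apply: T_lin_ext => // w; rewrite -fword_const fg. Qed.

End TensorAlgebraWords.

(** * Deconcatenation and coalgebra morphisms *)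

Notation allnil := (all (@nilp _)).

Section TupleCuts.
Variables (T : Type) (M : zmodType).
Implicit Types (F G : seq (seq T) -> seq (seq T) -> M) (X : seq (seq T)).

(** Deconcatenation on a tensor power of the coalgebra of words: the left pieces form one tuple and
    the right pieces another. *)
Fixpoint cutm F X : M :=
  if X is s :: X' then cut2 (fun u v => cutm (fun A B => F (u :: A) (v :: B)) X') s
  else F [::] [::].

Definition msize X := sumn (map size X).

Lemma msize0 X : (msize X == 0)%N = allnil X.
Proof. by elim: X => //= s X IHX; rewrite addn_eq0 IHX. Qed.

(** The side conditions are what inductions on the total length use: the pieces are tuples of the
    same size, and their total lengths add up. *)
Lemma eq_cutm F G X :
  (forall A B, size A = size X -> size B = size X ->
     (msize A + msize B = msize X)%N -> F A B = G A B) ->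
  cutm F X = cutm G X.
Proof.
elim: X F G => [|s X IHX] F G FG /=; first exact: FG.
apply: eq_cut2 => u v Es; apply: IHX => A B sA sB mAB.
by apply: FG; rewrite /= ?sA ?sB // /msize /= addnACA mAB Es size_cat.
Qed.

Lemma cutmD F G X : cutm (fun A B => F A B + G A B) X = cutm F X + cutm G X.
Proof.
elim: X F G => //= s X IHX F G; rewrite -cut2D.
by apply: eq_cut2 => u v _; apply: IHX.
Qed.

Lemma cutm0 X : cutm (fun _ _ => 0) X = 0.
Proof.
elim: X => //= s X IHX; rewrite -[RHS](cut20 M s).
by apply: eq_cut2 => u v _; apply: IHX.
Qed.

Lemma cutm_counitl F X :
  cutm (fun A B => if allnil A then F A B else 0) X = F (nseq (size X) [::]) X.
Proof.
elim: X F => //= s X IHX F; rewrite -(IHX (fun A B => F ([::] :: A) (s :: B))).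
rewrite -[RHS](cut2_counitl (fun u v => cutm (fun A B =>
   if allnil A then F (u :: A) (v :: B) else 0) X) s).
apply: eq_cut2 => u v _; case: nilp => //=; exact: cutm0.
Qed.

Lemma cutm_counitr F X :
  cutm (fun A B => if allnil B then F A B else 0) X = F X (nseq (size X) [::]).
Proof.
elim: X F => //= s X IHX F; rewrite -(IHX (fun A B => F (s :: A) ([::] :: B))).
rewrite -[RHS](cut2_counitr (fun u v => cutm (fun A B =>
   if allnil B then F (u :: A) (v :: B) else 0) X) s).
apply: eq_cut2 => u v _; case: nilp => //=; exact: cutm0.
Qed.

Lemma cutm_cut2_exchange T' (F : seq (seq T) -> seq (seq T) -> seq T' -> seq T' -> M) X s :
  cutm (fun A B => cut2 (fun u v => F A B u v) s) X =
  cut2 (fun u v => cutm (fun A B => F A B u v) X) s.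
Proof.
elim: X F => //= t X IHX F.
rewrite -cut2_exchange; apply: eq_cut2 => u v _; exact: IHX.
Qed.

Lemma cutmA (H : seq (seq T) -> seq (seq T) -> seq (seq T) -> M) X :
  cutm (fun A C => cutm (fun B C => H A B C) C) X =
  cutm (fun A C => cutm (fun A B => H A B C) A) X.
Proof.
elim: X H => //= s X IHX H.
under [LHS](@eq_cut2 T M) => u w _ do rewrite cutm_cut2_exchange.
under [RHS](@eq_cut2 T M) => u w _ do rewrite cutm_cut2_exchange.
rewrite cut2A; apply: eq_cut2 => u w _; apply: eq_cut2 => v z _.
exact: IHX.
Qed.

End TupleCuts.

Lemma cutm_morph T (M N : zmodType) (f : M -> N) F (X : seq (seq T)) :
  {morph f : x y / x + y} -> f (cutm F X) = cutm (fun A B => f (F A B)) X.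
Proof.
move=> fD; elim: X F => //= s X IHX F.
by rewrite (cut2_morph _ _ fD); apply: eq_cut2 => u v _; apply: IHX.
Qed.

Section TensorCoalgebra.
Variables (K : comNzRingType) (V : lmodType K).
Local Notation L := (fps V).
Local Notation T := (fps (tensorAlg V)).
Local Notation one := (fword [::] : T).
Implicit Types (s : seq L) (t : T).

Definition teps : T -> fps K := @linext K _ _ K^o (fun w => fconst (nilp w)%:R).

Lemma teps_wliftE t : teps t = wlift (fun s => if nilp s then (1 : fps K^o) else 0) t.
Proof.
rewrite /teps; set f := (fun w : seq V => _).
suff -> : f = (fun w => if nilp (map (@fconst V) w) then (1 : fps K^o) else 0) by [].
apply/funext => -[|x w]; [exact: erefl|exact: (@fconst0 K K^o)].
Qed.

Lemma teps_linear : linear (teps : T -> fps K^o).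
Proof.
move=> a x y; rewrite !teps_wliftE; apply: wlift_linear.
by apply: wlin_nilp => b u v; rewrite scalerDr.
Qed.

Lemma teps_word s : teps (fword s) = if nilp s then 1 else 0.
Proof.
by rewrite teps_wliftE wliftE //; apply: wlin_nilp => b u v; rewrite scalerDr.
Qed.

Lemma teps_cons x t : teps (fcons x t) = 0.
Proof.
apply: (T_word_ext (W := K^o) (f := fun t => teps (fcons x t)) (g := fun=> 0)).
- by apply: lin_comp teps_linear; apply: (fcons_bilin V).2.
- exact: lin_zero.
by move=> s; rewrite -fword_cons teps_word.
Qed.

Definition tpi : T -> L := wlift (fun s => if s is [:: x] then x else 0).

Lemma tpi_wlin : wlin *:%R (fun s : seq L => if s is [:: x] then x else 0).
Proof.
move=> [|z [|z' u]] [|z1 v] a x y //=; rewrite ?scaler0 ?addr0 //.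
Qed.

Lemma tpi_linear : linear tpi.
Proof. exact: wlift_linear tpi_wlin. Qed.

Lemma tpi_word s : tpi (fword s) = if s is [:: x] then x else 0.
Proof. exact: wliftE tpi_wlin _. Qed.

Lemma tpi_cons x t : tpi (fcons x t) = teps t *: x.
Proof.
apply: (T_word_ext (f := fun t => tpi (fcons x t)) (g := fun t => teps t *: x)).
- by apply: lin_comp tpi_linear; apply: (fcons_bilin V).2.
- by move=> a u v; rewrite teps_linear scalerDl scalerA.
move=> s; rewrite -fword_cons tpi_word teps_word.
by case: s => [|y s]; rewrite ?scale1r ?scale0r.
Qed.

Section Comultiplication.
Variables (W : lmodType K) (G : T -> T -> fps W).

(* The sum of G t_(1) t_(2), in Sweedler's notation. *)
Definition sweedler : T -> fps W := wlift (cut2 (fun u v => G (fword u) (fword v))).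

Hypothesis lG : bilin G.

Lemma sweedler_wlin : wlin *:%R (cut2 (fun u v : seq L => G (fword u) (fword v))).
Proof.
apply: wlin_cut2 => [a x y|v|u]; first by rewrite scalerDr.
  by apply: (wlin_lin (lG.1 _)); apply: fword_wlin.
by apply: (wlin_lin (lG.2 _)); apply: fword_wlin.
Qed.

Lemma sweedler_linear : linear sweedler.
Proof. exact: wlift_linear sweedler_wlin. Qed.

Lemma sweedler_word s : sweedler (fword s) = cut2 (fun u v => G (fword u) (fword v)) s.
Proof. exact: wliftE sweedler_wlin _. Qed.

Lemma sweedler_one : sweedler one = G one one.
Proof. by rewrite sweedler_word cut2_nil. Qed.

End Comultiplication.

Lemma sweedler_comp (W W' : lmodType K) (f : fps W -> fps W') (G : T -> T -> fps W) t :
  linear f -> bilin G -> f (sweedler G t) = sweedler (fun x y => f (G x y)) t.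
Proof.
move=> lf lG; have lfG : bilin (fun x y => f (G x y)).
  by split=> u; apply: lin_comp lf; [apply: lG.1|apply: lG.2].
apply: (T_word_ext (f := fun t => f (sweedler G t))) t => [||s].
- by apply: lin_comp lf; apply: sweedler_linear.
- exact: sweedler_linear.
by rewrite !sweedler_word // (cut2_morph _ _ (linD lf)).
Qed.

Lemma sweedler_zero (W : lmodType K) t : sweedler (fun _ _ => 0 : fps W) t = 0.
Proof.
have b0 : bilin (fun _ _ : T => 0 : fps W) by split=> u; apply: lin_zero.
apply: (T_word_ext (g := fun=> 0)) t => [||s]; [exact: sweedler_linear|exact: lin_zero|].
by rewrite sweedler_word // cut20.
Qed.

Lemma wlift_param_linear (U : lmodType (fps K)) (W : lmodType K) (F : U -> seq L -> fps W) t :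
  (forall s, linear (F^~ s)) -> (forall u, wlin *:%R (F u)) ->
  linear (fun u => wlift (F u) t).
Proof.
move=> lF wF a x y.
apply: (T_word_ext (g := fun t => a *: wlift (F x) t + wlift (F y) t)) t => [||s].
- exact: wlift_linear.
- by apply: lin_add; [apply: lin_scaler|]; apply: wlift_linear.
by rewrite !wliftE // lF.
Qed.

Lemma cut2_param_linear (R : nzRingType) (U M : lmodType R) S (F : U -> seq S -> seq S -> M) (s : seq S) :
  (forall u v, linear (fun x => F x u v)) -> linear (fun x => cut2 (F x) s).
Proof.
move=> lF a x y; rewrite (cut2_morph _ _ (scalerDr a)) -cut2D.
by apply: eq_cut2 => u v _; apply: lF.
Qed.

Definition trilin (R : nzRingType) (U1 U2 U3 W : lmodType R) (H : U1 -> U2 -> U3 -> W) :=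
  (forall y z, linear (fun x => H x y z)) /\ (forall x, bilin (H x)).

Lemma sweedler_param_linear (U : lmodType (fps K)) (W : lmodType K) (H : U -> T -> T -> fps W) t :
  trilin H -> linear (fun u => sweedler (H u) t).
Proof.
move=> [lH bH]; apply: wlift_param_linear => [s|u]; last exact: sweedler_wlin.
by apply: cut2_param_linear => u v; apply: lH.
Qed.

Lemma trilin_rot (R : nzRingType) (U1 U2 U3 W : lmodType R) (H : U1 -> U2 -> U3 -> W) :
  trilin H -> trilin (fun z x y => H x y z).
Proof.
move=> [lH bH]; split=> [y z|x]; first exact: (bH y).2.
by split=> u; [apply: lH | apply: (bH u).1].
Qed.

(** Coassociativity, tested against trilinear maps in place of a triple tensor product. *)
Lemma sweedlerA (W : lmodType K) (H : T -> T -> T -> fps W) t : trilin H ->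
  sweedler (fun a b => sweedler (H a) b) t = sweedler (fun a b => sweedler (fun c d => H c d b) a) t.
Proof.
move=> tH; have bl : bilin (fun a b => sweedler (H a) b).
  split=> u; first exact: sweedler_param_linear.
  by apply: sweedler_linear; apply: tH.2.
have br : bilin (fun a b => sweedler (fun c d => H c d b) a).
  split=> u; last by apply: (@sweedler_param_linear _ _ (fun z x y => H x y z)); apply: trilin_rot.
  by apply: sweedler_linear; apply: (trilin_rot tH).2.
apply: T_word_ext t => [||s]; try exact: sweedler_linear.
rewrite !sweedler_word //.
rewrite (@eq_cut2 _ _ _ (fun u v => cut2 (fun v w => H (fword u) (fword v) (fword w)) v)).
  rewrite cut2A; apply: eq_cut2 => u v _; rewrite sweedler_word //.
  exact: (trilin_rot tH).2.
by move=> u v _; rewrite sweedler_word //; apply: tH.2.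
Qed.

Lemma sweedler_counitl (W : lmodType K) (f : T -> fps W) t : linear f ->
  sweedler (fun a b => teps a *: f b) t = f t.
Proof.
move=> lf; have bf : bilin (fun a b => teps a *: f b).
  split=> u; last by apply: lin_scaler.
  by move=> a x y; rewrite teps_linear scalerDl scalerA.
apply: T_word_ext t => [||s] //; first exact: sweedler_linear.
rewrite sweedler_word // -[RHS](cut2_counitl (fun u v => f (fword v)) s).
by apply: eq_cut2 => u v _; rewrite teps_word; case: nilp; rewrite ?scale1r ?scale0r.
Qed.

Lemma sweedler_counitr (W : lmodType K) (f : T -> fps W) t : linear f ->
  sweedler (fun a b => teps b *: f a) t = f t.
Proof.
move=> lf; have bf : bilin (fun a b => teps b *: f a).
  split=> u; first by apply: lin_scaler.
  by move=> a x y; rewrite teps_linear scalerDl scalerA.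
apply: T_word_ext t => [||s] //; first exact: sweedler_linear.
rewrite sweedler_word // -[RHS](cut2_counitr (fun u v => f (fword u)) s).
by apply: eq_cut2 => u v _; rewrite teps_word; case: nilp; rewrite ?scale1r ?scale0r.
Qed.

Lemma sweedler_cons (W : lmodType K) (G : T -> T -> fps W) x t : bilin G ->
  sweedler G (fcons x t) = G one (fcons x t) + sweedler (fun u v => G (fcons x u) v) t.
Proof.
move=> lG; have bG : bilin (fun u v => G (fcons x u) v).
  split=> v; last exact: lG.2.
  by apply: lin_comp (lG.1 v); apply: (fcons_bilin V).2.
apply: (T_word_ext (f := fun t => sweedler G (fcons x t))
   (g := fun t => G one (fcons x t) + sweedler (fun u v => G (fcons x u) v) t)) t => [||s].
- by apply: lin_comp (sweedler_linear lG); apply: (fcons_bilin V).2.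
- apply: lin_add; last exact: sweedler_linear.
  by apply: lin_comp (lG.2 _); apply: (fcons_bilin V).2.
by rewrite -fword_cons !sweedler_word // cut2_cons.
Qed.

(* An element of the cofree coalgebra is recovered from its coproduct by
   projecting the left factor to the cogenerators. *)
Lemma T_eta t : t = teps t *: one + sweedler (fun a b => fcons (tpi a) b) t.
Proof.
have bG : bilin (fun a b => fcons (tpi a) b).
  split=> u; last exact: (fcons_bilin V).2.
  exact: (lin_comp tpi_linear ((fcons_bilin V).1 u)).
apply: (T_word_ext (f := idfun)
  (g := fun t => teps t *: one + sweedler (fun a b => fcons (tpi a) b) t)) t => [||s] //.
  apply: lin_add; last exact: sweedler_linear.
  by move=> a u v; rewrite teps_linear scalerDl scalerA.
rewrite sweedler_word // teps_word; case: s => [|x s].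
  by rewrite scale1r cut2_nil tpi_word fcons0 addr0.
rewrite scale0r add0r cut2_cons tpi_word fcons0 add0r.
rewrite -[LHS](cut2_counitl (fun u v => fcons x (fword v)) s).
by apply: eq_cut2 => u v _; rewrite tpi_word; case: u => // *; rewrite fcons0.
Qed.

(* An n-tuple of words stands for an element of the n-th tensor power of the
   tensor coalgebra: Phi is a morphism of coalgebras. *)
Record comult (n : nat) (Phi : seq (seq L) -> T) : Prop := Comult {
  comult_empty : forall X, size X = n -> allnil X -> Phi X = one;
  comult_eps : forall X, size X = n -> ~~ allnil X -> teps (Phi X) = 0;
  comult_sweedler : forall (W : lmodType K) (G : T -> T -> fps W) X, bilin G -> size X = n ->
    sweedler G (Phi X) = cutm (fun A B => G (Phi A) (Phi B)) X
}.

(** By [T_eta], the value at a tuple that is not all empty is rebuilt from the projection at the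
    left pieces and the value at the right pieces. Either the left pieces are all empty and their
    projection is 0, or the right pieces have smaller total length and induction applies. *)
Lemma comult_uniq n Phi Psi : comult n Phi -> comult n Psi ->
  (forall X, size X = n -> tpi (Phi X) = tpi (Psi X)) ->
  forall X, size X = n -> Phi X = Psi X.
Proof.
move=> cPhi cPsi piE X; have [m] := ubnP (msize X).
elim: m X => // m IHm X; rewrite ltnS => leXm sX.
have [eX|neX] := boolP (allnil X).
  by rewrite (comult_empty cPhi) ?(comult_empty cPsi).
have bG : bilin (fun a b => fcons (tpi a) b).
  split=> u; last exact: (fcons_bilin V).2.
  exact: (lin_comp tpi_linear ((fcons_bilin V).1 u)).
rewrite [LHS]T_eta [RHS]T_eta (comult_eps cPhi) // (comult_eps cPsi) // !scale0r !add0r.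
rewrite (comult_sweedler cPhi) // (comult_sweedler cPsi) //; apply: eq_cutm => A B sA sB mAB.
have [eA|neA] := boolP (allnil A).
  by rewrite (comult_empty cPhi) ?sA // (comult_empty cPsi) ?sA // tpi_word !fcons0.
rewrite piE ?sA // IHm ?sB //; apply: leq_trans leXm; rewrite -mAB.
by rewrite -[X in (X < _)%N]add0n ltn_add2r lt0n msize0.
Qed.

Section Recursion.
Variables (n : nat) (f : seq (seq L) -> L) (Phi : seq (seq L) -> T).
Hypothesis f_empty : forall X, size X = n -> allnil X -> f X = 0.
Hypothesis PhiE : forall X, size X = n ->
  Phi X = (if allnil X then one else 0) + cutm (fun A B => fcons (f A) (Phi B)) X.

(** [PhiE] is the recursion that [T_eta] forces on a coalgebra morphism with projection [f].
    Conversely, to cut [fcons (f A) (Phi B)] after its first letter is to cut [Phi B], where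
    induction applies, and [cutmA] reassembles the pieces by the same recursion. *)
Lemma rec_comult : comult n Phi.
Proof.
split=> [X sX eX|X sX neX|W G X bG sX].
- rewrite PhiE // eX (@eq_cutm _ _ _ (fun _ _ => 0)) ?cutm0 ?addr0 // => A B sA _ mAB.
  rewrite f_empty ?fcons0 ?sA // -msize0 -leqn0; apply: (@leq_trans (msize X)).
    by rewrite -mAB leq_addr.
  by rewrite leqn0 msize0.
- rewrite PhiE // (negPf neX) add0r (cutm_morph _ _ (linD teps_linear)).
  by rewrite (@eq_cutm _ _ _ (fun _ _ => 0)) ?cutm0 // => A B *; rewrite teps_cons.
have [m] := ubnP (msize X); elim: m X G bG sX => // m IHm X G bG sX.
rewrite ltnS => leXm.
have swD := linD (sweedler_linear bG).
(* The first term collects the cuts before the first letter, the second those after it. *)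
transitivity (G one (Phi X) +
    cutm (fun A D => cutm (fun B C => G (fcons (f A) (Phi B)) (Phi C)) D) X).
  rewrite [in LHS]PhiE // swD (cutm_morph _ _ swD).
  rewrite [in RHS]PhiE // (linD (bG.2 _)) (cutm_morph _ _ (linD (bG.2 _))).
  rewrite -addrA -cutmD; congr (_ + _).
    by case: ifP => _; rewrite ?sweedler_one // (lin0 (bG.2 _)) (lin0 (sweedler_linear bG)).
  apply: eq_cutm => A B sA sB mAB; rewrite sweedler_cons //; congr (_ + _).
  (* For empty left pieces [B] is as long as [X], out of reach of the induction, but both sides
     vanish with [f A]. *)
  have [eA|neA] := boolP (allnil A).
    have G0 u v : G (fcons (f A) u) v = 0.
      by rewrite f_empty ?sA // fcons0 (lin0 (bG.1 _)).
    under [RHS]eq_cutm do rewrite G0.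
    rewrite cutm0 -[RHS](sweedler_zero _ (Phi B)).
    by congr (sweedler _ _); apply/funext => u; apply/funext => v.
  rewrite (IHm B (fun u v => G (fcons (f A) u) v)) //.
  - split=> v; last exact: bG.2.
    by apply: lin_comp (bG.1 v); apply: (fcons_bilin V).2.
  - by rewrite sB.
  apply: leq_trans leXm; rewrite -mAB -[X in (X < _)%N]add0n ltn_add2r lt0n.
  by rewrite msize0.
(* Written as a sum over cuts, this term supplies the summand [one] that the recursion for [Phi A]
   has at empty [A]. *)
rewrite cutmA; have G1 : G one (Phi X) =
    cutm (fun A B => if allnil A then G one (Phi B) else 0) X.
  by rewrite cutm_counitl.
rewrite G1 -cutmD; apply: eq_cutm => A B sA sB _.
rewrite (PhiE (X := A)) ?sA // (linD (bG.1 _)) (cutm_morph _ _ (linD (bG.1 _))).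
by case: ifP => _; rewrite ?(lin0 (bG.1 _)).
Qed.

Lemma rec_tpi X : size X = n -> tpi (Phi X) = f X.
Proof.
move=> sX; rewrite PhiE // (linD tpi_linear) (cutm_morph _ _ (linD tpi_linear)).
rewrite (_ : tpi _ = 0) ?add0r; last first.
  by case: ifP => _; rewrite ?tpi_word ?(lin0 tpi_linear).
rewrite -[RHS](cutm_counitr (fun A B => f A) X); apply: eq_cutm => A B sA sB _.
rewrite tpi_cons; case: ifPn => eB.
  by rewrite (comult_empty rec_comult) ?sB // teps_word scale1r.
by rewrite (comult_eps rec_comult) ?sB // scale0r.
Qed.

End Recursion.

(* [A k] collects the decompositions into exactly k blocks. *)
Lemma blocks_rec (n : nat) (f : seq (seq L) -> L) (A : nat -> seq (seq L) -> T) :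
  (forall X, size X = n -> allnil X -> f X = 0) ->
  (forall X, size X = n -> A 0%N X = if allnil X then one else 0) ->
  (forall k X, size X = n -> A k.+1 X = cutm (fun Y Z => fcons (f Y) (A k Z)) X) ->
  let Phi X := \sum_(0 <= k < (msize X).+1) A k X in
  forall X, size X = n ->
  Phi X = (if allnil X then one else 0) + cutm (fun Y Z => fcons (f Y) (Phi Z)) X.
Proof.
move=> f0 A0 AS Phi X sX.
(* With more blocks than letters some block is empty, and [f] vanishes there; so any bound above the
   total length gives the same sum. *)
have Alarge k Y : size Y = n -> (msize Y < k)%N -> A k Y = 0.
  elim: k Y => // k IHk Y sY; rewrite ltnS => leYk; rewrite AS //.
  rewrite (@eq_cutm _ _ _ (fun _ _ => 0)) ?cutm0 // => B C sB sC mBC.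
  have [eB|neB] := boolP (allnil B); first by rewrite f0 ?fcons0 // sB.
  rewrite IHk ?sC ?(lin0 ((fcons_bilin V).2 _)) //; apply: leq_trans leYk.
  by rewrite -mBC -[X in (X < _)%N]add0n ltn_add2r lt0n msize0.
have PhiN N Y : size Y = n -> (msize Y < N)%N -> Phi Y = \sum_(0 <= k < N) A k Y.
  move=> sY ltYN; rewrite [RHS](@big_cat_nat _ _ _ (msize Y).+1) //=.
  rewrite [X in _ = _ + X]big_nat_cond [X in _ = _ + X]big1 ?addr0 // => k.
  by rewrite andbT => /andP[ltYk _]; apply: Alarge.
(* One more term than in [Phi X]: once the first block is split off, the remaining range is the
   original one. *)
rewrite (PhiN (msize X).+2) // big_nat_recl // A0 //; congr (_ + _).
rewrite (eq_big_nat _ _ (F2 := fun k => cutm (fun Y Z => fcons (f Y) (A k Z)) X)).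
  transitivity (cutm (fun Y Z => \sum_(0 <= k < (msize X).+1) fcons (f Y) (A k Z)) X).
    elim: (msize X).+1 => [|N IHN].
      rewrite big_geq // (@eq_cutm _ _ _ (fun _ _ => 0)) ?cutm0 // => *.
      by rewrite big_geq.
    rewrite big_nat_recr //= IHN -cutmD.
    by apply: eq_cutm => *; rewrite big_nat_recr.
  apply: eq_cutm => Y Z sY sZ mYZ.
  rewrite -(lin_sum _ _ _ ((fcons_bilin V).2 _)) -PhiN ?sZ //.
  by rewrite ltnS -mYZ leq_addl.
by move=> k _; rewrite AS.
Qed.

End TensorCoalgebra.

(** * Evaluation of Lie polynomials *)

Lemma freeg_lin_ext (R : comNzRingType) (X : choiceType) (W : lmodType R)
    (f g : {freeg X / R} -> W) : linear f -> linear g ->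
  (forall x, f << x >> = g << x >>) -> f =1 g.
Proof.
move=> lf lg fg a; rewrite -(freeg_sumE a) !lin_sum //; apply: eq_bigr => x _.
have -> : << coeff x a *g x >> = coeff x a *: (<< x >> : {freeg X / R}).
  by apply/eqP/freeg_eqP => y; rewrite coeffZ !coeffU mul1r.
by rewrite !linZ // fg.
Qed.

Section LieEvaluation.
Variables (R : comNzRingType) (n : nat) (L : lieAlgType R).
Implicit Types (v : 'I_n -> L) (t : ltree n) (e : freeLie R n).

Lemma lbr_bilin : bilin (@lbr R L).
Proof. by split=> x; [apply: lbr_linearl | apply: lbr_linearr]. Qed.

Lemma teval_node_mul v (a b : free_magma_alg R n) :
  fglift (teval v) (node_mul a b) = lbr (fglift (teval v) a) (fglift (teval v) b).
Proof.
have lv := fglift_linear (teval v).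
apply: (freeg_lin_ext (f := fun a => fglift (teval v) (node_mul a b))
  (g := fun a => lbr (fglift (teval v) a) (fglift (teval v) b))) => {a} [||t].
- exact: lin_comp (node_mul_linearl b) lv.
- exact: lin_comp lv (lbr_linearl _).
apply: (freeg_lin_ext (f := fun b => fglift (teval v) (node_mul << t >> b))
  (g := fun b => lbr (fglift (teval v) << t >>) (fglift (teval v) b))) => {b} [||u].
- exact: lin_comp (node_mul_linearr _) lv.
- exact: lin_comp lv (lbr_linearr _).
by rewrite /node_mul !liftU !scale1r liftU scale1r.
Qed.

Lemma teval_respects v : respects (@lie_rel R n) (teval v).
Proof.
move=> r; elim=> {r} [a|a b c|a r _ IH|a r _ IH].
- by rewrite teval_node_mul lbrxx.
- by rewrite !(linD (fglift_linear (teval v))) !teval_node_mul lbr_jacobi.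
- by rewrite teval_node_mul IH (lin0 (@lbr_linearr _ L _)).
- by rewrite teval_node_mul IH (lin0 (@lbr_linearl _ L _)).
Qed.

Lemma leval_linear v : linear (leval v : freeLie R n -> L).
Proof. exact: lquot_lift_linear (@teval_respects v). Qed.

Lemma leval_tree v t : leval v (gen _ t : freeLie R n) = teval v t.
Proof. exact: lquot_lift_gen (@teval_respects v). Qed.

Lemma leval_lgen v i : leval v (lgen R i) = v i.
Proof. exact: leval_tree v (Leaf i). Qed.

Lemma leval_lbr v e e' : leval v (lbr e e') = lbr (leval v e) (leval v e').
Proof.
rewrite -(lrepK e) -(lrepK e') [lbr _ _]freeLie_brE.
by rewrite /leval !(lquot_liftE (@teval_respects v)) teval_node_mul.
Qed.

Lemma eq_leval v v' e : v =1 v' -> leval v e = leval v' e.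
Proof. by move=> /funext->. Qed.

Definition lie_morph (L' : lieAlgType R) (f : L -> L') :=
  linear f /\ {morph f : x y / lbr x y}.

End LieEvaluation.

Section LieEvaluationMorphism.
Variables (R : comNzRingType) (n : nat) (L L' : lieAlgType R).

Lemma lie_morph_leval (f : L -> L') (v : 'I_n -> L) (e : freeLie R n) :
  lie_morph f -> f (leval v e) = leval (f \o v) e.
Proof.
move=> [lf fbr]; apply: (lquot_lin_ext (f := fun e => f (leval v e))) e => [||t].
- by apply: lin_comp lf; apply: leval_linear.
- exact: leval_linear.
rewrite !leval_tree; elim: t => //= t IHt u IHu.
by rewrite fbr IHt IHu.
Qed.

Lemma leval_lie_morph (v : 'I_n -> L) : lie_morph (leval v : freeLie R n -> L).
Proof. by split; [apply: leval_linear | apply: leval_lbr]. Qed.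

End LieEvaluationMorphism.

Section Multilinear.
Variables (R : comNzRingType) (n : nat) (L : lieAlgType R).
Implicit Types (v : 'I_n -> L) (t : ltree n) (e : freeLie R n).

Lemma eq_teval v v' t : {in leaves t, v =1 v'} -> teval v t = teval v' t.
Proof.
elim: t => [i|t IHt u IHu] /= vv'; first by apply: vv'; rewrite inE.
by rewrite IHt ?IHu // => i ti; apply: vv'; rewrite mem_cat ti ?orbT.
Qed.

(** The variable [k] occurs in exactly one of the two subtrees of a node; the other subtree has the
    same value under all three evaluations, and the bracket is linear in each argument. *)
Lemma teval_slot (k : 'I_n) a v v1 v2 t :
  (forall i, i != k -> v i = v1 i /\ v i = v2 i) -> v k = a *: v1 k + v2 k ->
  count_mem k (leaves t) = 1%N -> teval v t = a *: teval v1 t + teval v2 t.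
Proof.
move=> vE vk; have cst w : k \notin leaves w -> teval v w = teval v1 w /\ teval v w = teval v2 w.
  move=> kw; split; apply: eq_teval => i iw; have [] // := vE i;
    by apply: contraNneq kw => <-.
elim: t => [i|t IHt u IHu] /=; first by rewrite addn0; case: eqP => // ->.
rewrite count_cat; have [kt|] := boolP (k \in leaves t); last first.
  move=> kt; rewrite (count_memPn kt) add0n => /IHu->.
  rewrite ((lbr_bilin L).2 _); have [<- <-] := cst _ kt; exact: erefl.
have [ku|] := boolP (k \in leaves u).
  move: kt ku; rewrite -!has_pred1 !has_count.
  case: (count _ (leaves t)) => // c _; case: (count _ (leaves u)) => // d _.
  by rewrite addSn addnS.
move=> ku; rewrite (count_memPn ku) addn0 => /IHt->.
rewrite ((lbr_bilin L).1 _); have [<- <-] := cst _ ku; exact: erefl.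
Qed.

Lemma multilinear_levalE e : multilinear e ->
  exists2 s : seq (R * ltree n), (forall x, x \in s -> perm_eq (leaves x.2) (enum 'I_n))
  & forall v, leval v e = \sum_(x <- s) x.1 *: teval v x.2.
Proof.
move=> [a am ->]; exists [seq (coeff t a, t) | t <- dom a].
  by move=> _ /mapP[t ta ->]; apply: am.
move=> v; rewrite big_map /leval (lquot_liftE (@teval_respects _ _ _ v)).
rewrite -[in LHS](freeg_sumE a) (lin_sum _ _ _ (fglift_linear _)).
by apply: eq_bigr => t _; rewrite liftU.
Qed.

Lemma multilinear_slot e (k : 'I_n) a v v1 v2 : multilinear e ->
  (forall i, i != k -> v i = v1 i /\ v i = v2 i) -> v k = a *: v1 k + v2 k ->
  leval v e = a *: leval v1 e + leval v2 e.
Proof.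
move=> /multilinear_levalE[s sm sE] vE vk; rewrite !sE scaler_sumr -big_split /=.
rewrite !big_seq; apply: eq_bigr => x /sm px; rewrite (teval_slot vE vk).
  by rewrite scalerDr !scalerA mulrC.
rewrite (seq.permP px (pred1 k)) count_uniq_mem ?enum_uniq // mem_enum; exact: erefl.
Qed.

(* Brackets of a single element with itself vanish. *)
Lemma multilinear_const e (x : L) : n != 1%N -> multilinear e ->
  leval (fun=> x) e = 0.
Proof.
move=> n1 /multilinear_levalE[s sm ->]; rewrite big_seq big1 // => -[c t] /sm /=.
have tevalx (w : ltree n) : teval (fun=> x) w = if size (leaves w) == 1%N then x else 0.
  elim: w => //= w1 IH1 w2 IH2; rewrite IH1 IH2 size_cat.
  have [p1 p2] : (0 < size (leaves w1))%N /\ (0 < size (leaves w2))%N.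
    have p (w : ltree n) : (0 < size (leaves w))%N.
      by elim: w => //= w IHw w' _; rewrite size_cat addn_gt0 IHw.
    by [].
  rewrite [X in _ = if X then _ else _](_ : _ = false); last first.
    by case: (size _) p1 => // ? _; case: (size _) p2 => // ? _; rewrite addSn addnS.
  by do 2?[case: ifP => _]; rewrite ?lbrxx ?(lin0 ((lbr_bilin L).1 _)) ?(lin0 ((lbr_bilin L).2 _)).
move/perm_size; rewrite size_enum_ord tevalx => ->.
by rewrite (negPf n1) scaler0.
Qed.

End Multilinear.

(** * Cuttings into blocks and evaluation of families *)

Section SplitsMap.
Variables (T T' : Type) (f : T -> T').

Lemma splits_map k s : splits k (map f s) = map (map (map f)) (splits k s).
Proof.
elim: k s => [|k IHk] s; first by case: s.
rewrite /splits -/splits size_map map_flatten -map_comp; congr flatten.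
apply: eq_map => i /=; rewrite -map_take -map_drop IHk -!map_comp.
exact: eq_map.
Qed.

Lemma psplits_map k s : psplits k (map f s) = map (map (map f)) (psplits k s).
Proof.
rewrite /psplits splits_map filter_map; congr (map _ _); apply: eq_filter => I /=.
by rewrite all_map; apply: eq_all => -[].
Qed.

End SplitsMap.

Section SplitsCut.
Variables (T : Type) (M : zmodType).

Lemma splits0_sum (F : seq (seq T) -> M) s :
  \sum_(I <- splits 0 s) F I = if nilp s then F [::] else 0.
Proof. by case: s => [|x s] /=; rewrite ?big_seq1 ?big_nil. Qed.

Lemma splitsS_sum k (F : seq (seq T) -> M) s :
  \sum_(I <- splits k.+1 s) F I =
  cut2 (fun u v => \sum_(I <- splits k v) F (u :: I)) s.
Proof.
rewrite cut2E /splits -/splits big_flatten big_map; apply: eq_bigr => i _.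
by rewrite big_map.
Qed.

End SplitsCut.

Lemma nth_slot (V : nmodType) u (x : V) v i :
  i != size u -> nth 0 (u ++ x :: v) i = nth 0 (u ++ 0 :: v) i.
Proof.
rewrite !nth_cat; case: ltngtP => // lt _.
by rewrite -(subnSK lt).
Qed.

Lemma nth_slotE (V : nmodType) u (x : V) v : nth 0 (u ++ x :: v) (size u) = x.
Proof. by rewrite nth_cat ltnn subnn. Qed.

Section FamilyEvaluation.
Variables (R : comNzRingType) (L : lieAlgType R).
Implicit Types (B : Bfamily R) (P : Pfamily R) (xs ys : seq L).

(** In [Bev] the arities are the lengths of the lists, so that changing a list changes the type of
    the polynomial; separate arities make the lengths rewritable on their own. *)
Definition Bevn B p q xs ys : L := leval (fun k => nth 0 (xs ++ ys) k) (B p q).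

Lemma BevE B xs ys : Bev B xs ys = Bevn B (size xs) (size ys) xs ys.
Proof. by []. Qed.

Definition Pevn P p xs : L := leval (fun k => nth 0 xs k) (P p).

Lemma PevE P xs : Pev P xs = Pevn P (size xs) xs.
Proof. by []. Qed.

Lemma leval_nth_slot n (e : freeLie R n) u v a (x y : L) :
  (size u < n)%N -> multilinear e ->
  leval (fun k : 'I_n => nth 0 (u ++ (a *: x + y) :: v) k) e =
  a *: leval (fun k : 'I_n => nth 0 (u ++ x :: v) k) e +
  leval (fun k : 'I_n => nth 0 (u ++ y :: v) k) e.
Proof.
move=> lt em; apply: (multilinear_slot (k := Ordinal lt)) => // [i|]; last first.
  by rewrite !nth_slotE.
by rewrite -val_eqE /= => ik; split; rewrite !(@nth_slot _ u _ v i).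
Qed.

Lemma Bev_wlinl B ys : (forall p q, multilinear (B p q)) ->
  wlin *:%R (fun xs => Bev B xs ys).
Proof.
move=> mB u v a x y; rewrite !BevE /Bevn !size_cat /= -!catA /=.
by apply: leval_nth_slot => //; rewrite addnS addSn ltnS -addnA leq_addr.
Qed.

Lemma Bev_wlinr B xs : (forall p q, multilinear (B p q)) ->
  wlin *:%R (fun ys => Bev B xs ys).
Proof.
move=> mB u v a x y; rewrite !BevE /Bevn !size_cat /= !catA.
by apply: leval_nth_slot => //; rewrite size_cat ltn_add2l addnS ltnS leq_addr.
Qed.

Lemma Pev_wlin P : (forall p, multilinear (P p)) -> wlin *:%R (@Pev R P L).
Proof.
move=> mP u v a x y; rewrite !PevE /Pevn !size_cat /=.
by apply: leval_nth_slot => //; rewrite addnS ltnS leq_addr.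
Qed.

(** With no variables every evaluation is an evaluation at a constant family, which vanishes in
    degree different from one. *)
Lemma Pev_nil P : (forall p, multilinear (P p)) -> Pev P ([::] : seq L) = 0.
Proof.
move=> mP; rewrite -(multilinear_const 0 _ (mP 0%N)) //.
by apply: eq_leval => -[].
Qed.

Lemma Pev_one P (x : L) : P 1%N = lgen R ord0 -> Pev P [:: x] = x.
Proof. by move=> P1; rewrite PevE /Pevn /= P1 leval_lgen. Qed.

Lemma Bev_one_nil B (x : L) : B 1%N 0%N = lgen R ord0 -> Bev B [:: x] [::] = x.
Proof. by move=> B1; rewrite BevE /Bevn /= B1 leval_lgen. Qed.

Lemma Bev_nil_one B (x : L) : B 0%N 1%N = lgen R ord0 -> Bev B [::] [:: x] = x.
Proof. by move=> B1; rewrite BevE /Bevn /= B1 leval_lgen. Qed.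

Lemma Bev_0r B xs : (forall p, p != 1%N -> B p 0%N = 0) -> size xs != 1%N ->
  Bev B xs [::] = 0.
Proof. by move=> B0 sx; rewrite BevE /Bevn B0 // (lin0 (leval_linear _)). Qed.

Lemma Bev_0l B ys : (forall p, p != 1%N -> B 0%N p = 0) -> size ys != 1%N ->
  Bev B [::] ys = 0.
Proof. by move=> B0 sx; rewrite BevE /Bevn B0 // (lin0 (leval_linear _)). Qed.

Lemma Bev_const B (x : L) p q : (forall p q, multilinear (B p q)) ->
  (p + q != 1)%N -> Bev B (nseq p x) (nseq q x) = 0.
Proof.
move=> mB pq; rewrite BevE /Bevn !size_nseq -[RHS](multilinear_const x pq (mB p q)).
apply: eq_leval => k; rewrite nth_cat size_nseq !nth_nseq.
by case: ltnP => // lepk; rewrite -[X in if X then _ else _]subn_gt0 subnBA // addnC subn_gt0 ltn_ord.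
Qed.

End FamilyEvaluation.

Section FamilyMorphism.
Variables (R : comNzRingType) (L L' : lieAlgType R) (f : L -> L').
Hypothesis hf : lie_morph f.

Lemma nth_map0 (s : seq L) i : nth 0 (map f s) i = f (nth 0 s i).
Proof.
have [lt|ge] := ltnP i (size s); first by rewrite (nth_map 0).
by rewrite !nth_default ?size_map // (lin0 hf.1).
Qed.

Lemma Bev_map B xs ys : Bev B (map f xs) (map f ys) = f (Bev B xs ys).
Proof.
rewrite (lie_morph_leval _ _ hf) BevE /Bevn !size_map -map_cat.
by apply: eq_leval => k; rewrite nth_map0.
Qed.

Lemma Pev_map P xs : Pev P (map f xs) = f (Pev P xs).
Proof.
rewrite (lie_morph_leval _ _ hf) PevE /Pevn !size_map.
by apply: eq_leval => k; rewrite nth_map0.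
Qed.

Lemma Bblocks_map B (I J : seq (seq L)) :
  Bblocks B (map (map f) I) (map (map f) J) = map f (Bblocks B I J).
Proof.
elim: I J => [|x I IHI] [|y J] //; rewrite /Bblocks /=; congr (_ :: _).
  exact: Bev_map.
exact: IHI.
Qed.

Lemma map_Pev_map P (I : seq (seq L)) :
  [seq Pev P b | b <- map (map f) I] = map f [seq Pev P b | b <- I].
Proof. by rewrite -!map_comp; apply: eq_map => b /=; apply: Pev_map. Qed.

End FamilyMorphism.

(** * From identities between generators to identities between arbitrary elements *)

Section Transfer.
Variables (R : comNzRingType) (L : lieAlgType R).

Lemma leval_lgens n (s : seq L) : size s = n ->
  map (leval (fun k : 'I_n => nth 0 s k)) (lgens R n) = s.
Proof.
move=> <-; rewrite /lgens -map_comp -[RHS](mkseq_nth 0) /mkseq -val_enum_ord -map_comp.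
by apply: eq_map => i /=; rewrite leval_lgen.
Qed.

(** [phi] sends the generators to the successive letters of [xs ++ ys ++ zs]. Cutting into blocks
    and evaluating B commute with Lie morphisms, so applying [phi] to the identity between
    generators gives the one for these letters. *)
Lemma B_assoc_eval B (xs ys zs : seq L) :
  B_assoc B (size xs) (size ys) (size zs) ->
  \sum_(1 <= k < (size xs + size ys).+1) \sum_(I <- splits k xs)
    \sum_(J <- splits k ys) Bev B (Bblocks B I J) zs =
  \sum_(1 <= k < (size ys + size zs).+1) \sum_(I <- splits k ys)
    \sum_(J <- splits k zs) Bev B xs (Bblocks B I J).
Proof.
set p := size xs; set q := size ys; set r := size zs; set n := (p + q + r)%N.
pose s := xs ++ ys ++ zs; pose phi := leval (fun k : 'I_n => nth 0 s k).
have hphi : lie_morph phi by apply: leval_lie_morph.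
have Es : map phi (lgens R n) = s.
  by apply: leval_lgens; rewrite /s !size_cat addnA.
have Exs : xs = map phi (take p (lgens R n)) by rewrite map_take Es /s take_size_cat.
have Eys : ys = map phi (take q (drop p (lgens R n))).
  by rewrite map_take map_drop Es /s drop_size_cat // take_size_cat.
have Ezs : zs = map phi (drop (p + q) (lgens R n)).
  by rewrite map_drop Es /s catA drop_size_cat // size_cat.
move=> /(congr1 phi); rewrite !(lin_sum _ _ _ hphi.1).
under eq_bigr do rewrite (lin_sum _ _ _ hphi.1).
under eq_bigr do under eq_bigr do rewrite (lin_sum _ _ _ hphi.1).
under [X in _ = X -> _]eq_bigr do rewrite (lin_sum _ _ _ hphi.1).
under [X in _ = X -> _]eq_bigr do under eq_bigr do rewrite (lin_sum _ _ _ hphi.1).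
move=> E; rewrite {1}Exs {1}Eys {1}Ezs; apply: etrans (etrans E _).
  apply: eq_bigr => k _; rewrite splits_map big_map; apply: eq_bigr => I _.
  rewrite splits_map big_map; apply: eq_bigr => J _.
  by rewrite (Bblocks_map hphi) (Bev_map hphi).
rewrite {1}Exs {1}Eys {1}Ezs.
apply: eq_bigr => k _; rewrite splits_map big_map; apply: eq_bigr => I _.
rewrite splits_map big_map; apply: eq_bigr => J _.
by rewrite (Bblocks_map hphi) (Bev_map hphi).
Qed.

Lemma transports_eval P B B' (xs ys : seq L) : transports P B B' ->
  \sum_(1 <= k < (size xs + size ys).+1) \sum_(I <- splits k xs)
    \sum_(J <- splits k ys) Pev P (Bblocks B I J) =
  \sum_(0 <= k < (size xs).+1) \sum_(0 <= l < (size ys).+1)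
    \sum_(I <- psplits k xs) \sum_(J <- psplits l ys)
      Bev B' [seq Pev P b | b <- I] [seq Pev P b | b <- J].
Proof.
move/(_ (size xs) (size ys)).
set p := size xs; set q := size ys; set n := (p + q)%N.
pose s := xs ++ ys; pose phi := leval (fun k : 'I_n => nth 0 s k).
have hphi : lie_morph phi by apply: leval_lie_morph.
have Es : map phi (lgens R n) = s by apply: leval_lgens; rewrite /s size_cat.
have Exs : xs = map phi (take p (lgens R n)) by rewrite map_take Es /s take_size_cat.
have Eys : ys = map phi (drop p (lgens R n)) by rewrite map_drop Es /s drop_size_cat.
move/(congr1 phi); rewrite !(lin_sum _ _ _ hphi.1).
under eq_bigr do rewrite (lin_sum _ _ _ hphi.1).
under eq_bigr do under eq_bigr do rewrite (lin_sum _ _ _ hphi.1).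
under [X in _ = X -> _]eq_bigr do rewrite (lin_sum _ _ _ hphi.1).
under [X in _ = X -> _]eq_bigr do under eq_bigr do rewrite (lin_sum _ _ _ hphi.1).
under [X in _ = X -> _]eq_bigr do under eq_bigr do under eq_bigr do
  rewrite (lin_sum _ _ _ hphi.1).
move=> E; rewrite {1}Exs {1}Eys; apply: etrans (etrans E _).
  apply: eq_bigr => k _; rewrite splits_map big_map; apply: eq_bigr => I _.
  rewrite splits_map big_map; apply: eq_bigr => J _.
  by rewrite (Bblocks_map hphi) (Pev_map hphi).
rewrite {1}Exs {1}Eys.
apply: eq_bigr => k _; apply: eq_bigr => l _.
rewrite psplits_map big_map; apply: eq_bigr => I _.
rewrite psplits_map big_map; apply: eq_bigr => J _.
by rewrite !(map_Pev_map hphi) (Bev_map hphi).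
Qed.

End Transfer.

(** * The shuffle product *)

Lemma cut2_sum T (M : zmodType) I (r : seq I) (F : I -> seq T -> seq T -> M) s :
  \sum_(i <- r) cut2 (F i) s = cut2 (fun u v => \sum_(i <- r) F i u v) s.
Proof. by rewrite cut2E exchange_big /=; apply: eq_bigr => i _; rewrite cut2E. Qed.

Lemma bilin_comp (R : nzRingType) (U V U' V' W : lmodType R) (b : U -> V -> W)
    (f : U' -> U) (h : V' -> V) :
  bilin b -> linear f -> linear h -> bilin (fun x y => b (f x) (h y)).
Proof.
move=> bb lf lh; split=> u; first exact: (lin_comp lf (bb.1 _)).
exact: (lin_comp lh (bb.2 _)).
Qed.

Section ShuffleProduct.
Variables (K : comNzRingType) (B : Bfamily (fps K)) (g : lieAlgType K).
Variables (lambda : fps K) (hB : in_Blambda lambda B).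
Local Notation L := (fps g).
Local Notation T := (fps (tensorAlg g)).
Local Notation one := (fword [::] : T).
Local Notation mul := (@sh_mul K B g).
Implicit Types (x y z : seq L) (a b c : T).

Lemma Bev_nil_nil : Bev B ([::] : seq L) [::] = 0.
Proof. exact: Bev_0r (B_p0 hB) _. Qed.

Definition blockw k x y : T :=
  \sum_(I <- splits k x) \sum_(J <- splits k y) fword (Bblocks B I J).

Definition mulw x y : T := \sum_(0 <= k < (size x + size y).+1) blockw k x y.

Lemma blockw0 x y : blockw 0 x y = if nilp x && nilp y then one else 0.
Proof.
by rewrite /blockw splits0_sum splits0_sum; case: (nilp x); case: (nilp y).
Qed.

Lemma blockwS k x y : blockw k.+1 x y =
  cut2 (fun u v => cut2 (fun u' v' => fcons (Bev B u u') (blockw k v v')) y) x.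
Proof.
rewrite /blockw splitsS_sum; apply: eq_cut2 => u v _.
under eq_bigr do rewrite splitsS_sum.
rewrite cut2_sum; apply: eq_cut2 => u' v' _.
rewrite (lin_sum _ _ _ ((fcons_bilin g).2 _)); apply: eq_bigr => I _.
by rewrite (lin_sum _ _ _ ((fcons_bilin g).2 _)).
Qed.

Lemma scale_morph : forall c : fps K, {morph ( *:%R c : T -> T) : a b / a + b}.
Proof. by move=> c a b; rewrite scalerDr. Qed.

Lemma blockw_wlinl k y : wlin *:%R (fun x => blockw k x y).
Proof.
elim: k y => [|k IHk] y.
  have -> : (fun x => blockw 0 x y) =
      (fun x => if nilp x then (if nilp y then one else 0) else 0).
    by apply/funext => x; rewrite blockw0; case: nilp.
  exact: wlin_nilp scale_morph _.
have -> : (fun x => blockw k.+1 x y) = cut2 (fun u v =>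
    cut2 (fun u' v' => fcons (Bev B u u') (blockw k v v')) y).
  by apply/funext => x; rewrite blockwS.
apply: wlin_cut2 => [|v|u]; first exact: scale_morph.
  apply: (wlin_cut2_param scale_morph) => u' v'.
  exact: (wlin_lin ((fcons_bilin g).1 _) (Bev_wlinl _ (B_multilinear hB))).
apply: (wlin_cut2_param scale_morph) => u' v'.
exact: (wlin_lin ((fcons_bilin g).2 _) (IHk _)).
Qed.

Lemma blockw_wlinr k x : wlin *:%R (blockw k x).
Proof.
elim: k x => [|k IHk] x.
  have -> : blockw 0 x = (fun y => if nilp y then (if nilp x then one else 0) else 0).
    by apply/funext => y; rewrite blockw0; case: (nilp x); case: (nilp y).
  exact: wlin_nilp scale_morph _.
have -> : blockw k.+1 x = cut2 (fun u' v' =>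
    cut2 (fun u v => fcons (Bev B u u') (blockw k v v')) x).
  by apply/funext => y; rewrite blockwS cut2_exchange.
apply: wlin_cut2 => [|v|u]; first exact: scale_morph.
  apply: (wlin_cut2_param scale_morph) => u' v'.
  exact: (wlin_lin ((fcons_bilin g).1 _) (Bev_wlinr _ (B_multilinear hB))).
apply: (wlin_cut2_param scale_morph) => u' v'.
exact: (wlin_lin ((fcons_bilin g).2 _) (IHk _)).
Qed.

Lemma mulw_wlinl y : wlin *:%R (fun x => mulw x y).
Proof.
move=> u v a x1 x2; rewrite /mulw !size_cat /= scaler_sumr -big_split /=.
by apply: eq_bigr => k _; rewrite blockw_wlinl.
Qed.

Lemma mulw_wlinr x : wlin *:%R (mulw x).
Proof.
move=> u v a x1 x2; rewrite /mulw !size_cat /= scaler_sumr -big_split /=.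
by apply: eq_bigr => k _; rewrite blockw_wlinr.
Qed.

Lemma sh_mul_wlift a b : mul a b = wlift (fun x => wlift (mulw x) b) a.
Proof.
rewrite /sh_mul /wlift; congr (linext _ a); apply/funext => xs.
congr (linext _ b); apply/funext => ys.
by rewrite /sh_mul_word /mulw /blockw !size_map.
Qed.

Lemma wlift_mulw_wlin b : wlin *:%R (fun x => wlift (mulw x) b).
Proof.
move=> u v a x1 x2.
apply: (T_word_ext (g := fun b => a *: wlift (mulw (u ++ x1 :: v)) b
                                  + wlift (mulw (u ++ x2 :: v)) b)) b => [||s].
- exact: wlift_linear (mulw_wlinr _).
- by apply: lin_add; [apply: lin_scaler|]; apply: wlift_linear; apply: mulw_wlinr.
by rewrite !wliftE ?(mulw_wlinl s u v) //; apply: mulw_wlinr.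
Qed.

Lemma sh_mul_words x y : mul (fword x) (fword y) = mulw x y.
Proof.
rewrite sh_mul_wlift wliftE; last exact: wlift_mulw_wlin.
by rewrite wliftE //; apply: mulw_wlinr.
Qed.

Lemma sh_mul_bilin : bilin mul.
Proof.
split=> [b|a] c u v.
  by rewrite !sh_mul_wlift; apply: wlift_linear; apply: wlift_mulw_wlin.
rewrite !sh_mul_wlift; apply: (wlift_param_linear (F := fun b x => wlift (mulw x) b)).
  by move=> s; apply: wlift_linear; apply: mulw_wlinr.
by move=> w; apply: wlift_mulw_wlin.
Qed.

(** Turns a function of two words into a function of a list of words, the form that [comult]
    requires; on lists of size two the default [m0] is never taken. *)
Let pair2 (M : Type) (m0 : M) (F : seq L -> seq L -> M) (X : seq (seq L)) : M :=
  if X is [:: x; y] then F x y else m0.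

Let f2 := pair2 (0 : L) (fun x y => Bev B x y).
Let M2 := pair2 (0 : T) mulw.

Lemma f2_empty X : size X = 2 -> allnil X -> f2 X = 0.
Proof.
case: X => [|x [|y []]] //= _; rewrite andbT => /andP[/nilP-> /nilP->].
exact: Bev_nil_nil.
Qed.

Lemma M2_rec X : size X = 2 ->
  M2 X = (if allnil X then one else 0) + cutm (fun Y Z => fcons (f2 Y) (M2 Z)) X.
Proof.
move=> sX; have rec := (blocks_rec (A := fun k => pair2 (0 : T) (blockw k)) f2_empty).
have ME Y : size Y = 2 -> M2 Y = \sum_(0 <= k < (msize Y).+1) pair2 (0 : T) (blockw k) Y.
  by case: Y => [|x [|y []]] //= _; rewrite /msize /= addn0.
rewrite ME // rec //; last 2 first.
- by case=> [|x [|y []]] //= _; rewrite blockw0 andbT.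
- by move=> k; case=> [|x [|y []]] //= _; rewrite blockwS.
by congr (_ + _); apply: eq_cutm => Y Z sY sZ _; rewrite ME ?sZ.
Qed.

Lemma mulw_comult : comult 2 M2.
Proof. exact: rec_comult f2_empty M2_rec. Qed.

(** Recursion on the first block, as for quasi-shuffle products. The cut with [u] and [u'] both
    empty reproduces [mulw x y], but its coefficient is B_00 = 0. *)
Lemma mulw_rec x y : mulw x y = (if nilp x && nilp y then one else 0) +
  cut2 (fun u v => cut2 (fun u' v' => fcons (Bev B u u') (mulw v v')) y) x.
Proof. by have := M2_rec (X := [:: x; y]) erefl; rewrite /= andbT. Qed.

Lemma tpi_sh_mul x y : tpi (mul (fword x) (fword y)) = Bev B x y.
Proof. rewrite sh_mul_words; exact: (rec_tpi f2_empty M2_rec (X := [:: x; y])). Qed.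

Lemma sweedler_mul_bilin (W : lmodType K) (G : T -> T -> fps W) t : bilin G ->
  bilin (fun a1 a2 => sweedler (fun b1 b2 => G (mul a1 b1) (mul a2 b2)) t).
Proof.
move=> bG; have bm := sh_mul_bilin.
split=> u.
  apply: (@sweedler_param_linear _ _ _ _ (fun c b1 b2 => G (mul c b1) (mul u b2))).
  split=> [b1 b2|c]; first exact: (lin_comp (bm.1 b1) (bG.1 _)).
  exact: bilin_comp bG (bm.2 c) (bm.2 u).
apply: (@sweedler_param_linear _ _ _ _ (fun c b1 b2 => G (mul u b1) (mul c b2))).
split=> [b1 b2|c]; first exact: (lin_comp (bm.1 b2) (bG.2 _)).
exact: bilin_comp bG (bm.2 u) (bm.2 c).
Qed.

(** Multiplicativity of the coproduct: on words it is [mulw_comult], and both sides are linear in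
    [a] and in [b]. *)
Lemma sweedler_sh_mul (W : lmodType K) (G : T -> T -> fps W) a b : bilin G ->
  sweedler G (mul a b) =
  sweedler (fun a1 a2 => sweedler (fun b1 b2 => G (mul a1 b1) (mul a2 b2)) b) a.
Proof.
move=> bG; have bm := sh_mul_bilin.
have bi c d : bilin (fun b1 b2 => G (mul c b1) (mul d b2)).
  exact: bilin_comp bG (bm.2 c) (bm.2 d).
have bo t : bilin (fun a1 a2 => sweedler (fun b1 b2 => G (mul a1 b1) (mul a2 b2)) t).
  exact: sweedler_mul_bilin.
apply: (T_word_ext (f := fun a => sweedler G (mul a b))
  (g := fun a => sweedler (fun a1 a2 => sweedler (fun b1 b2 => G (mul a1 b1) (mul a2 b2)) b) a)) a.
- exact: (lin_comp (bm.1 _) (sweedler_linear bG)).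
- exact: sweedler_linear.
move=> x; rewrite sweedler_word //.
have lr : linear (fun b => cut2 (fun u v =>
     sweedler (fun b1 b2 => G (mul (fword u) b1) (mul (fword v) b2)) b) x).
  by apply: cut2_param_linear => u v; apply: sweedler_linear.
apply: (T_word_ext (f := fun b => sweedler G (mul (fword x) b)) _ lr) b.
  exact: (lin_comp (bm.2 _) (sweedler_linear bG)).
move=> y; rewrite sh_mul_words (comult_sweedler mulw_comult (X := [:: x; y])) //=.
apply: eq_cut2 => u v _; rewrite sweedler_word //.
by apply: eq_cut2 => u' v' _; rewrite /= !sh_mul_words.
Qed.

Lemma teps_sh_mul a b : teps (mul a b) = teps a * teps b.
Proof.
apply: (T_word_ext (W := K^o) (f := fun a => teps (mul a b))
  (g := fun a => (teps a * teps b : fps K^o))) a => [||x].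
- by move=> c u v; rewrite (sh_mul_bilin.1 b) teps_linear.
- by move=> c u v; rewrite teps_linear mulrDl -mulrA.
apply: (T_word_ext (W := K^o) (f := fun b => teps (mul (fword x) b))
  (g := fun b => (teps (fword x) * teps b : fps K^o))) b => [||y].
- by move=> c u v; rewrite (sh_mul_bilin.2 _) teps_linear.
- by move=> c u v; rewrite teps_linear mulrDr mulrCA.
rewrite !teps_word sh_mul_words.
have -> : mulw x y = M2 [:: x; y] by [].
have [e|ne] := boolP (allnil [:: x; y]).
  rewrite (comult_empty mulw_comult) // teps_word /=.
  by case/and3P: e => -> -> _; rewrite mulr1.
rewrite (comult_eps mulw_comult) //; move: ne => /=.
by rewrite andbT; case: (nilp x); case: (nilp y); rewrite ?mulr0 ?mul0r.
Qed.

Lemma sh_mul_one_one : mul one one = one.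
Proof.
rewrite sh_mul_words; exact: (comult_empty mulw_comult (X := [:: [::]; [::]])).
Qed.

Let head1 (F : seq L -> T) (X : seq (seq L)) := if X is [:: x] then F x else 0.

Lemma fword_comult : comult 1 (head1 (@fword K g)).
Proof.
split=> [[|x []] //= _|[|x []] //= _|W G [|x []] //= bG _].
- by rewrite andbT => /nilP->.
- by rewrite andbT teps_word => /negPf->.
by rewrite sweedler_word.
Qed.

(** Left multiplication by [one] and the identity are coalgebra morphisms, and they have the same
    projection because B_01 is the identity and the other B_0p vanish. *)
Lemma sh_mul1w x : mul one (fword x) = fword x.
Proof.
apply: (comult_uniq (n := 1) (Phi := head1 (fun x => mul one (fword x)))
  (Psi := head1 (@fword K g)) _ fword_comult _ (X := [:: x])) => //; last first.
  move=> [|y []] //= _; rewrite tpi_sh_mul tpi_word.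
  case: y => [|y [|]] *; [exact: Bev_nil_nil|exact: Bev_nil_one (B_01 hB)|].
  by rewrite (Bev_0l (B_0p hB)).
split=> [[|y []] //= _|[|y []] //= _|W G [|y []] //= bG _].
- by rewrite andbT => /nilP->; rewrite sh_mul_one_one.
- by rewrite andbT teps_sh_mul !teps_word mul1r => /negPf->.
rewrite sh_mul_words (comult_sweedler mulw_comult (X := [:: [::]; y])) //= addr0.
by apply: eq_cut2 => u v _; rewrite !sh_mul_words.
Qed.

Lemma sh_mulw1 x : mul (fword x) one = fword x.
Proof.
apply: (comult_uniq (n := 1) (Phi := head1 (fun x => mul (fword x) one))
  (Psi := head1 (@fword K g)) _ fword_comult _ (X := [:: x])) => //; last first.
  move=> [|y []] //= _; rewrite tpi_sh_mul tpi_word.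
  case: y => [|y [|]] *; [exact: Bev_nil_nil|exact: Bev_one_nil (B_10 hB)|].
  by rewrite (Bev_0r (B_p0 hB)).
split=> [[|y []] //= _|[|y []] //= _|W G [|y []] //= bG _].
- by rewrite andbT => /nilP->; rewrite sh_mul_one_one.
- by rewrite andbT teps_sh_mul !teps_word mulr1 => /negPf->.
rewrite sh_mul_words (comult_sweedler mulw_comult (X := [:: y; [::]])) //=.
by apply: eq_cut2 => u v _; rewrite addr0 !sh_mul_words.
Qed.

Lemma sh_mul1r a : mul one a = a.
Proof.
by apply: (T_word_ext (g := idfun)) a => //; [apply: sh_mul_bilin.2|apply: sh_mul1w].
Qed.

Lemma sh_mulr1 a : mul a one = a.
Proof.
apply: (T_word_ext (f := fun a => mul a one) (g := idfun)) a => //.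
  exact: sh_mul_bilin.1.
exact: sh_mulw1.
Qed.

Let triple3 (F : seq L -> seq L -> seq L -> T) (X : seq (seq L)) :=
  if X is [:: x; y; z] then F x y z else 0.

(** This bracketing and that of [mulr_comult] are coalgebra morphisms from the third tensor power,
    so [comult_uniq] reduces associativity to projections. *)
Lemma mull_comult : comult 3 (triple3 (fun x y z => mul (mul (fword x) (fword y)) (fword z))).
Proof.
have bm := sh_mul_bilin.
split=> [[|x [|y [|z []]]] //= _|[|x [|y [|z []]]] //= _|W G [|x [|y [|z []]]] //= bG _].
- by case/and4P=> /nilP-> /nilP-> /nilP-> _; rewrite !sh_mul_one_one.
- rewrite andbT !teps_sh_mul !teps_word.
  by case: (nilp x); case: (nilp y); case: (nilp z) => //= _; rewrite ?mul0r ?mulr0 ?mul0r.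
have bi c d : bilin (fun b1 b2 => G (mul c b1) (mul d b2)).
  exact: bilin_comp bG (bm.2 c) (bm.2 d).
have bj u v : bilin (fun a1 a2 => G (mul a1 u) (mul a2 v)).
  exact: bilin_comp bG (bm.1 u) (bm.1 v).
have bo t : bilin (fun a1 a2 => sweedler (fun b1 b2 => G (mul a1 b1) (mul a2 b2)) t).
  exact: sweedler_mul_bilin.
rewrite sweedler_sh_mul // sh_mul_words (comult_sweedler mulw_comult (X := [:: x; y])) //=.
apply: eq_cut2 => u v _; apply: eq_cut2 => u' v' _; rewrite sweedler_word //.
by apply: eq_cut2 => u'' v'' _; rewrite !sh_mul_words.
Qed.

Lemma mulr_comult : comult 3 (triple3 (fun x y z => mul (fword x) (mul (fword y) (fword z)))).
Proof.
have bm := sh_mul_bilin.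
split=> [[|x [|y [|z []]]] //= _|[|x [|y [|z []]]] //= _|W G [|x [|y [|z []]]] //= bG _].
- by case/and4P=> /nilP-> /nilP-> /nilP-> _; rewrite !sh_mul_one_one.
- rewrite andbT !teps_sh_mul !teps_word.
  by case: (nilp x); case: (nilp y); case: (nilp z) => //= _; rewrite ?mul0r ?mulr0 ?mul0r.
have bi c d : bilin (fun b1 b2 => G (mul c b1) (mul d b2)).
  exact: bilin_comp bG (bm.2 c) (bm.2 d).
have bo t : bilin (fun a1 a2 => sweedler (fun b1 b2 => G (mul a1 b1) (mul a2 b2)) t).
  exact: sweedler_mul_bilin.
rewrite sweedler_sh_mul // sweedler_word //; apply: eq_cut2 => u v _.
rewrite sh_mul_words (comult_sweedler mulw_comult (X := [:: y; z])) //=.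
by apply: eq_cut2 => u' v' _; apply: eq_cut2 => u'' v'' _; rewrite !sh_mul_words.
Qed.

(** Brings a product into the form of [B_assoc] and [transports], whose sums start at one block:
    zero blocks contribute only when both words are empty. *)
Lemma tpi_mul_sum x y (F : T -> L) : linear F -> (0 < size x + size y)%N ->
  F (mul (fword x) (fword y)) =
  \sum_(1 <= k < (size x + size y).+1) \sum_(I <- splits k x) \sum_(J <- splits k y)
    F (fword (Bblocks B I J)).
Proof.
move=> lF s0; rewrite sh_mul_words /mulw (lin_sum _ _ _ lF) big_ltn //.
rewrite blockw0 /nilp -addn_eq0 eqn0Ngt s0 (lin0 lF) add0r.
apply: eq_bigr => k _; rewrite (lin_sum _ _ _ lF); apply: eq_bigr => I _.
by rewrite (lin_sum _ _ _ lF).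
Qed.

Lemma sh_mulA_words x y z :
  mul (fword x) (mul (fword y) (fword z)) = mul (mul (fword x) (fword y)) (fword z).
Proof.
apply: (comult_uniq mulr_comult mull_comult _ (_ : size [:: x; y; z] = 3)) => //.
move=> [|{}x [|{}y [|{}z []]]] //= _; have bm := sh_mul_bilin.
(* The identity defining B is assumed for positive lengths only; an empty word is the unit. *)
have [sx|x0] := posnP (size x); first by rewrite (size0nil sx) !sh_mul1r.
have [sy|y0] := posnP (size y); first by rewrite (size0nil sy) !sh_mul1r sh_mulr1.
have [sz|z0] := posnP (size z); first by rewrite (size0nil sz) !sh_mulr1.
rewrite (@tpi_mul_sum y z (fun t => tpi (mul (fword x) t))); last first.
- by rewrite addn_gt0 y0.
- exact: (lin_comp (bm.2 _) (@tpi_linear K g)).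
rewrite (@tpi_mul_sum x y (fun t => tpi (mul t (fword z)))); last first.
- by rewrite addn_gt0 x0.
- exact: (lin_comp (bm.1 _) (@tpi_linear K g)).
under eq_bigr do under eq_bigr do under eq_bigr do rewrite tpi_sh_mul.
under [RHS]eq_bigr do under eq_bigr do under eq_bigr do rewrite tpi_sh_mul.
exact/esym/B_assoc_eval/(B_assocP hB).
Qed.

Lemma sh_mulA : associative mul.
Proof.
have bm := sh_mul_bilin; move=> a b c.
apply: (T_word_ext (f := fun a => mul a (mul b c)) (g := fun a => mul (mul a b) c)) a.
- exact: bm.1.
- exact: lin_comp (bm.1 b) (bm.1 c).
move=> x; apply: (T_word_ext (f := fun b => mul (fword x) (mul b c))
  (g := fun b => mul (mul (fword x) b) c)) b.
- exact: (lin_comp (bm.1 c) (bm.2 _)).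
- exact: (lin_comp (bm.2 _) (bm.1 _)).
move=> y; apply: (T_word_ext (f := fun c => mul (fword x) (mul (fword y) c))
  (g := fun c => mul (mul (fword x) (fword y)) c)) c.
- exact: (lin_comp (bm.2 _) (bm.2 _)).
- exact: (bm.2 _).
by move=> z; apply: sh_mulA_words.
Qed.

End ShuffleProduct.

(** * The Hopf algebra structure *)

Section ShuffleCoproduct.
Variables (K : comNzRingType) (g : lieAlgType K).
Local Notation T := (fps (tensorAlg g)).
Local Notation one := (fword [::] : T).

Definition sh_comul : T -> fps (tens (tensorAlg g) (tensorAlg g)) :=
  linext (fun w : seq g => fconst (sh_comul_word w)).

Lemma sh_comul_wordE (w : seq g) : fconst (sh_comul_word w) =
  cut2 (fun u v => ftens (fword u) (fword v)) (map (@fconst g) w).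
Proof.
rewrite [RHS]cut2_map [RHS]cut2E /sh_comul_word (@fconst_sum K); apply: eq_bigr => i _.
by rewrite !fword_const ftens_const.
Qed.

Lemma sh_comulE t : sh_comul t = sweedler (@ftens K _ _) t.
Proof.
rewrite /sh_comul /sweedler /wlift; congr (linext _ t).
by apply/funext => w; rewrite sh_comul_wordE.
Qed.

Lemma sh_comul_linear : linear sh_comul.
Proof.
by move=> a u v; rewrite !sh_comulE; apply: sweedler_linear; apply: ftens_bilin.
Qed.

(** The bridge between the Hopf axioms, stated in the completed tensor square, and the Sweedler sums
    in which they are verified. *)
Lemma tlift_sh_comul (W : lmodType K) (G : T -> T -> fps W) t : bilin G ->
  tlift G (sh_comul t) = sweedler G t.
Proof.
move=> bG; rewrite sh_comulE (sweedler_comp _ (tlift_linear bG) (ftens_bilin _ _)).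
by congr (sweedler _ t); apply/funext => x; apply/funext => y; rewrite tliftE.
Qed.

End ShuffleCoproduct.

Lemma tensA_tlift (K : comNzRingType) (V : lmodType K) :
  @tensA K V = tlift (fun t z => tlift (fun x y => ftens x (ftens y z)) t).
Proof.
rewrite /tensA /tlift; congr tlinext; apply/funext => t; apply/funext => z.
congr (tlinext _ _); apply/funext => x; apply/funext => y.
by rewrite !ftens_const.
Qed.

Lemma tlift_param_linear (K : comNzRingType) (V V' W : lmodType K)
    (U : lmodType (fps K)) (H : U -> fps V -> fps V' -> fps W) t :
  trilin H -> linear (fun u => tlift (H u) t).
Proof.
move=> [lH bH] a x y.
apply: (tens_lin_ext (g := fun t => a *: tlift (H x) t + tlift (H y) t)) t => [||u v].
- exact: tlift_linear.
- by apply: lin_add; [apply: lin_scaler|]; apply: tlift_linear.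
by rewrite !tliftE // lH.
Qed.

Lemma tensA_bilin (K : comNzRingType) (V : lmodType K) :
  bilin (fun t (z : fps V) => tlift (fun x y => ftens x (ftens y z)) t
         : fps (tens V (tens V V))).
Proof.
have bt := @ftens_bilin K; have tl : trilin (fun z x y => ftens x (ftens y z) : fps (tens V (tens V V))).
  split=> [x y|z]; first exact: (lin_comp ((bt V V).2 _) ((bt V (tens V V)).2 _)).
  exact: (bilin_comp (bt _ _) (@lin_id _ _) ((bt V V).1 z)).
split=> [z|t]; first exact: tlift_linear (tl.2 z).
exact: (tlift_param_linear t tl).
Qed.

Section ShuffleHopf.
Variables (K : comNzRingType) (B : Bfamily (fps K)) (g : lieAlgType K).
Variables (lambda : fps K) (hB : in_Blambda lambda B).
Local Notation L := (fps g).
Local Notation T := (fps (tensorAlg g)).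
Local Notation one := (fword [::] : T).
Local Notation mul := (@sh_mul K B g).
Let bm := sh_mul_bilin g hB.

(** The inductive definition of S runs over proper prefixes, whereas [cut2] also has the cut with
    empty right piece; the test on [v] removes it. *)
Lemma sh_anti_recS n (w : seq g) : sh_anti_rec B n.+1 w =
  (if nilp w then one else 0) - cut2 (fun u v => if nilp v then 0 else
     mul (sh_anti_rec B n u) (fconst (tword v))) w.
Proof.
rewrite cut2E big_nat_recr //= drop_size /= addr0.
case: w => [|x w]; first by rewrite !big_geq // subr0.
rewrite sub0r; congr (- _); rewrite [LHS]big_nat_cond [RHS]big_nat_cond.
apply: eq_bigr => i /andP[/andP[_ lti] _].
by rewrite /nilp size_drop subn_eq0 leqNgt lti.
Qed.

Lemma sh_anti_rec_fuel n m (w : seq g) : (size w <= n)%N -> (size w <= m)%N ->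
  sh_anti_rec B n w = sh_anti_rec B m w.
Proof.
elim: n m w => [|n IHn] [|m] w //.
- by case: w => // _ _.
- by case: w.
move=> lewn lewm; rewrite !sh_anti_recS; congr (_ - _).
apply: eq_cut2 => u v Ew; case: ifPn => // nv; congr (mul _ _).
have ltuw : (size u < size w)%N by rewrite Ew size_cat -[X in (X < _)%N]addn0 ltn_add2l lt0n.
by apply: IHn; rewrite -ltnS (leq_trans ltuw).
Qed.

Definition sh_anti_word (w : seq g) : T := sh_anti_rec B (size w) w.

Lemma sh_anti_wordE w : sh_anti_word w =
  (if nilp w then one else 0) -
  cut2 (fun u v => if nilp v then 0 else mul (sh_anti_word u) (fconst (tword v))) w.
Proof.
rewrite /sh_anti_word (@sh_anti_rec_fuel _ (size w).+1) // sh_anti_recS.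
congr (_ - _); apply: eq_cut2 => u v Ew; case: ifPn => // nv; congr (mul _ _).
by apply: sh_anti_rec_fuel; rewrite // Ew size_cat leq_addr.
Qed.

Lemma fscale_morph : forall c : K, {morph (fscale c : T -> T) : a b / a + b}.
Proof. by move=> c a b; rewrite /fscale scalerDr. Qed.

Lemma sh_anti_word_wlin : wlin fscale sh_anti_word.
Proof.
(* Out of fuel, [sh_anti_rec] returns [one] on every word, which is not multilinear. The variant [F]
   stops with [one] on the empty word and 0 elsewhere, and agrees with it as long as the fuel bounds
   the length. *)
have [F lF FE] : exists2 F : nat -> seq g -> T, (forall n, wlin fscale (F n)) &
    forall n w, (size w <= n)%N -> sh_anti_rec B n w = F n w.
  pose F := fix F n := if n is n'.+1 then fun w => (if nilp w then one else 0) -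
      cut2 (fun u v => if nilp v then 0 else mul (F n' u) (fconst (tword v))) w
    else fun w => if nilp w then one else 0.
  exists F => n.
    elim: n => [|n IHn]; first exact: wlin_nilp fscale_morph _.
    apply: (wlin_add fscale_morph); first exact: wlin_nilp fscale_morph _.
    apply: (@wlin_comp _ _ _ _ fscale _ -%R) => [a b|c a|]; rewrite ?opprD //.
      by rewrite /fscale scalerN.
    apply: wlin_cut2 => [|v|u]; first exact: fscale_morph.
      case: nilp; first exact: wlin_zero fscale_morph.
      apply: (@wlin_comp _ _ _ _ fscale _ (fun t => mul t (fconst (tword v))) _ _ _ IHn).
        exact: linD (bm.1 _).
      by move=> c a; apply: linZ (bm.1 _) _ _.
    apply: wlin_unless_nilp => u1 v1 a x y.
    rewrite tword_wlin fconst_linear; exact: bm.2.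
  elim: n => [|n IHn] w; first by case: w.
  move=> lew; rewrite sh_anti_recS /=; congr (_ - _).
  apply: eq_cut2 => u v Ew; case: ifPn => // nv; rewrite IHn // -ltnS.
  apply: leq_trans lew; rewrite Ew size_cat -[X in (X < _)%N]addn0 ltn_add2l.
  by rewrite lt0n.
by move=> u v a x y; rewrite /sh_anti_word !FE // !size_cat /= lF.
Qed.

Definition sh_anti : T -> T := linext sh_anti_word.

Lemma sh_anti_linear : linear sh_anti.
Proof. exact: klift_linear sh_anti_word_wlin. Qed.

Lemma sh_anti_const w : sh_anti (fconst (tword w)) = sh_anti_word w.
Proof. exact: kliftE sh_anti_word_wlin _. Qed.

(** The inductive definition of S says exactly this: the cut with empty right piece gives S(w), and
    the other cuts are the sum subtracted in it. *)
Lemma sh_antil t : sweedler (fun a b => mul (sh_anti a) b) t = teps t *: one.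
Proof.
have bS : bilin (fun a b => mul (sh_anti a) b).
  exact: (bilin_comp bm sh_anti_linear (@lin_id _ _)).
apply: (T_lin_ext (g := fun t => teps t *: one)) t => [||w].
- exact: sweedler_linear.
- by move=> a u v; rewrite teps_linear scalerDl scalerA.
rewrite -fword_const sweedler_word // cut2_map teps_word.
under eq_cut2 => u v _ do rewrite !fword_const sh_anti_const.
have -> : cut2 (fun u v => mul (sh_anti_word u) (fconst (tword v))) w =
    sh_anti_word w + cut2 (fun u v => if nilp v then 0 else
      mul (sh_anti_word u) (fconst (tword v))) w.
  rewrite -[in RHS](sh_mulr1 hB (sh_anti_word w)).
  rewrite -(cut2_counitr (fun u v => mul (sh_anti_word u) (fconst (tword v))) w) -cut2D.
  by apply: eq_cut2 => u v _; case: nilp; rewrite ?addr0 ?add0r.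
rewrite {1}sh_anti_wordE subrK /nilp size_map.
by case: (size w == 0)%N; rewrite ?scale1r ?scale0r.
Qed.

Lemma sh_anti_one : sh_anti one = one.
Proof.
rewrite -[one]/(fconst (tword [::])) sh_anti_const.
by rewrite sh_anti_wordE cut2_nil subr0.
Qed.

(* Convolving S * id = 1 with S on the right gives S * (id * S) = S, from which
   id * S is computed by induction on the length of words. *)
Lemma sh_antir t : sweedler (fun a b => mul a (sh_anti b)) t = teps t *: one.
Proof.
pose E t := sweedler (fun a b => mul a (sh_anti b)) t.
have bE : bilin (fun a b => mul a (sh_anti b)).
  exact: (bilin_comp bm (@lin_id _ _) sh_anti_linear).
have lE : linear E by apply: sweedler_linear.
have bS : bilin (fun a b => mul (sh_anti a) b).
  exact: (bilin_comp bm sh_anti_linear (@lin_id _ _)).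
have SE s : sweedler (fun a b => mul (sh_anti a) (E b)) s = sh_anti s.
  transitivity (sweedler (fun a b => sweedler (fun c d => mul (mul (sh_anti a) c) (sh_anti d)) b) s).
    congr (sweedler _ s); apply/funext => a; apply/funext => b.
    rewrite /E (sweedler_comp _ (bm.2 _) bE); congr (sweedler _ b).
    by apply/funext => c; apply/funext => d; rewrite (sh_mulA hB).
  rewrite sweedlerA; last first.
    split=> [c d|c]; first exact: (lin_comp (lin_comp sh_anti_linear (bm.1 _)) (bm.1 _)).
    exact: (bilin_comp bm (bm.2 _) sh_anti_linear).
  transitivity (sweedler (fun a b => teps a *: sh_anti b) s); last first.
    exact: sweedler_counitl sh_anti_linear.
  congr (sweedler _ s); apply/funext => a; apply/funext => b.
  rewrite -(sweedler_comp _ (bm.1 _) bS) sh_antil (linZ (bm.1 _)).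
  by rewrite (sh_mul1r hB).
suff Ew s : E (fword s) = teps (fword s) *: one.
  apply: (@T_word_ext K g (tensorAlg g) E (fun t => teps t *: one) lE _ Ew t).
  by move=> a u v; rewrite teps_linear scalerDl scalerA.
rewrite teps_word; have [n] := ubnP (size s).
elim: n s => [s lts0|n IHn s]; first by case: (notF lts0).
rewrite ltnS => les.
case: s les => [|x s] les.
  by rewrite /E sweedler_word // cut2_nil sh_anti_one (sh_mul1r hB) scale1r.
rewrite scale0r; have := SE (fword (x :: s)); rewrite sweedler_word; last first.
  exact: (bilin_comp bm sh_anti_linear lE).
rewrite cut2_cons sh_anti_one (sh_mul1r hB).
(* By induction [E] is the counit on proper suffixes, so these cuts add up to the antipode of the
   whole word. That is also the right-hand side, which leaves 0 for [E] of the whole word. *)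
rewrite (@eq_cut2 _ _ _ (fun u v => if nilp v then sh_anti (fword (x :: u)) else 0)).
  by rewrite cut2_counitr => /(canRL (addrK _)); rewrite subrr.
move=> u v Es; rewrite IHn; last first.
  by apply: leq_trans les; rewrite Es /= ltnS size_cat leq_addl.
case: nilp; first by rewrite scale1r (sh_mulr1 hB).
by rewrite scale0r (lin0 (bm.2 _)).
Qed.

Lemma sh_is_hopf : is_hopf (sh_hopf B g).
Proof.
have bt := @ftens_bilin K; have lD := @sh_comul_linear K g.
split=> /=.
- exact: bm.1.
- exact: bm.2.
- exact: sh_mulA hB.
- exact: sh_mul1r hB.
- exact: sh_mulr1 hB.
- exact: lD.
- move=> a; rewrite -!/(sh_comul _) -/(@sh_comul K g).
  have b1 : bilin (fun x y : T => ftens (sh_comul x) y).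
    exact: (bilin_comp (bt _ _) lD (@lin_id _ _)).
  have b2 : bilin (fun x y : T => ftens x (sh_comul y)).
    exact: (bilin_comp (bt _ _) (@lin_id _ _) lD).
  rewrite [tensF (@sh_comul K g) _ _](tlift_sh_comul a b1).
  rewrite [RHS](tlift_sh_comul a b2) tensA_tlift.
  rewrite (sweedler_comp _ (tlift_linear (@tensA_bilin K _)) b1).
  transitivity (sweedler (fun x y => sweedler (fun c d => ftens c (ftens d y)) x) a).
    congr (sweedler _ a); apply/funext => x; apply/funext => y.
    rewrite tliftE; last exact: tensA_bilin.
    apply: tlift_sh_comul; exact: (bilin_comp (bt _ _) (@lin_id _ _) ((bt _ _).1 y)).
  rewrite -(sweedlerA (H := fun x c d => ftens x (ftens c d))); last first.
    split=> [c d|c]; first exact: (bt _ _).1.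
    split=> x; first exact: (lin_comp ((bt _ _).1 x) ((bt _ _).2 _)).
    exact: (lin_comp ((bt _ _).2 x) ((bt _ _).2 _)).
  congr (sweedler _ a); apply/funext => x; apply/funext => y.
  by rewrite sh_comulE (sweedler_comp _ ((bt _ _).2 x) (bt _ _)).
- by move=> c u v; apply: (@teps_linear K g c u v).
- move=> a; rewrite -[RHS](sweedler_counitl a (@lin_id _ _)).
  apply: (tlift_sh_comul (G := fun x y => teps x *: y)).
  split=> u; first by move=> c x y; rewrite teps_linear scalerDl scalerA.
  by apply: lin_scaler.
- move=> a; rewrite -[RHS](sweedler_counitr a (@lin_id _ _)).
  apply: (tlift_sh_comul (G := fun x y => teps y *: x)).
  split=> u; first by apply: lin_scaler.
  by move=> c x y; rewrite teps_linear scalerDl scalerA.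
- move=> a b; rewrite -!/(sh_comul _) sh_comulE (sweedler_sh_mul hB _ _ (bt _ _)).
  rewrite -(tlift_sh_comul a (sweedler_mul_bilin hB b (bt _ _))).
  rewrite /tens_mul {1}/tlift; congr (tlinext _ _).
  apply/funext => x; apply/funext => y; apply/esym.
  apply: (tlift_sh_comul (G := fun b1 b2 => ftens (mul (fconst x) b1) (mul (fconst y) b2))).
  exact: (bilin_comp (bt _ _) (bm.2 _) (bm.2 _)).
- by rewrite -[LHS]/(sh_comul one) sh_comulE sweedler_one //; apply: bt.
- exact: teps_sh_mul hB.
- exact: (@teps_word K g [::]).
- exact: sh_anti_linear.
- move=> a; rewrite -[RHS](sh_antil a).
  apply: (tlift_sh_comul (G := fun x y => mul (sh_anti x) y)).
  exact: (bilin_comp bm sh_anti_linear (@lin_id _ _)).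
- move=> a; rewrite -[RHS](sh_antir a).
  apply: (tlift_sh_comul (G := fun x y => mul x (sh_anti y))).
  exact: (bilin_comp bm (@lin_id _ _) sh_anti_linear).
Qed.

End ShuffleHopf.

(** * Functoriality and twists *)

Section HopfMorphisms.
Variables (K : comNzRingType) (B B' : Bfamily (fps K)) (lambda lambda' : fps K).
Variables (hB : in_Blambda lambda B) (hB' : in_Blambda lambda' B').
Variables (g h : lieAlgType K).
Local Notation T := (fps (tensorAlg g)).
Local Notation T' := (fps (tensorAlg h)).
Variable F : T -> T'.
Hypothesis lF : linear F.
Hypothesis F1 : F (fword [::]) = fword [::].
Hypothesis FM : forall x y : seq (fps g),
  F (sh_mul B (fword x) (fword y)) = sh_mul B' (F (fword x)) (F (fword y)).
Hypothesis FD : forall (W : lmodType K) (G : T' -> T' -> fps W) (x : seq (fps g)),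
  bilin G -> sweedler G (F (fword x)) = cut2 (fun u v => G (F (fword u)) (F (fword v))) x.
Hypothesis Feps : forall x : seq (fps g), teps (F (fword x)) = teps (fword x).

Let bm := sh_mul_bilin g hB.
Let bm' := sh_mul_bilin h hB'.

Lemma morph_sh_mul a b : F (sh_mul B a b) = sh_mul B' (F a) (F b).
Proof.
apply: (T_word_ext (f := fun a => F (sh_mul B a b))
  (g := fun a => sh_mul B' (F a) (F b))) a.
- exact: (lin_comp (bm.1 b) lF).
- exact: (lin_comp lF (bm'.1 _)).
move=> x; apply: (T_word_ext (f := fun b => F (sh_mul B (fword x) b))
  (g := fun b => sh_mul B' (F (fword x)) (F b))) b.
- exact: (lin_comp (bm.2 _) lF).
- exact: (lin_comp lF (bm'.2 _)).
by move=> y; apply: FM.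
Qed.

Lemma morph_sweedler (W : lmodType K) (G : T' -> T' -> fps W) t : bilin G ->
  sweedler G (F t) = sweedler (fun a b => G (F a) (F b)) t.
Proof.
move=> bG; have bF := bilin_comp bG lF lF.
apply: (T_word_ext (f := fun t => sweedler G (F t))) t => [||x].
- exact: (lin_comp lF (sweedler_linear bG)).
- exact: sweedler_linear.
by rewrite FD // sweedler_word.
Qed.

Lemma morph_teps t : teps (F t) = teps t.
Proof.
apply: (T_word_ext (W := K^o) (f := fun t => teps (F t)) (g := fun t => teps t)) t => //.
  by move=> c u v; rewrite lF teps_linear.
exact: teps_linear.
Qed.

(* F S and S' F are both inverse to F for the convolution. *)
Lemma morph_sh_anti t : F (sh_anti B t) = sh_anti B' (F t).
Proof.
have lS := sh_anti_linear (g := g) hB; have lS' := sh_anti_linear (g := h) hB'.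
have lFS : linear (fun a => F (sh_anti B a)) by exact: (lin_comp lS lF).
have lSF : linear (fun a => sh_anti B' (F a)) by exact: (lin_comp lF lS').
have bl : bilin (fun a b => sh_mul B' (F (sh_anti B a)) (F b)).
  exact: (bilin_comp bm' lFS lF).
have br : bilin (fun a b => sh_mul B' (F a) (sh_anti B' (F b))).
  exact: (bilin_comp bm' lF lSF).
transitivity (sweedler (fun a b => sweedler (fun c d =>
   sh_mul B' (F (sh_anti B a)) (sh_mul B' (F c) (sh_anti B' (F d)))) b) t).
  rewrite -(sweedler_counitr t lFS); congr (sweedler _ t); apply/funext => a; apply/funext => b.
  rewrite -(sweedler_comp _ (bm'.2 _) br).
  rewrite -(@morph_sweedler _ (fun c d => sh_mul B' c (sh_anti B' d))); last first.
    exact: (bilin_comp bm' (@lin_id _ _) lS').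
  by rewrite (sh_antir hB') morph_teps (linZ (bm'.2 _)) (sh_mulr1 hB').
rewrite (sweedlerA (H := fun a c d =>
   sh_mul B' (F (sh_anti B a)) (sh_mul B' (F c) (sh_anti B' (F d))))); last first.
  split=> [c d|a]; first exact: (lin_comp lFS (bm'.1 _)).
  by split=> u; [exact: (lin_comp (br.1 u) (bm'.2 _))|exact: (lin_comp (br.2 u) (bm'.2 _))].
rewrite -[RHS](sweedler_counitl t lSF); congr (sweedler _ t); apply/funext => a; apply/funext => b.
transitivity (sh_mul B' (sweedler (fun c d => sh_mul B' (F (sh_anti B c)) (F d)) a)
                (sh_anti B' (F b))).
  rewrite (sweedler_comp _ (bm'.1 _) bl); congr (sweedler _ a).
  by apply/funext => c; apply/funext => d; rewrite (sh_mulA hB').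
rewrite (_ : sweedler _ a = F (sweedler (fun c d => sh_mul B (sh_anti B c) d) a)); last first.
  rewrite (sweedler_comp _ lF); last exact: (bilin_comp bm lS (@lin_id _ _)).
  by congr (sweedler _ a); apply/funext => c; apply/funext => d; rewrite morph_sh_mul.
by rewrite (sh_antil hB) (linZ lF) F1 (linZ (bm'.1 _)) (sh_mul1r hB').
Qed.

(** The hypotheses of the section concern words only and say nothing on the antipode: linearity
    extends them, and compatibility with the antipode follows from uniqueness of convolution
    inverses. *)
Lemma sh_hopf_morph : hopf_morph (sh_hopf B g) (sh_hopf B' h) F.
Proof.
split=> //=; try exact: morph_sh_mul.
- move=> a; rewrite -!/(sh_comul _) sh_comulE morph_sweedler; last exact: ftens_bilin.
  apply/esym/(tlift_sh_comul (G := fun x y => ftens (F x) (F y))).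
  exact: (bilin_comp (@ftens_bilin K _ _)).
- exact: morph_teps.
- exact: morph_sh_anti.
Qed.

End HopfMorphisms.

(** * Functoriality in the Lie algebra *)

Section LieMorphisms.
Variables (K : comNzRingType) (g h : lieAlgType K) (f : g -> h).
Local Notation T := (fps (tensorAlg g)).
Hypotheses (lf : linear f) (fbr : {morph f : x y / lbr x y}).

Definition fps_map (u : fps g) : fps h := Fps (fun n => f (u n)).

Lemma fps_map_linear : linear fps_map.
Proof.
move=> a u v; apply: fpsP => n; rewrite !fps_addE !fps_scaleE /= (linD lf).
by rewrite (lin_sum _ _ _ lf); congr (_ + _); apply: eq_bigr => i _; rewrite (linZ lf).
Qed.

Lemma fps_map_lie : lie_morph fps_map.
Proof.
split=> [|u v]; first exact: fps_map_linear.
apply: fpsP => n /=; rewrite (lin_sum _ _ _ lf).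
by apply: eq_bigr => i _; rewrite fbr.
Qed.

Lemma fps_map_const x : fps_map (fconst x) = fconst (f x).
Proof. by apply: fpsP => -[|n] //=; rewrite (lin0 lf). Qed.

Lemma sh_map_wlin : wlin fscale (fun w : seq g => fconst (tword (map f w))).
Proof.
by move=> u v a x y; rewrite !map_cat /= lf tword_wlin fconst_linear.
Qed.

Lemma sh_map_linear : linear (sh_map f).
Proof. exact: klift_linear sh_map_wlin. Qed.

Lemma sh_map_const w : sh_map f (fconst (tword w)) = fconst (tword (map f w)).
Proof. exact: kliftE sh_map_wlin _. Qed.

Lemma sh_map_word (s : seq (fps g)) : sh_map f (fword s) = fword (map fps_map s).
Proof.
apply: (word_ext (F := fun s => sh_map f (fword s))
  (G := fun s => fword (map fps_map s))) s.
- exact: (wlin_lin sh_map_linear (@fword_wlin _ _)).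
- by move=> u v a x y; rewrite !map_cat /= fps_map_linear fword_wlin.
move=> w; rewrite fword_const sh_map_const -fword_const -!map_comp.
by congr (fword _); apply: eq_map => x /=; rewrite fps_map_const.
Qed.

Lemma sh_map_hopf_morph B lambda : in_Blambda lambda B ->
  hopf_morph (sh_hopf B g) (sh_hopf B h) (sh_map f).
Proof.
move=> hB; apply: (@sh_hopf_morph _ _ _ _ _ hB hB _ _ _ sh_map_linear).
- exact: (sh_map_word [::]).
- move=> x y; rewrite (sh_mul_words hB) !sh_map_word (sh_mul_words hB).
  rewrite /mulw !size_map (lin_sum _ _ _ sh_map_linear); apply: eq_bigr => k _.
  rewrite /blockw splits_map big_map (lin_sum _ _ _ sh_map_linear).
  apply: eq_bigr => I _; rewrite splits_map big_map (lin_sum _ _ _ sh_map_linear).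
  by apply: eq_bigr => J _; rewrite sh_map_word (Bblocks_map fps_map_lie).
- move=> W G x bG; rewrite sh_map_word sweedler_word // cut2_map.
  by apply: eq_cut2 => u v _; rewrite !sh_map_word.
by move=> x; rewrite sh_map_word !teps_word /nilp size_map.
Qed.

End LieMorphisms.

Lemma sh_map_id (K : comNzRingType) (g : lieAlgType K) : sh_map (@idfun g) =1 idfun.
Proof.
apply: T_lin_ext => [||w] //; first exact: sh_map_linear.
by rewrite sh_map_const // map_id.
Qed.

Lemma sh_map_comp (K : comNzRingType) (g h l : lieAlgType K) (f : g -> h) (f' : h -> l) :
  linear f -> linear f' -> sh_map (f' \o f) =1 sh_map f' \o sh_map f.
Proof.
move=> lf lf'; have lff' : linear (f' \o f) by exact: (lin_comp lf lf').
apply: T_lin_ext => [||w] /=; first exact: sh_map_linear.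
  exact: (lin_comp (sh_map_linear lf) (sh_map_linear lf')).
by rewrite !sh_map_const // -map_comp.
Qed.

(** * The twist by an element of the group G *)

Section Twist.
Variables (K : comNzRingType) (g : lieAlgType K) (P : Pfamily (fps K)) (hP : in_G P).
Local Notation L := (fps g).
Local Notation T := (fps (tensorAlg g)).
Local Notation one := (fword [::] : T).
Implicit Types s : seq L.

Definition blocktw k s : T :=
  \sum_(I <- splits k s) fword [seq Pev P b | b <- I].

Definition twist_word s : T := \sum_(0 <= k < (size s).+1) blocktw k s.

Lemma psplits_sum (M : zmodType) k s (G : seq L -> M) :
  (forall I, 0 \in I -> G I = 0) ->
  \sum_(I <- psplits k s) G [seq Pev P b | b <- I] =
  \sum_(I <- splits k s) G [seq Pev P b | b <- I].
Proof.
move=> G0; rewrite /psplits big_filter big_mkcond; apply: eq_bigr => I _.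
case: ifPn => // /allPn[b bI]; rewrite negbK => /nilP b0.
by rewrite G0 // -(Pev_nil _ hP.1) -b0; apply: map_f.
Qed.

Lemma fword_0 s : 0 \in s -> fword s = 0.
Proof.
elim: s => // x s IHs; rewrite inE fword_cons => /orP[/eqP<-|/IHs->].
  exact: fcons0.
exact: lin0 ((fcons_bilin g).2 x).
Qed.

Lemma blocktw0 s : blocktw 0 s = if nilp s then one else 0.
Proof. exact: splits0_sum. Qed.

Lemma blocktwS k s : blocktw k.+1 s = cut2 (fun u v => fcons (Pev P u) (blocktw k v)) s.
Proof.
rewrite /blocktw splitsS_sum; apply: eq_cut2 => u v _.
by rewrite (lin_sum _ _ _ ((fcons_bilin g).2 _)).
Qed.

Lemma blocktw_wlin k : wlin *:%R (blocktw k).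
Proof.
elim: k => [|k IHk].
  have -> : blocktw 0 = (fun s => if nilp s then one else 0).
    by apply/funext => s; rewrite blocktw0.
  by apply: wlin_nilp; apply: scale_morph.
have -> : blocktw k.+1 = cut2 (fun u v => fcons (Pev P u) (blocktw k v)).
  by apply/funext => s; rewrite blocktwS.
apply: wlin_cut2 => [|v|u]; first exact: scale_morph.
  exact: (wlin_lin ((fcons_bilin g).1 _) (Pev_wlin hP.1)).
exact: (wlin_lin ((fcons_bilin g).2 _) IHk).
Qed.

Lemma twist_word_wlin : wlin *:%R twist_word.
Proof.
move=> u v a x1 x2; rewrite /twist_word !size_cat /= scaler_sumr -big_split /=.
by apply: eq_bigr => k _; rewrite blocktw_wlin.
Qed.

Lemma sh_twist_wlift : @sh_twist K g P = wlift twist_word.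
Proof.
rewrite /sh_twist /wlift; congr linext; apply/funext => w.
rewrite /twist_word size_map; apply: eq_bigr => k _.
exact: (psplits_sum _ _ fword_0).
Qed.

Lemma sh_twist_linear : linear (@sh_twist K g P).
Proof. by rewrite sh_twist_wlift; apply: wlift_linear twist_word_wlin. Qed.

Lemma sh_twist_word s : sh_twist P (fword s) = twist_word s.
Proof. by rewrite sh_twist_wlift wliftE //; apply: twist_word_wlin. Qed.

Let head1 (M : Type) (m0 : M) (F : seq L -> M) (X : seq (seq L)) :=
  if X is [:: x] then F x else m0.

Let f1 := head1 (0 : L) (fun s => Pev P s).
Let T1 := head1 (0 : T) twist_word.

Lemma f1_empty X : size X = 1 -> allnil X -> f1 X = 0.
Proof.
case: X => [|x []] //= _; rewrite andbT => /nilP->.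
exact: Pev_nil hP.1.
Qed.

Lemma T1_rec X : size X = 1 ->
  T1 X = (if allnil X then one else 0) + cutm (fun Y Z => fcons (f1 Y) (T1 Z)) X.
Proof.
move=> sX; have rec := (blocks_rec (A := fun k => head1 (0 : T) (blocktw k)) f1_empty).
have TE Y : size Y = 1 -> T1 Y = \sum_(0 <= k < (msize Y).+1) head1 (0 : T) (blocktw k) Y.
  by case: Y => [|x []] //= _; rewrite /msize /= addn0.
rewrite TE // rec //; last 2 first.
- by case=> [|x []] //= _; rewrite blocktw0 andbT.
- by move=> k; case=> [|x []] //= _; rewrite blocktwS.
by congr (_ + _); apply: eq_cutm => Y Z sY sZ _; rewrite TE ?sZ.
Qed.

Lemma twist_word_comult : comult 1 T1.
Proof. exact: rec_comult f1_empty T1_rec. Qed.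

Lemma twist_word_rec s : twist_word s =
  (if nilp s then one else 0) + cut2 (fun u v => fcons (Pev P u) (twist_word v)) s.
Proof. by have := T1_rec (X := [:: s]) erefl; rewrite /= andbT. Qed.

Lemma tpi_twist s : tpi (sh_twist P (fword s)) = Pev P s.
Proof. rewrite sh_twist_word; exact: (rec_tpi f1_empty T1_rec (X := [:: s])). Qed.

Lemma sweedler_twist (W : lmodType K) (G : T -> T -> fps W) s : bilin G ->
  sweedler G (sh_twist P (fword s)) =
  cut2 (fun u v => G (sh_twist P (fword u)) (sh_twist P (fword v))) s.
Proof.
move=> bG; rewrite sh_twist_word (comult_sweedler twist_word_comult (X := [:: s])) //=.
by apply: eq_cut2 => u v _; rewrite !sh_twist_word.
Qed.

Lemma twist_one : sh_twist P one = one.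
Proof. rewrite sh_twist_word; exact: (comult_empty twist_word_comult (X := [:: [::]])). Qed.

Lemma teps_twist s : teps (sh_twist P (fword s)) = teps (fword s).
Proof.
rewrite sh_twist_word teps_word; case: ifPn => [/nilP->|ns].
  by rewrite -sh_twist_word twist_one teps_word.
by apply: (comult_eps twist_word_comult (X := [:: s])); rewrite //= andbT.
Qed.

Definition shorter n (t : T) := exists2 cs : seq (seq L),
  (forall c, c \in cs -> (size c < n)%N) & t = \sum_(c <- cs) fword c.

Lemma shorter0 n : shorter n 0.
Proof. by exists [::]; rewrite ?big_nil. Qed.

Lemma shorterD n t u : shorter n t -> shorter n u -> shorter n (t + u).
Proof.
move=> [cs csP ->] [ds dsP ->]; exists (cs ++ ds); last by rewrite big_cat.
by move=> c; rewrite mem_cat => /orP[/csP|/dsP].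
Qed.

Lemma shorterW n m t : (n <= m)%N -> shorter n t -> shorter m t.
Proof. by move=> lenm [cs csP ->]; exists cs => // c /csP/leq_trans->. Qed.

Lemma shorter_word n s : (size s < n)%N -> shorter n (fword s).
Proof. by move=> ltsn; exists [:: s]; rewrite ?big_seq1 // => c; rewrite inE => /eqP->. Qed.

Lemma shorter_cons n x t : shorter n t -> shorter n.+1 (fcons x t).
Proof.
move=> [cs csP ->]; exists [seq x :: c | c <- cs].
  by move=> _ /mapP[c /csP ltcn ->].
by rewrite big_map (lin_sum _ _ _ ((fcons_bilin g).2 x)).
Qed.

Lemma shorter_cut2 n F s : (forall u v, s = u ++ v -> shorter n (F u v)) ->
  shorter n (cut2 F s).
Proof.
move=> Fn; rewrite cut2E; elim/big_ind: _ => [|t u|i _].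
- exact: shorter0.
- exact: shorterD.
by apply: Fn; rewrite cat_take_drop.
Qed.

(* The twist is unipotent for the filtration by the length of words. *)
Lemma twist_shorter s : shorter (size s) (sh_twist P (fword s) - fword s).
Proof.
have [n] := ubnP (size s); elim: n s => // n IHn s; rewrite ltnS => les.
case: s les => [|x s] les; first by rewrite twist_one subrr; apply: shorter0.
have ts v : (size v <= size s)%N -> shorter (size v).+1 (sh_twist P (fword v)).
  move=> lev; rewrite -[sh_twist _ _](subrK (fword v)).
  apply: shorterD; last exact: shorter_word.
  by apply: shorterW (IHn v (leq_ltn_trans lev les)).
rewrite sh_twist_word twist_word_rec /= add0r (Pev_nil _ hP.1) fcons0 add0r.
(* If [u] is empty the first block is the letter [x], fixed by P_1, and induction applies to [s].
   Otherwise the first block merges at least two letters, which shortens the word. *)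
rewrite (@eq_cut2 _ _ _ (fun u v => (if nilp u then fcons x (twist_word v) else 0) +
    (if nilp u then 0 else fcons (Pev P (x :: u)) (twist_word v)))); last first.
  move=> u v _; case: ifP => [/nilP->|]; rewrite ?addr0 ?add0r //.
  by rewrite (Pev_one _ hP.2).
rewrite cut2D cut2_counitl addrAC; apply: shorterD.
  rewrite fword_cons -(linB ((fcons_bilin g).2 x)) -sh_twist_word.
  exact: shorter_cons (IHn s les).
apply: shorter_cut2 => u v Es; case: ifPn => [_|nu]; first exact: shorter0.
have ltv : (size v < size s)%N.
  by rewrite Es size_cat -[X in (X < _)%N]add0n ltn_add2r lt0n.
rewrite -sh_twist_word; apply: shorterW (shorter_cons _ (ts v (ltnW ltv))).
by rewrite ltnS.
Qed.

Let N (t : T) : T := sh_twist P t - t.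

Lemma twist_sub_linear : linear N.
Proof. exact: (lin_add sh_twist_linear (lin_opp (@lin_id _ _))). Qed.

Lemma shorter_lin_eq0 (F : T -> T) n t : linear F ->
  (forall s, (size s < n)%N -> F (fword s) = 0) -> shorter n t -> F t = 0.
Proof.
move=> lF Fs [cs csP ->]; rewrite (lin_sum _ _ _ lF) big_seq big1 // => c /csP.
exact: Fs.
Qed.

Lemma iter_N_linear i : linear (iter i N).
Proof.
elim: i => [|i IHi]; first exact: lin_id.
exact: (lin_comp IHi twist_sub_linear).
Qed.

Lemma iter_N_eq0 i s : (size s < i)%N -> iter i N (fword s) = 0.
Proof.
elim: i s => // i IHi s; rewrite ltnS => les; rewrite iterSr.
apply: (shorter_lin_eq0 (iter_N_linear i) _ (twist_shorter s)) => c ltc.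
by apply: IHi; apply: leq_trans les.
Qed.

(* The geometric series inverting 1 + N, truncated by the length of the word. *)
Let J n (t : T) : T := \sum_(i < n) (-1) ^+ i *: iter i N t.

Lemma J_recr n t : J n.+1 t = J n t + (-1) ^+ n *: iter n N t.
Proof. exact: big_ord_recr. Qed.

Lemma J_linear n : linear (J n).
Proof.
by apply: lin_bigsum => i; apply: lin_scaler; apply: iter_N_linear.
Qed.

Lemma J_twist n t : J n (sh_twist P t) = t - (-1) ^+ n *: iter n N t.
Proof.
have -> : sh_twist P t = t + N t by rewrite addrC subrK.
elim: n => [|n IHn]; first by rewrite /J big_ord0 scale1r subrr.
rewrite J_recr IHn (linD (iter_N_linear n)) -iterSr /=.
by rewrite exprS scalerDr addrA subrK mulN1r scaleNr opprK.
Qed.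

Lemma twist_J n t : sh_twist P (J n t) = t - (-1) ^+ n *: iter n N t.
Proof.
have tE u : sh_twist P u = u + N u by rewrite addrC subrK.
rewrite /J (lin_sum _ _ _ sh_twist_linear).
elim: n => [|n IHn]; first by rewrite big_ord0 scale1r subrr.
rewrite big_ord_recr IHn /= (linZ sh_twist_linear) tE scalerDr addrA subrK.
by rewrite exprS mulN1r scaleNr opprK.
Qed.

Lemma J_stable n s : (size s < n)%N -> J n (fword s) = J (size s).+1 (fword s).
Proof.
move=> /subnK <-; elim: (n - _)%N => // d IHd.
by rewrite addSn J_recr IHd iter_N_eq0 ?leq_addl // scaler0 addr0.
Qed.

Lemma twist_bij : bijective (@sh_twist K g P).
Proof.
have wJ : wlin *:%R (fun s => J (size s).+1 (fword s)).
  by move=> u v a x y; rewrite fword_wlin !size_cat /=; apply: J_linear.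
have lJ := wlift_linear wJ; have lT := sh_twist_linear.
exists (wlift (fun s => J (size s).+1 (fword s))) => t.
  apply: (T_word_ext (g := idfun) (lin_comp lT lJ)) t => // s.
  (* The twist of [s] is a sum of words of length at most [size s]; by [J_stable] the order
     [(size s).+1] suffices for all of them at once. *)
  transitivity (J (size s).+1 (sh_twist P (fword s))); last first.
    by rewrite J_twist iter_N_eq0 // scaler0 subr0.
  have lD := lin_add lJ (lin_opp (J_linear (size s).+1)).
  apply/eqP; rewrite -subr_eq0; apply/eqP.
  apply: (shorter_lin_eq0 (n := (size s).+1) lD) => [c ltc|].
    by rewrite wliftE // (J_stable ltc) subrr.
  rewrite -[sh_twist P _](subrK (fword s)); apply: shorterD.
    exact: shorterW (twist_shorter s).
  exact: shorter_word.
apply: (T_word_ext (g := idfun) (lin_comp lJ lT)) t => // s.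
by rewrite wliftE // twist_J iter_N_eq0 // scaler0 subr0.
Qed.

End Twist.

Section TwistMorphism.
Variables (K : comNzRingType) (B B' : Bfamily (fps K)) (lambda lambda' : fps K).
Variables (hB : in_Blambda lambda B) (hB' : in_Blambda lambda' B').
Variables (P : Pfamily (fps K)) (hP : in_G P) (hPBB' : transports P B B').
Variable g : lieAlgType K.
Local Notation L := (fps g).
Local Notation T := (fps (tensorAlg g)).
Local Notation tw := (@sh_twist K g P).

Let pair2 (F : seq L -> seq L -> T) (X : seq (seq L)) : T :=
  if X is [:: x; y] then F x y else 0.

Lemma tpi_twist_mul (x y : seq L) :
  tpi (tw (sh_mul B (fword x) (fword y))) =
  tpi (sh_mul B' (tw (fword x)) (tw (fword y))).
Proof.
have lT := @sh_twist_linear _ g _ hP; have bm' := sh_mul_bilin g hB'.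
have [s0|s0] := posnP (size x + size y).
  move/eqP: s0; rewrite addn_eq0 => /andP[/nilP-> /nilP->].
  by rewrite (sh_mul1r hB) (twist_one _ hP) (sh_mul1r hB').
rewrite (tpi_mul_sum hB (lin_comp lT (@tpi_linear _ _)) s0).
under eq_bigr do under eq_bigr do under eq_bigr do rewrite tpi_twist //.
rewrite (transports_eval x y hPBB') !(sh_twist_word hP) /twist_word.
rewrite (lin_sum _ _ _ (bm'.1 _)) (lin_sum _ _ _ (@tpi_linear _ _)).
apply: eq_bigr => k _.
rewrite (lin_sum _ _ _ (bm'.2 _)) (lin_sum _ _ _ (@tpi_linear _ _)).
apply: eq_bigr => l _.
rewrite /blocktw (lin_sum _ _ _ (bm'.1 _)) (lin_sum _ _ _ (@tpi_linear _ _)).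
(* The orbit relation has nonempty blocks on this side, the twist arbitrary ones. The extra terms
   contain a zero letter, and B' vanishes there, being the projection of a product with a zero
   word. *)
rewrite (psplits_sum hP k x (G := fun I' => \sum_(J <- psplits l y)
   Bev B' I' [seq Pev P b | b <- J])); last first.
  move=> I I0; rewrite big1 // => J _.
  by rewrite -(tpi_sh_mul hB') fword_0 // (lin0 (bm'.1 _)) (lin0 (@tpi_linear _ _)).
apply: eq_bigr => I _.
rewrite (lin_sum _ _ _ (bm'.2 _)) (lin_sum _ _ _ (@tpi_linear _ _)).
rewrite (psplits_sum hP l y (G := fun J' => Bev B' [seq Pev P b | b <- I] J')).
  by apply: eq_bigr => J _; rewrite (tpi_sh_mul hB').
move=> J J0.
by rewrite -(tpi_sh_mul hB') (fword_0 J0) (lin0 (bm'.2 _)) (lin0 (@tpi_linear _ _)).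
Qed.

Lemma twist_mul_words (x y : seq L) :
  tw (sh_mul B (fword x) (fword y)) = sh_mul B' (tw (fword x)) (tw (fword y)).
Proof.
have lT := @sh_twist_linear _ g _ hP; have bm' := sh_mul_bilin g hB'.
pose Phi := pair2 (fun x y => tw (sh_mul B (fword x) (fword y))).
pose Psi := pair2 (fun x y => sh_mul B' (tw (fword x)) (tw (fword y))).
suff [cPhi cPsi] : comult 2 Phi /\ comult 2 Psi.
  apply: (comult_uniq cPhi cPsi _ (_ : size [:: x; y] = 2)) => //.
  by case=> [|{}x [|{}y []]] //= _; apply: tpi_twist_mul.
have twD (W : lmodType K) (G : T -> T -> fps W) t : bilin G -> sweedler G (tw t) = sweedler (fun a b => G (tw a) (tw b)) t.
  by move=> bG; apply: (morph_sweedler lT (sweedler_twist hP)).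
have twE t : teps (tw t) = teps t by apply: (morph_teps lT (teps_twist hP)).
split; (split=> [[|{}x [|{}y []]] //= _|[|{}x [|{}y []]] //= _|W G [|{}x [|{}y []]] //= bG _]).
- by case/and3P=> /nilP-> /nilP-> _; rewrite (sh_mul1r hB) (twist_one _ hP).
- rewrite andbT twE (teps_sh_mul hB) !teps_word.
  by case: (nilp x); case: (nilp y) => //= _; rewrite ?mul0r ?mulr0.
- have bG' := bilin_comp bG lT lT.
  rewrite twD // (sweedler_sh_mul hB _ _ bG') sweedler_word; last exact: (sweedler_mul_bilin hB _ bG').
  apply: eq_cut2 => u v _; rewrite sweedler_word //.
  have bm := sh_mul_bilin g hB; exact: (bilin_comp bG' (bm.2 _) (bm.2 _)).
- by case/and3P=> /nilP-> /nilP-> _; rewrite (twist_one _ hP) (sh_mul1r hB').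
- rewrite andbT (teps_sh_mul hB') !twE !teps_word.
  by case: (nilp x); case: (nilp y) => //= _; rewrite ?mul0r ?mulr0.
rewrite (sweedler_sh_mul hB' _ _ bG) (sweedler_twist hP); last exact: (sweedler_mul_bilin hB' _ bG).
apply: eq_cut2 => u v _; rewrite (sweedler_twist hP) //.
exact: (bilin_comp bG (bm'.2 _) (bm'.2 _)).
Qed.

Lemma sh_twist_hopf_iso : hopf_iso (sh_hopf B g) (sh_hopf B' g) tw.
Proof.
split; last exact: twist_bij.
apply: (@sh_hopf_morph _ _ _ _ _ hB hB' _ _ _ (sh_twist_linear hP)).
- exact: twist_one.
- exact: twist_mul_words.
- by move=> W G x; apply: sweedler_twist.
- exact: teps_twist.
Qed.

End TwistMorphism.

Lemma sh_map_twist (K : comNzRingType) (P : Pfamily (fps K)) (hP : in_G P)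
    (g h : lieAlgType K) (f : g -> h) : linear f -> {morph f : x y / lbr x y} ->
  sh_map f \o @sh_twist K g P =1 @sh_twist K h P \o sh_map f.
Proof.
move=> lf fbr; have lm := sh_map_linear lf.
apply: T_word_ext => [||s] /=.
- exact: (lin_comp (sh_twist_linear hP) lm).
- exact: (lin_comp lm (sh_twist_linear hP)).
rewrite sh_map_word // !sh_twist_word // /twist_word size_map (lin_sum _ _ _ lm).
apply: eq_bigr => k _; rewrite /blocktw splits_map big_map (lin_sum _ _ _ lm).
by apply: eq_bigr => I _; rewrite sh_map_word // (map_Pev_map (fps_map_lie lf fbr)).
Qed.

(** * Polarization and symmetric tensors *)

Section Polarization.
Variables (K : comNzRingType) (V M : lmodType K).

Lemma wlin_nseq_sum (I : finType) (A : {set I}) (v : I -> V) n (F : seq V -> M) :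
  wlin *:%R F ->
  F (nseq n (\sum_(i in A) v i)) =
  \sum_(c : n.-tuple I | all (mem A) c) F (map v c).
Proof.
elim: n F => [|n IHn] F lF.
  rewrite (big_pred1 [tuple]) // => c; rewrite (tuple0 c) /= eqxx; exact: erefl.
have lin1 s : linear (fun x => F (x :: s)) by move=> a x y; apply: (lF [::]).
rewrite /= (lin_sum _ _ _ (lin1 _)).
rewrite (eq_bigr (fun i => \sum_(c : n.-tuple I | all (mem A) c) F (v i :: map v c))).
rewrite pair_big_dep /=.
rewrite [RHS](reindex (fun p : I * n.-tuple I => cons_tuple p.1 p.2)) //=.
exists (fun c : n.+1.-tuple I => (thead c, behead_tuple c)) => [[i c] _ /=|c _].
    by congr (_, _); apply: val_inj.
  by rewrite [RHS]tuple_eta; apply: val_inj.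
by move=> i _; apply: (IHn (fun s => F (v i :: s))) => u; apply: (lF (v i :: u)).
Qed.

(** A word of length n that contains all of n letters has no repetition, hence lists the values of a
    permutation. *)
Lemma surjective_tuple_sum n (G : seq 'I_n -> M) :
  \sum_(c : n.-tuple 'I_n | [forall i, i \in c]) G c =
  \sum_(s : 'S_n) G (map s (enum 'I_n)).
Proof.
pose h (s : 'S_n) := [tuple s i | i < n].
pose h' (c : n.-tuple 'I_n) : {perm 'I_n} :=
  if pselect (injective (tnth c)) is left inj then perm inj else 1%g.
have h'E c (inj : injective (tnth c)) i : h' c i = tnth c i.
  by rewrite /h'; case: pselect => // ?; rewrite permE.
have inj_h s : injective (tnth (h s)) by move=> i j; rewrite !tnth_mktuple => /perm_inj.
rewrite (reindex_onto h h') => [|c /forallP cP]; last first.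
  have injc : injective (tnth c).
    apply/tuple_uniqP/card_uniqP; rewrite size_tuple -[RHS]card_ord.
    by apply: eq_card => i; rewrite cP.
  by apply: eq_from_tnth => i; rewrite tnth_mktuple h'E.
apply: eq_big => [s|s _].
  rewrite (_ : h' (h s) = s); last first.
    by apply/permP => i; rewrite h'E // tnth_mktuple.
  rewrite eqxx andbT; apply/forallP => i; apply/tnthP; exists (s^-1%g i).
  by rewrite tnth_mktuple permKV.
by rewrite /h /=.
Qed.

End Polarization.

Section PolarizationSpan.
Variables (K : fieldType) (V M : lmodType K) (Q : M -> Prop).
Hypotheses (Q0 : Q 0) (Qlin : forall a x y, Q x -> Q y -> Q (a *: x + y)).

Lemma span_scale a x : Q x -> Q (a *: x).
Proof. by move=> Qx; rewrite -[_ *: _]addr0; apply: Qlin. Qed.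

Lemma span_add x y : Q x -> Q y -> Q (x + y).
Proof. by move=> Qx Qy; rewrite -[x]scale1r; apply: Qlin. Qed.

Lemma span_opp x : Q x -> Q (- x).
Proof. by rewrite -scaleN1r; apply: span_scale. Qed.

Lemma span_sum I (r : seq I) (P : pred I) (F : I -> M) :
  (forall i, P i -> Q (F i)) -> Q (\sum_(i <- r | P i) F i).
Proof. by move=> QF; elim/big_ind: _ => //; apply: span_add. Qed.

(* Inclusion-exclusion: \prod_i (1 - [i \notin c]) selects, among the words c in
   n letters, those in which every letter occurs. *)
Lemma polarization (F : seq V -> M) (w : seq V) : wlin *:%R F ->
  (forall x, Q (F (nseq (size w) x))) ->
  Q (\sum_(s : 'S_(size w)) F [seq nth 0 w (s i) | i <- enum 'I_(size w)]).
Proof.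
move=> lF QF; set n := size w; pose v (i : 'I_n) := nth 0 w i.
(* The sign (-1)^(n - |A|), written as a product over letters so that the sum over [A] factors. *)
pose sgn (A : {set 'I_n}) : K := \prod_(i : 'I_n) (if i \in A then 1 else -1).
suff <- : \sum_(A : {set 'I_n}) sgn A *: F (nseq n (\sum_(i in A) v i)) =
    \sum_(s : 'S_n) F [seq nth 0 w (s i) | i <- enum 'I_n].
  by apply: span_sum => A _; apply: span_scale.
rewrite (eq_bigr (fun s : 'S_n => F (map v (map s (enum 'I_n))))); last first.
  by move=> s _; congr (F _); rewrite -[RHS]map_comp; apply: eq_map.
rewrite -(surjective_tuple_sum (fun c => F (map v c))).
under eq_bigr do rewrite wlin_nseq_sum // scaler_sumr.
rewrite (exchange_big_dep xpredT) //= [RHS]big_mkcond /=; apply: eq_bigr => c _.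
rewrite -scaler_suml.
(* Expanding the product chooses a set [A]: a letter in [A] contributes 1, one outside it 0 or -1,
   so only the sets containing all the letters of [c] survive. *)
have -> : \sum_(A : {set 'I_n} | all (mem A) c) sgn A =
    \prod_(i : 'I_n) (1 + (if i \in c then 0 else -1)).
  rewrite bigA_distr [LHS]big_mkcond; apply: eq_bigr => A _; case: ifPn => [/allP cA|/allPn[i ic iA]].
    apply: eq_bigr => i _; case: ifPn => // iA.
    by case: ifPn => // ic; case/negP: iA; apply: cA.
  by rewrite (bigD1 i) //= ic (_ : (i \in A) = false) ?mul0r //; apply: negPf iA.
case: ifPn => [/forallP ic|/forallPn[i /negPf ic]].
  by rewrite big1 ?scale1r // => i _; rewrite ic addr0.
by rewrite (bigD1 i) //= ic subrr mul0r scale0r.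
Qed.

End PolarizationSpan.

Section TensorAlgebraLift.
Variables (K : comNzRingType) (V W : lmodType K) (F : seq V -> W).
Hypothesis lF : wlin *:%R F.

Lemma word_respects0 : respects (@word_rel K V) F.
Proof.
move=> _ [u v a x y]; rewrite !(linB (fglift_linear F)) (linZ (fglift_linear F)).
by rewrite !liftU !scale1r lF -addrA -opprD subrr.
Qed.

Lemma tlift0_linear : linear (lquot_lift F : tensorAlg V -> W).
Proof. exact: lquot_lift_linear word_respects0. Qed.

Lemma tlift0E w : lquot_lift F (tword w : tensorAlg V) = F w.
Proof. exact: lquot_lift_gen word_respects0. Qed.

End TensorAlgebraLift.

Section SymmetricTensors.
Variables (K : comNzRingType) (V : lmodType K).
Implicit Types (w : seq V) (t : tensorAlg V).

Lemma perm_word_wlin n (s : 'S_n) : wlin *:%R (fun w => tword (perm_word s w)).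
Proof.
move=> u v a x y; rewrite /perm_word !size_cat /=; case: eqP => [Es|_]; last first.
  exact: tword_wlin.
have ltun : (size u < n)%N by rewrite -Es -[X in (X < _)%N]addn0 ltn_add2l.
(* The letter in position [k] is moved to position [j]; the other positions do not see it. *)
pose k := Ordinal ltun; pose j := (s^-1%g k).
have [p1 [p2 [Ep j1 j2]]] : exists p1 p2,
    [/\ enum 'I_n = p1 ++ j :: p2, j \notin p1 & j \notin p2].
  have ej : j \in enum 'I_n by rewrite mem_enum.
  move: ej (enum_uniq 'I_n); move: (enum 'I_n) => e; case/splitPr => p1 p2.
  rewrite cat_uniq /= negb_or => /and3P[_ /andP[j1 _] /andP[j2 _]].
  by exists p1, p2.
pose f i := nth 0 (u ++ 0 :: v) (s i : 'I_n).
have fE z : [seq nth 0 (u ++ z :: v) (s i) | i <- enum 'I_n] = map f p1 ++ z :: map f p2.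
  rewrite Ep map_cat /= {1}/j permKV /= nth_slotE; congr (_ ++ _ :: _).
    apply/eq_in_map => i ip; rewrite /f nth_slot //; apply: contraNneq j1 => Esi.
    by rewrite (_ : j = i) //; apply: (@perm_inj _ s); rewrite permKV; apply: val_inj.
  apply/eq_in_map => i ip; rewrite /f nth_slot //; apply: contraNneq j2 => Esi.
  by rewrite (_ : j = i) //; apply: (@perm_inj _ s); rewrite permKV; apply: val_inj.
by rewrite !fE tword_wlin.
Qed.

Lemma perm_word_nseq n (s : 'S_n) m x : perm_word s (nseq m x) = nseq m x :> seq V.
Proof.
rewrite /perm_word size_nseq; case: eqP => // mn; subst m.
have -> : [seq nth 0 (nseq n x) (s i) | i <- enum 'I_n] = [seq x | _ <- enum 'I_n].
  by apply: eq_map => i; rewrite nth_nseq ltn_ord.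
by rewrite -[in RHS](size_enum_ord n); elim: (enum 'I_n) => //= _ e ->.
Qed.

Definition permT n (s : 'S_n) : tensorAlg V -> tensorAlg V :=
  lquot_lift (fun w => tword (perm_word s w)).

Lemma permT_linear n (s : 'S_n) : linear (permT s).
Proof. exact: tlift0_linear (perm_word_wlin s). Qed.

Lemma permT_word n (s : 'S_n) w : permT s (tword w) = tword (perm_word s w).
Proof. exact: tlift0E (perm_word_wlin s) _. Qed.

Lemma symmetric_tensor0 : symmetric_tensor (0 : tensorAlg V).
Proof. by move=> n s; apply: lin0 (permT_linear s). Qed.

Lemma symmetric_tensorP a t u : symmetric_tensor t -> symmetric_tensor u ->
  symmetric_tensor (a *: t + u).
Proof.
move=> st su n s; have Et : permT s t = t := st n s.
by have Eu : permT s u = u := su n s; rewrite -[LHS]/(permT s _) permT_linear Et Eu.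
Qed.

Lemma symmetric_power m x : symmetric_tensor (tword (nseq m x) : tensorAlg V).
Proof. by move=> n s; rewrite [LHS]permT_word perm_word_nseq. Qed.

End SymmetricTensors.

Section SymmetricSpan.
Variables (K : fieldType) (charK : [pchar K] =i pred0) (V : lmodType K).
Variable Q : tensorAlg V -> Prop.
Hypotheses (Q0 : Q 0) (Qlin : forall a x y, Q x -> Q y -> Q (a *: x + y)).
Hypothesis Qpow : forall n x, Q (tword (nseq n x)).
Implicit Types (w : seq V) (t : tensorAlg V).

Lemma natr_fact_neq0 n : n`!%:R != 0 :> K.
Proof. by rewrite (pcharf0P K).1 // -lt0n fact_gt0. Qed.

(** The symmetrizer in degree [n]; it is the identity in the other degrees because [perm_word] fixes
    words of other lengths. *)
Let symz n t := (n`!%:R)^-1 *: \sum_(s : 'S_n) permT s t.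

Let symz_linear n : linear (symz n).
Proof. by apply: lin_scaler; apply: lin_bigsum => s; apply: permT_linear. Qed.

Let symz_id n t : (forall s : 'S_n, permT s t = t) -> symz n t = t.
Proof.
move=> ts; rewrite /symz (eq_bigr (fun=> t)) // sumr_const card_Sn.
by rewrite -scaler_nat scalerA mulVf ?scale1r ?natr_fact_neq0.
Qed.

(** Elements of the quotient carry no bound on their degree, so degrees are symmetrized one after
    the other, up to a bound chosen later. *)
Fixpoint symz_upto n t := if n is n'.+1 then symz_upto n' (symz n' t) else t.

Let symz_upto_linear n : linear (symz_upto n).
Proof.
elim: n => [|n IHn]; first exact: lin_id.
exact: (lin_comp (@symz_linear n) IHn).
Qed.

Let symz_word n w : size w != n -> symz n (tword w) = tword w.
Proof.
by move=> sw; apply: symz_id => s; rewrite permT_word /perm_word (negPf sw).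
Qed.

Let symz_upto_word n w : (n <= size w)%N -> symz_upto n (tword w) = tword w.
Proof.
elim: n => //= n IHn ltn; rewrite symz_word ?IHn ?(ltnW ltn) //.
by rewrite neq_ltn ltn orbT.
Qed.

Let symz_upto_span n w : (size w < n)%N -> Q (symz_upto n (tword w)).
Proof.
elim: n => // n IHn; rewrite ltnS leq_eqVlt => /orP[/eqP sw|ltwn] /=; last first.
  by rewrite symz_word ?neq_ltn ?ltwn //; apply: IHn.
have symE : symz n (tword w) =
    (n`!%:R)^-1 *: \sum_(s : 'S_n) tword [seq nth 0 w (s i) | i <- enum 'I_n].
  congr (_ *: _); apply: eq_bigr => s _.
  by rewrite permT_word /perm_word sw eqxx.
have -> : symz_upto n (symz n (tword w)) = symz n (tword w).
  rewrite symE (linZ (@symz_upto_linear n)) (lin_sum _ _ _ (@symz_upto_linear n)).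
  congr (_ *: _); apply: eq_bigr => s _.
  by rewrite symz_upto_word // size_map size_enum_ord.
rewrite symE; apply: span_scale => //; rewrite -sw.
by apply: polarization => //; apply: tword_wlin.
Qed.

(* Symmetrizing in all degrees at once is the identity on symmetric tensors and
   sends every word to a combination of powers. *)
Lemma symmetric_span t : symmetric_tensor t -> Q t.
Proof.
move=> st; have symt n : symz_upto n t = t.
  by elim: n => //= n IHn; rewrite symz_id // => s; apply: st.
suff [N QN] : exists N, Q (symz_upto N t) by rewrite -(symt N).
(* Asking for all large [n] makes the property stable under linear combinations: the maximum of two
   bounds works. *)
suff [N QN] : exists N, forall n, (N <= n)%N -> Q (symz_upto n t).
  by exists N; apply: QN.
elim/lquot_ind: t {st symt} => [|a x y [Nx Qx] [Ny Qy]|w].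
- by exists 0%N => n _; rewrite (lin0 (@symz_upto_linear n)).
- exists (maxn Nx Ny) => n; rewrite geq_max => /andP[lex ley].
  by rewrite symz_upto_linear; apply: Qlin; [apply: Qx|apply: Qy].
by exists (size w).+1 => n; apply: symz_upto_span.
Qed.

End SymmetricSpan.

(** * The enveloping algebra *)

Section EnvelopingLift.
Variables (K : comNzRingType) (g : lieAlgType K).

Definition wbr (W : zmodType) (F : seq g -> W) := forall u v x y,
  F (u ++ x :: y :: v) - F (u ++ y :: x :: v) = F (u ++ lbr x y :: v).

Lemma eword_wlin : wlin *:%R (@eword K g).
Proof.
move=> u v a x y; apply/eqP; rewrite -subr_eq0 opprD addrA.
rewrite -(linZ (@lcls_is_linear _ _ _)) -!(linB (@lcls_is_linear _ _ _)).
rewrite -(lin0 (@lcls_is_linear _ _ _)).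
by apply/eqP/lclsP; rewrite subr0 mem_relspan //; apply: EnvWord; apply: WordLin.
Qed.

Lemma eword_wbr : wbr (@eword K g).
Proof.
move=> u v x y; apply/eqP; rewrite -subr_eq0.
rewrite -!(linB (@lcls_is_linear _ _ _)) -(lin0 (@lcls_is_linear _ _ _)).
by apply/eqP/lclsP; rewrite subr0 mem_relspan //; apply: EnvBr.
Qed.

Section Lift0.
Variables (W : lmodType K) (F : seq g -> W).
Hypotheses (lF : wlin *:%R F) (bF : wbr F).

Lemma env_respects0 : respects (@env_rel K g) F.
Proof.
move=> _ [r wr|u v x y]; first exact: word_respects0.
by rewrite !(linB (fglift_linear F)) !liftU !scale1r bF subrr.
Qed.

Lemma elift0_linear : linear (lquot_lift F : env g -> W).
Proof. exact: lquot_lift_linear env_respects0. Qed.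

Lemma elift0E w : lquot_lift F (eword w : env g) = F w.
Proof. exact: lquot_lift_gen env_respects0. Qed.

End Lift0.

Section Lift.
Variables (W : lmodType K) (F : seq g -> fps W).
Hypotheses (lF : wlin fscale F) (bF : wbr F).

Lemma env_respects n : respects (@env_rel K g) (fun w => F w n).
Proof.
move=> _ [r wr|u v x y]; first exact: word_respects.
rewrite !(linB (fglift_linear _)) !liftU !scale1r.
by have /(congr1 (fun t : fps W => t n)) := bF u v x y => <-; rewrite subrr.
Qed.

Lemma elift_linear : linear (linext F : fps (env g) -> fps W).
Proof. exact: linext_linear env_respects. Qed.

Lemma eliftE w : linext F (fconst (eword w : env g)) = F w.
Proof. exact: linext_gen env_respects. Qed.

End Lift.

Lemma env_lin_ext0 (W : lmodType K) (f f' : env g -> W) : linear f -> linear f' ->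
  (forall w, f (eword w) = f' (eword w)) -> f =1 f'.
Proof. exact: lquot_lin_ext. Qed.

Lemma env_lin_ext (W : lmodType K) (f f' : fps (env g) -> fps W) :
  linear f -> linear f' ->
  (forall w, f (fconst (eword w)) = f' (fconst (eword w))) -> f =1 f'.
Proof. exact: fps_lquot_lin_ext. Qed.

Lemma fconst_wlin (W : lmodType K) (F : seq g -> W) :
  wlin *:%R F -> wlin fscale (fun w => fconst (F w)).
Proof. by move=> lF u v a x y; rewrite lF fconst_linear. Qed.

Lemma fconst_wbr (W : lmodType K) (F : seq g -> W) :
  wbr F -> wbr (fun w => fconst (F w)).
Proof. by move=> bF u v x y; rewrite -(@fconstN K W) -(@fconstD K W) bF. Qed.

Lemma econs_wlin (x : g) : wlin *:%R (fun w : seq g => eword (x :: w)).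
Proof. by move=> u; apply: (eword_wlin (x :: u)). Qed.

Lemma econs_wbr (x : g) : wbr (fun w : seq g => eword (x :: w) : env g).
Proof. by move=> u; apply: (eword_wbr (x :: u)). Qed.

Lemma econsE (x : g) w : econs x (eword w) = eword (x :: w).
Proof. exact: elift0E (econs_wlin x) (econs_wbr x) w. Qed.

Lemma econs_bilin : bilin (@econs K g).
Proof.
have lr (x : g) : linear (econs x) := elift0_linear (econs_wlin x) (@econs_wbr x).
split=> // e a x y.
apply: (env_lin_ext0 (f := econs (a *: x + y))
  (f' := fun e => a *: econs x e + econs y e)) => // [|w].
  exact: lin_add (lin_scaler _ (lr x)) (lr y).
by rewrite !econsE; apply: (eword_wlin [::]).
Qed.

Lemma econs_br (x y : g) e : econs x (econs y e) - econs y (econs x e) = econs (lbr x y) e.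
Proof.
have lr (z : g) : linear (econs z) := econs_bilin.2 z.
apply: (env_lin_ext0 (f := fun e => econs x (econs y e) - econs y (econs x e))) => //.
  apply: lin_add; first exact: (lin_comp (lr y) (lr x)).
  exact: lin_opp (lin_comp (lr x) (lr y)).
by move=> w; rewrite !econsE; apply: (eword_wbr [::]).
Qed.

Lemma tens_lin_ext0 (V V' W : lmodType K) (f f' : tens V V' -> W) :
  linear f -> linear f' -> (forall p q, f (tpure p q) = f' (tpure p q)) -> f =1 f'.
Proof. by move=> lf lf' ff'; apply: lquot_lin_ext => // -[p q]; apply: ff'. Qed.

Lemma tens_respects0 (V V' W : lmodType K) (b : V -> V' -> W) : bilin b ->
  respects (@tens_rel K V V') (fun p => b p.1 p.2).
Proof.
move=> lb _ [a x x' y|a x y y'];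
  rewrite !(linB (fglift_linear _)) (linZ (fglift_linear _)) !liftU !scale1r /=.
  by rewrite (lb.1 _) -addrA -opprD subrr.
by rewrite (lb.2 _) -addrA -opprD subrr.
Qed.

Lemma eprim_respects (x : g) :
  bilin (fun p q : env g => tpure (econs x p) q + tpure p (econs x q)).
Proof.
have bt := @tpure_bilin K (env g) (env g); have le := econs_bilin.2 x.
split=> u; apply: lin_add.
- exact: (lin_comp le (bt.1 u)).
- exact: bt.1.
- exact: bt.2.
- exact: (lin_comp le (bt.2 u)).
Qed.

Lemma eprimE (x : g) p q : eprim x (tpure p q) = tpure (econs x p) q + tpure p (econs x q).
Proof. exact: (lquot_lift_gen (p, q) (tens_respects0 (eprim_respects x))). Qed.

Lemma eprim_bilin : bilin (@eprim K g).
Proof.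
have lr (x : g) : linear (eprim x) := lquot_lift_linear (tens_respects0 (eprim_respects x)).
have bt := @tpure_bilin K (env g) (env g).
split=> // t a x y.
apply: (tens_lin_ext0 (f := eprim (a *: x + y))
  (f' := fun t => a *: eprim x t + eprim y t)) => // [|p q].
  exact: lin_add (lin_scaler _ (lr x)) (lr y).
by rewrite !eprimE !(econs_bilin.1 _) (bt.1 _) (bt.2 _) scalerDr addrACA.
Qed.

(** The mixed terms, with [x] acting on one factor and [y] on the other, occur in both compositions
    and cancel; [econs_br] treats the others. *)
Lemma eprim_br (x y : g) t : eprim x (eprim y t) - eprim y (eprim x t) = eprim (lbr x y) t.
Proof.
have lr (z : g) : linear (eprim z) := eprim_bilin.2 z.
have bt := @tpure_bilin K (env g) (env g).
apply: (tens_lin_ext0 (f := fun t => eprim x (eprim y t) - eprim y (eprim x t))) => //.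
  apply: lin_add; first exact: (lin_comp (lr y) (lr x)).
  exact: lin_opp (lin_comp (lr x) (lr y)).
move=> p q; rewrite !eprimE !(linD (lr _)) !eprimE -!econs_br.
rewrite (linB (bt.1 q)) (linB (bt.2 p)).
rewrite [X in X - _]addrACA opprD [LHS]addrACA; congr (_ + _).
  by rewrite opprD addrACA subrr addr0.
by rewrite opprD addrACA subrr add0r.
Qed.

Definition ecomul_word (w : seq g) : tens (env g) (env g) :=
  foldr (@eprim K g) (tpure (eword [::]) (eword [::])) w.

Lemma foldr_wlin (W : lmodType K) (f : g -> W -> W) (t0 : W) : bilin f ->
  wlin *:%R (foldr f t0).
Proof.
move=> bf; elim=> [|z u IHu] v a x y /=; first exact: bf.1.
by rewrite IHu (bf.2 _).
Qed.

Lemma foldr_wbr (W : lmodType K) (f : g -> W -> W) (t0 : W) : bilin f ->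
  (forall x y t, f x (f y t) - f y (f x t) = f (lbr x y) t) -> wbr (foldr f t0).
Proof.
move=> bf fbr; elim=> [|z u IHu] v x y /=; first exact: fbr.
by rewrite -IHu (linB (bf.2 _)).
Qed.

Definition ecomul : fps (env g) -> fps (tens (env g) (env g)) :=
  linext (fun w : seq g => fconst (ecomul_word w)).

Lemma ecomul_linear : linear ecomul.
Proof.
apply: elift_linear; first exact/fconst_wlin/foldr_wlin/eprim_bilin.
exact/fconst_wbr/foldr_wbr/eprim_br/eprim_bilin.
Qed.

Lemma ecomulE (w : seq g) : ecomul (fconst (eword w)) = fconst (ecomul_word w).
Proof.
apply: eliftE; first exact/fconst_wlin/foldr_wlin/eprim_bilin.
exact/fconst_wbr/foldr_wbr/eprim_br/eprim_bilin.
Qed.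

Definition ecounit : fps (env g) -> fps K^o := linext (fun w : seq g => fconst (nilp w)%:R).

Lemma nilp_wlin : wlin *:%R (fun w : seq g => (nilp w)%:R : K^o).
Proof. by move=> [|? ?] v a x y /=; rewrite scaler0 addr0. Qed.

Lemma nilp_wbr : wbr (fun w : seq g => (nilp w)%:R : K^o).
Proof. by move=> [|? ?] v x y /=; rewrite subrr. Qed.

Lemma ecounit_linear : linear ecounit.
Proof. exact: elift_linear (fconst_wlin nilp_wlin) (fconst_wbr nilp_wbr). Qed.

Lemma ecounitE (w : seq g) : ecounit (fconst (eword w)) = fconst ((nilp w)%:R : K^o).
Proof. exact: eliftE (fconst_wlin nilp_wlin) (fconst_wbr nilp_wbr) w. Qed.

Definition eanti_word (w : seq g) : env g := (-1) ^+ size w *: eword (rev w).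

Lemma eanti_wlin : wlin *:%R eanti_word.
Proof.
move=> u v a x y; rewrite /eanti_word !rev_cat !rev_cons -!cats1 -!catA /= !size_cat /=.
by rewrite eword_wlin scalerDr !scalerA mulrC.
Qed.

(** Reversal negates the commutator, and the bracket makes the word one letter shorter, so the two
    signs compensate. *)
Lemma eanti_wbr : wbr eanti_word.
Proof.
move=> u v x y; rewrite /eanti_word !rev_cat !rev_cons -!cats1 -!catA /= !size_cat /=.
rewrite -scalerBr !addnS exprS mulN1r scaleNr -scalerN opprB.
by rewrite (eword_wbr (rev v) (rev u)).
Qed.

Definition eanti : fps (env g) -> fps (env g) := linext (fun w : seq g => fconst (eanti_word w)).

Lemma eanti_linear : linear eanti.
Proof. exact: elift_linear (fconst_wlin eanti_wlin) (fconst_wbr eanti_wbr). Qed.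

Lemma eantiE (w : seq g) : eanti (fconst (eword w)) = fconst (eanti_word w).
Proof. exact: eliftE (fconst_wlin eanti_wlin) (fconst_wbr eanti_wbr) w. Qed.

Definition emul (a b : fps (env g)) : fps (env g) :=
  linext (fun v : seq g => linext (fun w : seq g => fconst (eword (v ++ w))) b) a.

Lemma emul_wlinr (v : seq g) : wlin fscale (fun w : seq g => fconst (eword (v ++ w))).
Proof. by move=> u v' a x y; rewrite !catA eword_wlin fconst_linear. Qed.

Lemma emul_wbrr (v : seq g) : wbr (fun w : seq g => fconst (eword (v ++ w))).
Proof. by move=> u v' x y; rewrite !catA -eword_wbr (@fconstD K) (@fconstN K). Qed.

Let emulr (v : seq g) (b : fps (env g)) := linext (fun w : seq g => fconst (eword (v ++ w))) b : fps (env g).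

Let emulr_linear v : linear (emulr v).
Proof. exact: elift_linear (emul_wlinr v) (emul_wbrr v). Qed.

Let emulrE v w : emulr v (fconst (eword w)) = fconst (eword (v ++ w)).
Proof. exact: eliftE (emul_wlinr v) (emul_wbrr v) w. Qed.

Let emul_wlinl b : wlin fscale (fun v => emulr v b).
Proof.
move=> u v a x y; apply: (env_lin_ext (f := emulr (u ++ (a *: x + y) :: v))
  (f' := fun b => fconst a *: emulr (u ++ x :: v) b + emulr (u ++ y :: v) b)) => //.
  exact: lin_add (lin_scaler _ (emulr_linear _)) (emulr_linear _).
by move=> w; rewrite !emulrE -!catA /= eword_wlin fconst_linear.
Qed.

Let emul_wbrl b : wbr (fun v => emulr v b).
Proof.
move=> u v x y; apply: (env_lin_ext
  (f := fun b => emulr (u ++ x :: y :: v) b - emulr (u ++ y :: x :: v) b)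
  (f' := emulr (u ++ lbr x y :: v))) => //.
  exact: lin_add (emulr_linear _) (lin_opp (emulr_linear _)).
by move=> w; rewrite !emulrE -!catA /= -eword_wbr (@fconstD K) (@fconstN K).
Qed.

Lemma emul_bilin : bilin emul.
Proof.
have ll b : linear (emul^~ b) by exact: elift_linear (emul_wlinl b) (emul_wbrl b).
have E v b : emul (fconst (eword v)) b = emulr v b.
  exact: eliftE (emul_wlinl b) (emul_wbrl b) v.
split=> // a c x y; apply: (env_lin_ext (f := emul^~ (c *: x + y))
  (f' := fun a => c *: emul a x + emul a y)) => //.
  exact: lin_add (lin_scaler _ (ll x)) (ll y).
by move=> v; rewrite !E; apply: emulr_linear.
Qed.

Lemma emulE (v w : seq g) : emul (fconst (eword v)) (fconst (eword w)) = fconst (eword (v ++ w)).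
Proof.
rewrite -emulrE; exact: eliftE (emul_wlinl _) (emul_wbrl _) v.
Qed.

End EnvelopingLift.

(** * Powers span the enveloping algebra *)

Section EnvelopingSpan.
Variables (K : fieldType) (charK : [pchar K] =i pred0) (g : lieAlgType K).
Variable Q : env g -> Prop.
Hypotheses (Q0 : Q 0) (Qlin : forall a x y, Q x -> Q y -> Q (a *: x + y)).
Hypothesis Qpow : forall n x, Q (eword (nseq n x)).

Let Qadd := span_add Qlin.

Section Degree.
Variable n : nat.
Hypothesis Qn : forall w : seq g, (size w < n)%N -> Q (eword w).

Let eqQ (w w' : seq g) := Q (eword w - eword w').

Let eqQ_trans w1 w2 w3 : eqQ w1 w2 -> eqQ w2 w3 -> eqQ w1 w3.
Proof. by move=> /Qadd Q12 /Q12; rewrite /eqQ addrA subrK. Qed.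

Let eqQ_move p x v z : size (p ++ x :: v ++ z) = n -> eqQ (p ++ x :: v ++ z) (p ++ v ++ x :: z).
Proof.
elim: v p => [|y v IHv] p sn; first by rewrite /eqQ subrr.
apply: (@eqQ_trans _ (p ++ y :: x :: v ++ z)).
  rewrite /eqQ eword_wbr; apply: Qn.
  by rewrite -sn !size_cat /= !addnS.
rewrite -!cat_rcons /=; have := IHv (rcons p y); rewrite -!cat_rcons !cat_rcons /=.
apply; rewrite -sn !size_cat /= !addnS //.
Qed.

(** Exchanging two neighbouring letters changes a word by a shorter one, in which they are replaced
    by their bracket; moving letters into place one by one gives every permutation. *)
Lemma perm_eq_eword_span p s t : size (p ++ s) = n -> perm_eq s t ->
  Q (eword (p ++ s) - eword (p ++ t)).
Proof.
elim: s p t => [|x s IHs] p t sn st.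
  by move: st; rewrite perm_sym => /perm_nilP->; rewrite subrr.
have xt : x \in t by rewrite -(perm_mem st) inE eqxx.
case/splitPr: xt st => u v st.
have suv : perm_eq s (u ++ v) by rewrite -(perm_cons x) (perm_trans st) // perm_catC /= perm_cons perm_catC.
apply: (@eqQ_trans _ (p ++ x :: u ++ v)).
  by rewrite /eqQ -!(cat_rcons x p); apply: IHs; rewrite ?cat_rcons.
apply: eqQ_move; rewrite -sn !size_cat /=; congr (_ + _.+1)%N.
by rewrite (perm_size suv) size_cat.
Qed.

(** By polarization the sum of all permutations of [w] lies in [Q]. Modulo shorter words it is n!
    times [w], and n! is invertible. *)
Lemma eword_span_degree (w : seq g) : size w = n -> Q (eword w).
Proof.
move=> sw; have wE : map (fun i : 'I_(size w) => nth 0 w i) (enum 'I_(size w)) = w.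
  by rewrite -[RHS](mkseq_nth 0) /mkseq -val_enum_ord -map_comp.
have Qs (s : 'S_(size w)) : Q (eword [seq nth 0 w (s i) | i <- enum 'I_(size w)] - eword w).
  apply: (@perm_eq_eword_span [::]); first by rewrite size_map size_enum_ord.
  have -> : [seq nth 0 w (s i) | i <- enum 'I_(size w)] =
      map (fun i : 'I_(size w) => nth 0 w i) (map s (enum 'I_(size w))).
    by rewrite -[RHS]map_comp.
  rewrite -[X in perm_eq _ X]wE; apply: perm_map; apply: uniq_perm.
  - by rewrite (map_inj_uniq (@perm_inj _ s)) enum_uniq.
  - exact: enum_uniq.
  move=> i; rewrite mem_enum inE; apply/mapP; exists (s^-1%g i); rewrite ?mem_enum //.
  by rewrite permKV.
have := polarization Q0 Qlin (@eword_wlin K g) (Qpow (size w)).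
have Qd : Q (\sum_(s : 'S_(size w))
    (eword [seq nth 0 w (s i) | i <- enum 'I_(size w)] - eword w)).
  by apply: span_sum.
move/Qadd => Qsum; have := Qsum _ (span_opp Q0 Qlin Qd).
rewrite -sumrB (eq_bigr (fun=> eword w)) => [|s _]; last by rewrite opprB addrC subrK.
rewrite sumr_const card_Sn -scaler_nat => /(span_scale Q0 Qlin (size w)`!%:R^-1).
by rewrite scalerA mulVf ?scale1r //; apply: (natr_fact_neq0 charK).
Qed.

End Degree.

Lemma env_span e : Q e.
Proof.
apply: lquot_ind e => // w.
have [n] := ubnP (size w); elim: n w => // n IHn w; rewrite ltnS => lew.
apply: (@eword_span_degree (size w)) => // w' ltw'; apply: IHn.
exact: leq_trans ltw' lew.
Qed.

End EnvelopingSpan.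

Lemma natr_fconst (K : comNzRingType) n : (n%:R : fps K) = fconst n%:R.
Proof.
elim: n => [|n IHn]; first by rewrite (@fconst0 K K^o).
by rewrite -addn1 !natrD IHn (@fconstD K K^o).
Qed.

Lemma fconstZ (K : comNzRingType) (V : lmodType K) (a : K) (x : V) :
  fconst (a *: x) = fconst a *: fconst x.
Proof. by rewrite -[a *: x]addr0 fconst_linear (@fconst0 K V) addr0. Qed.

Lemma nseq_cat T n (x : T) u v : nseq n x = u ++ v ->
  u = nseq (size u) x /\ v = nseq (size v) x.
Proof.
elim: n u => [|n IHn] [|y u] //=; first by case: v.
  by move=> <-; rewrite /= size_nseq.
by case=> <- /IHn[-> ->]; rewrite !size_nseq.
Qed.

(** Reduces questions about [ephi] and the coproduct on series to the K-linear maps that they induce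
    on coefficients. *)
Lemma fps_lin_coef (K : comNzRingType) (V W : lmodType K) (f : fps V -> fps W)
    (f0 : V -> W) : linear f -> (forall v, f (fconst v) = fconst (f0 v)) ->
  forall u n, f u n = f0 (u n).
Proof.
move=> lf ff0; have lf0 : linear f0.
  move=> a x y; have /(congr1 (fun t : fps W => t 0%N)) := ff0 (a *: x + y).
  rewrite fconst_linear lf !ff0 fps_addE fps_scale_constE /= => <- //.
have lF : linear (fun u : fps V => Fps (fun n => f0 (u n))).
  move=> a u v; apply: fpsP => n; rewrite !fps_addE !fps_scaleE /= (linD lf0).
  rewrite (lin_sum _ _ _ lf0); congr (_ + _).
  by apply: eq_bigr => i _; rewrite (linZ lf0).
move=> u n; rewrite (fps_lin_ext lf lF) // => v; rewrite ff0; apply: fpsP => -[|m] //=.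
by rewrite (lin0 lf0).
Qed.

(** * Comparison with the enveloping algebra for lambda = 1/2 *)

Section HalfFamily.
Variables (K : fieldType) (charK : [pchar K] =i pred0) (B : Bfamily (fps K)).
Hypothesis hB : in_Blambda (fconst (2%:R^-1 : K)) B.
Variable g : lieAlgType K.
Local Notation L := (fps g).
Local Notation T := (fps (tensorAlg g)).
Local Notation one := (fword [::] : T).
Local Notation mul := (@sh_mul K B g).
Let bm := sh_mul_bilin g hB.

Lemma Bev_one_one (x y : L) : Bev B [:: x] [:: y] = fconst (2%:R^-1 : K) *: lbr x y.
Proof.
rewrite BevE /Bevn /= (B_11 hB) (linZ (leval_linear _)) leval_lbr.
by rewrite !leval_lgen.
Qed.

Lemma sh_mul_letters (x y : L) : mul (fword [:: x]) (fword [:: y]) =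
  fword [:: x; y] + fword [:: y; x] + fword [:: Bev B [:: x] [:: y]].
Proof.
rewrite (sh_mul_words hB) (mulw_rec hB) /= !addr0 !add0r.
rewrite (Bev_nil_nil _ hB) fcons0 add0r (Bev_one_nil _ (B_10 hB)) (Bev_nil_one _ (B_01 hB)).
rewrite -!(sh_mul_words hB) (sh_mul1w hB) (sh_mulw1 hB) (sh_mul_one_one _ hB).
by rewrite addrA [fword [:: x; y] + _]addrC.
Qed.

Lemma sh_mul_bracket (x y : g) (t : T) :
  mul (fword [:: fconst x]) (mul (fword [:: fconst y]) t) -
  mul (fword [:: fconst y]) (mul (fword [:: fconst x]) t) =
  mul (fword [:: fconst (lbr x y)]) t.
Proof.
rewrite !(sh_mulA hB) -(linB (bm.1 t)); congr (mul _ t).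
rewrite !sh_mul_letters [fword [:: fconst y; _] + _]addrC opprD addrACA subrr add0r.
rewrite !fword_cons -(linB ((fcons_bilin g).1 _)) !Bev_one_one; congr (fcons _ _).
rewrite [lbr (fconst y) _]lbrC scalerN opprK -scalerDl -(@fconstD K K^o).
have -> : (2%:R^-1 + 2%:R^-1 : K) = 1.
  by rewrite -mulr2n -[_ *+ 2]mulr_natl mulfV // (pcharf0P K).1.
rewrite scale1r; exact: fbil_const (lbr_bilin g) _ _.
Qed.

(** By [Bev_const] only blocks consisting of a single letter survive. [H1] collects the terms whose
    first letter comes from the power, counted by induction, and [H2] the one term in which the left
    factor comes first. *)
Lemma sh_mul_letter_power (x : L) m : mul (fword [:: x]) (fword (nseq m x)) =
  m.+1%:R *: fword (nseq m.+1 x).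
Proof.
have Bpow i j : (i + j != 1)%N -> Bev B (nseq i x) (nseq j x) = 0.
  exact: Bev_const (B_multilinear hB).
elim: m => [|m IHm]; first by rewrite (sh_mulw1 hB) scale1r.
have H1 : cut2 (fun u v => fcons (Bev B [::] u) (mulw B [:: x] v)) (nseq m.+1 x) =
    m.+1%:R *: fword (nseq m.+2 x).
  rewrite cut2_cons (Bev_nil_nil _ hB) fcons0 add0r.
  rewrite (@eq_cut2 _ _ _ (fun u v => if nilp u then fcons x (mulw B [:: x] v) else 0)).
    rewrite cut2_counitl -(sh_mul_words hB) IHm (linZ ((fcons_bilin g).2 x)).
    exact: erefl.
  move=> u v Es; have [Eu _] := @nseq_cat _ _ _ _ _ Es.
  case: ifPn => [/nilP->|nu].
    by rewrite (Bev_nil_one _ (B_01 hB)).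
  by rewrite Eu [Bev _ _ _](Bpow 0%N (size u).+1 nu) fcons0.
have H2 : cut2 (fun u v => fcons (Bev B [:: x] u) (mulw B [::] v)) (nseq m.+1 x) =
    fword (nseq m.+2 x).
  rewrite (@eq_cut2 _ _ _ (fun u v => if nilp u then fcons x (mulw B [::] v) else 0)).
    by rewrite cut2_counitl -(sh_mul_words hB) (sh_mul1w hB).
  move=> u v Es; have [Eu _] := @nseq_cat _ _ _ _ _ Es.
  case: ifPn => [/nilP->|nu].
    by rewrite (Bev_one_nil _ (B_10 hB)).
  by rewrite Eu [Bev _ _ _](Bpow 1%N (size u) nu) fcons0.
rewrite (sh_mul_words hB) (mulw_rec hB) add0r cut2_cons cut2_nil H1 H2.
by rewrite -[X in _ + X]scale1r -scalerDl natr1.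
Qed.

Definition ephi_word (w : seq g) : T :=
  foldr (fun x t => mul (fword [:: fconst x]) t) one w.

Lemma ephi_wlin : wlin fscale ephi_word.
Proof.
have lx (t : T) a (x y : g) : mul (fword [:: fconst (a *: x + y)]) t =
    fscale a (mul (fword [:: fconst x]) t) + mul (fword [:: fconst y]) t.
  by rewrite fconst_linear !fword_cons ((fcons_bilin g).1 _) (bm.1 t).
elim=> [|z u IHu] v a x y /=; first exact: lx.
by rewrite IHu (bm.2 _).
Qed.

Lemma ephi_wbr : wbr ephi_word.
Proof.
elim=> [|z u IHu] v x y /=; first exact: sh_mul_bracket.
by rewrite -IHu (linB (bm.2 _)).
Qed.

Definition ephi : fps (env g) -> T := linext ephi_word.

Lemma ephi_linear : linear ephi.
Proof. exact: elift_linear ephi_wlin ephi_wbr. Qed.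

Lemma ephiE w : ephi (fconst (eword w)) = ephi_word w.
Proof. exact: eliftE ephi_wlin ephi_wbr w. Qed.

Lemma ephi_cat v w : ephi_word (v ++ w) = mul (ephi_word v) (ephi_word w).
Proof.
elim: v => [|x v IHv] /=; first by rewrite (sh_mul1r hB).
by rewrite IHv (sh_mulA hB).
Qed.

Lemma ephi_letter x : ephi (fconst (eword [:: x])) = fconst (tword [:: x]).
Proof. by rewrite ephiE /= (sh_mulr1 hB) (fword_const [:: x]). Qed.

Lemma ephi_mul a b : ephi (emul a b) = mul (ephi a) (ephi b).
Proof.
have be := emul_bilin g.
apply: (env_lin_ext (f := fun a => ephi (emul a b)) (f' := fun a => mul (ephi a) (ephi b))) a.
- exact: (lin_comp (be.1 b) ephi_linear).
- exact: (lin_comp ephi_linear (bm.1 _)).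
move=> v; apply: (env_lin_ext (f := fun b => ephi (emul (fconst (eword v)) b))
  (f' := fun b => mul (ephi (fconst (eword v))) (ephi b))) b.
- exact: (lin_comp (be.2 _) ephi_linear).
- exact: (lin_comp ephi_linear (bm.2 _)).
by move=> w; rewrite emulE !ephiE ephi_cat.
Qed.

Lemma ephi_econs (x : g) (e : env g) :
  ephi (fconst (econs x e)) = mul (fword [:: fconst x]) (ephi (fconst e)).
Proof.
have lx := (econs_bilin g).2 x.
apply: (lquot_ind (Q := fun e => ephi (fconst (econs x e)) =
   mul (fword [:: fconst x]) (ephi (fconst e)))) e => [|a e e' IHe IHe'|w].
- by rewrite (lin0 lx) (@fconst0 K) (lin0 ephi_linear) (lin0 (bm.2 _)).
- by rewrite lx !fconst_linear !ephi_linear (bm.2 _) IHe IHe'.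
by rewrite [econs x _]econsE !ephiE.
Qed.

Let bt := @ftens_bilin K (tensorAlg g) (tensorAlg g).

(** Letters are primitive. The map applied to the coproduct is the counterpart of [eprim], which
    defines the coproduct of U(g) letter by letter. *)
Lemma sh_comul_letter (x : L) t : sh_comul (mul (fword [:: x]) t) =
  tlift (fun a b => ftens (mul (fword [:: x]) a) b + ftens a (mul (fword [:: x]) b))
    (sh_comul t).
Proof.
have bx : bilin (fun a b => ftens (mul (fword [:: x]) a) b + ftens a (mul (fword [:: x]) b)).
  split=> u; apply: lin_add.
  - exact: (lin_comp (bm.2 _) (bt.1 u)).
  - exact: bt.1.
  - exact: bt.2.
  - exact: (lin_comp (bm.2 _) (bt.2 u)).
rewrite (tlift_sh_comul _ bx) sh_comulE (sweedler_sh_mul hB _ _ bt).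
rewrite sweedler_word; last exact: (sweedler_mul_bilin hB _ bt).
have b1 u v : bilin (fun b1 b2 => ftens (mul u b1) (mul v b2)).
  exact: (bilin_comp bt (bm.2 u) (bm.2 v)).
rewrite cut2_cons cut2_nil [LHS]addrC.
apply: (T_word_ext (f := fun t => sweedler _ t + sweedler _ t)) t => [||s].
- exact: (lin_add (sweedler_linear (b1 _ _)) (sweedler_linear (b1 _ _))).
- exact: sweedler_linear.
rewrite !sweedler_word // -cut2D; apply: eq_cut2 => u v _.
by rewrite !(sh_mul1r hB).
Qed.

Lemma ephi_comul a : sh_comul (ephi a) = tensF ephi ephi (ecomul a).
Proof.
have bpp : bilin (fun x y => ftens (ephi x) (ephi y)).
  exact: (bilin_comp bt ephi_linear ephi_linear).
have lt := tlift_linear bpp.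
rewrite -[tensF _ _]/(tlift (fun x y => ftens (ephi x) (ephi y))).
apply: (env_lin_ext (f := fun a => sh_comul (ephi a))
  (f' := fun a => tlift (fun x y => ftens (ephi x) (ephi y)) (ecomul a))) a => [||w].
- exact: (lin_comp ephi_linear (@sh_comul_linear _ _)).
- exact: (lin_comp (@ecomul_linear _ _) lt).
rewrite ephiE ecomulE; elim: w => [|x w IHw].
  rewrite /= -ftens_const [RHS](tliftE bpp) ephiE sh_comulE sweedler_one //; exact: bt.
rewrite /= sh_comul_letter IHw; move: (ecomul_word w).
set f := fun a b => _ + _.
have bf : bilin f.
  split=> u; apply: lin_add.
  - exact: (lin_comp (bm.2 _) (bt.1 u)).
  - exact: bt.1.
  - exact: bt.2.
  - exact: (lin_comp (bm.2 _) (bt.2 u)).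
have lx := (eprim_bilin g).2 x.
apply: lquot_ind => [|c t t' IHt IHt'|[p q]].
- by rewrite (lin0 lx) !(@fconst0 K) !(lin0 lt) (lin0 (tlift_linear bf)).
- by rewrite lx !fconst_linear !lt (tlift_linear bf) IHt IHt'.
rewrite -[gen _ _]/(tpure p q) eprimE fconstD (linD lt) -!ftens_const.
by rewrite !(tliftE bpp) (tliftE bf) /f !ephi_econs.
Qed.

Lemma ephi_counit a : teps (ephi a) = ecounit a.
Proof.
apply: (env_lin_ext (W := K^o) (f := fun a => teps (ephi a)) (f' := @ecounit K g)) a.
- by move=> c u v; rewrite ephi_linear teps_linear.
- exact: ecounit_linear.
move=> w; rewrite ephiE ecounitE; case: w => [|x w] /=; first by rewrite teps_word.
by rewrite (teps_sh_mul hB) teps_word mul0r (@fconst0 K K^o).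
Qed.

Lemma ephi_power n (x : g) : ephi (fconst (eword (nseq n x))) =
  n`!%:R *: fword (nseq n (fconst x)).
Proof.
rewrite ephiE; elim: n => [|n IHn]; first by rewrite scale1r.
rewrite /= IHn (linZ (bm.2 _)) sh_mul_letter_power scalerA -natrM.
by rewrite factS mulnC.
Qed.

Lemma scale_natr_inj n : n%:R != 0 :> K -> injective ( *:%R (n%:R : fps K) : T -> T).
Proof.
move=> n0 t u /(congr1 (fun v => fconst n%:R^-1 *: v)).
rewrite !scalerA natr_fconst; have -> : fconst (n%:R^-1 : K) * fconst n%:R = 1.
  by rewrite -[LHS](@fconstZ K K^o) /= [_ *: _]mulVf.
by rewrite !scale1r.
Qed.

(** The words x ... x are divided powers: after multiplication by i! j!, this is the image under
    [ephi] of the product of x^i and x^j in U(g). *)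
Lemma sh_mul_power i j (x : g) :
  mul (fword (nseq i (fconst x))) (fword (nseq j (fconst x))) =
  'C(i + j, i)%:R *: fword (nseq (i + j) (fconst x)).
Proof.
apply: (@scale_natr_inj (i`! * j`!)%N); first by rewrite natrM mulf_neq0 ?natr_fact_neq0.
rewrite [in RHS]scalerA -natrM [in RHS]mulnC.
have -> : ('C(i + j, i) * (i`! * j`!) = (i + j)`!)%N.
  by rewrite -[in RHS](@bin_fact (i + j) i) ?leq_addr // addKn.
rewrite -ephi_power nseqD -emulE ephi_mul !ephi_power.
by rewrite (linZ (bm.1 _)) (linZ (bm.2 _)) scalerA -natrM.
Qed.

Lemma sh_anti_power n (x : g) : sh_anti B (fword (nseq n (fconst x))) =
  (-1) ^+ n *: fword (nseq n (fconst x)).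
Proof.
have [m] := ubnP n; elim: m n => // m IHm n; rewrite ltnS => lenm.
case: n lenm => [|n] lenm; first by rewrite (sh_anti_one _ hB) scale1r.
have bS : bilin (fun a b => mul (sh_anti B a) b).
  exact: (bilin_comp bm (sh_anti_linear hB) (@lin_id _ _)).
have := sh_antil hB (fword (nseq n.+1 (fconst x))).
rewrite teps_word scale0r sweedler_word // cut2E size_nseq big_nat_recr //.
set X := fconst x; set N := n.+1.
rewrite (eq_big_nat _ _ (F2 := fun i => ((-1) ^+ i * 'C(N, i)%:R) *: fword (nseq N X))).
  rewrite -scaler_suml take_oversize ?drop_oversize ?size_nseq // (sh_mulr1 hB).
  (* The sum over proper prefixes is the binomial expansion of (1 - 1)^N without its last term. *)
  have -> : \sum_(0 <= i < N) (-1) ^+ i * 'C(N, i)%:R = - (-1) ^+ N :> fps K.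
    apply/eqP; rewrite -subr_eq0 opprK; apply/eqP.
    transitivity ((1 - 1) ^+ N : fps K); last by rewrite subrr expr0n.
    rewrite exprDn big_ord_recr /= binn subnn expr0 mul1r mulr1n big_mkord.
    by congr (_ + _); apply: eq_bigr => i _; rewrite expr1n mul1r mulr_natr.
  by rewrite scaleNr => /(canRL (addKr _)); rewrite opprK addr0.
move=> i /andP[_ ltiN]; have leiN := ltnW ltiN.
have -> : nseq N X = nseq i X ++ nseq (N - i) X by rewrite -nseqD subnKC.
rewrite take_size_cat ?drop_size_cat ?size_nseq // IHm; last first.
  by apply: leq_trans lenm.
rewrite (linZ (bm.1 _)) sh_mul_power scalerA -nseqD subnKC //.
Qed.

(** It suffices to compare on powers of elements of g, which span; there both antipodes multiply by
    the same sign. *)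
Lemma ephi_anti a : ephi (eanti a) = sh_anti B (ephi a).
Proof.
have l1 := lin_comp (@eanti_linear K g) ephi_linear.
have l2 := lin_comp ephi_linear (sh_anti_linear (g := g) hB).
apply: (fps_lin_ext l1 l2) => e; elim/(env_span charK): e => [|c x y IHx IHy|n x].
- by rewrite (@fconst0 K) (lin0 l1) (lin0 l2).
- by rewrite fconst_linear l1 l2 IHx IHy.
rewrite eantiE /eanti_word size_nseq rev_nseq fconstZ (linZ ephi_linear) ephi_power.
rewrite (linZ (sh_anti_linear hB)) sh_anti_power !scalerA mulrC; congr (_ * _ *: _).
elim: n => [|n IHn]; first by rewrite !expr0.
rewrite !exprS -IHn !mulN1r; exact: (@fconstN K K^o).
Qed.

Lemma ephi_hopf_morph : hopf_morph (env_hopf g) (sh_hopf B g) ephi.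
Proof.
split=> //=.
- exact: ephi_linear.
- exact: ephi_mul.
- by rewrite (ephiE [::]).
- exact: ephi_comul.
- exact: ephi_counit.
- exact: ephi_anti.
Qed.

Definition ephi0 (e : env g) : tensorAlg g := ephi (fconst e) 0%N.

(** The product involves hbar through B, but powers span U(g) and go to natural multiples of words x
    ... x, in which hbar does not occur. *)
Lemma ephi_const e : ephi (fconst e) = fconst (ephi0 e).
Proof.
rewrite /ephi0; elim/(env_span charK): e => [|c x y IHx IHy|n x].
- by rewrite (@fconst0 K) (lin0 ephi_linear) (@fconst0 K).
- rewrite fconst_linear ephi_linear IHx IHy -!fconstZ -!(@fconstD K).
  by apply: fpsP => -[|m].
rewrite ephi_power natr_fconst -map_nseq fword_const -fconstZ.
by apply: fpsP => -[|m].
Qed.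

Lemma ephi_coef a n : ephi a n = ephi0 (a n).
Proof. exact: fps_lin_coef ephi_linear ephi_const a n. Qed.

Lemma ephi0_linear : linear ephi0.
Proof.
move=> a x y; rewrite /ephi0 fconst_linear ephi_linear.
by rewrite fps_addE fps_scale_constE.
Qed.

Lemma ephi0_power n (x : g) : ephi0 (eword (nseq n x)) = n`!%:R *: tword (nseq n x).
Proof.
by rewrite /ephi0 ephi_power natr_fconst -map_nseq fword_const -fconstZ.
Qed.

Definition epsi_word (w : seq g) : env g := (size w)`!%:R^-1 *: eword w.

Lemma epsi_wlin : wlin *:%R epsi_word.
Proof.
move=> u v a x y; rewrite /epsi_word !size_cat /= eword_wlin scalerDr !scalerA.
by rewrite mulrC.
Qed.

Definition epsi : tensorAlg g -> env g := lquot_lift epsi_word.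

Lemma epsi_linear : linear epsi.
Proof. exact: tlift0_linear epsi_wlin. Qed.

Lemma epsi_power n (x : g) : epsi (tword (nseq n x)) = n`!%:R^-1 *: eword (nseq n x).
Proof. by rewrite [LHS](tlift0E epsi_wlin) /epsi_word size_nseq. Qed.

Lemma ephi0K : cancel ephi0 epsi.
Proof.
move=> e; elim/(env_span charK): e => [|c x y IHx IHy|n x].
- by rewrite (lin0 ephi0_linear) (lin0 epsi_linear).
- by rewrite ephi0_linear epsi_linear IHx IHy.
rewrite ephi0_power (linZ epsi_linear) epsi_power scalerA mulfV ?scale1r //.
exact: natr_fact_neq0.
Qed.

Lemma epsiK t : symmetric_tensor t -> ephi0 (epsi t) = t.
Proof.
move: t; apply: (symmetric_span charK) => [|c x y IHx IHy|n x].
- by rewrite (lin0 epsi_linear) (lin0 ephi0_linear).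
- by rewrite epsi_linear ephi0_linear IHx IHy.
rewrite epsi_power (linZ ephi0_linear) ephi0_power scalerA mulVf ?scale1r //.
exact: natr_fact_neq0.
Qed.

Lemma ephi0_symmetric e : symmetric_tensor (ephi0 e).
Proof.
elim/(env_span charK): e => [|c x y IHx IHy|n x].
- by rewrite (lin0 ephi0_linear); apply: symmetric_tensor0.
- by rewrite ephi0_linear; apply: symmetric_tensorP.
rewrite ephi0_power -[_ *: _]addr0; apply: symmetric_tensorP.
  exact: symmetric_power.
exact: symmetric_tensor0.
Qed.

Lemma ephi_inj : injective ephi.
Proof.
move=> a b Eab; apply: fpsP => n; apply: (can_inj ephi0K).
by rewrite -!ephi_coef Eab.
Qed.

Lemma ephi_image a : fps_in (@symmetric_tensor K g) a <-> exists u, ephi u = a.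
Proof.
split=> [sa|[u <-] n]; last by rewrite ephi_coef; apply: ephi0_symmetric.
exists (Fps (fun n => epsi (a n))); apply: fpsP => n.
by rewrite ephi_coef /= epsiK.
Qed.

Lemma tens_in_linear (W : tensorAlg g -> Prop) c t u :
  (forall a x y, W x -> W y -> W (a *: x + y)) -> W 0 ->
  tens_in W t -> tens_in W u -> tens_in W (c *: t + u).
Proof.
move=> Wlin W0 [s sW ->] [r rW ->].
exists ([seq (c *: p.1, p.2) | p <- s] ++ r).
  move=> p; rewrite mem_cat => /orP[/mapP[q /sW[q1 q2] ->]|/rW //]; split=> //=.
  by rewrite -[_ *: _]addr0; apply: Wlin.
rewrite big_cat big_map scaler_sumr; congr (_ + _); apply: eq_bigr => p _.
by rewrite (linZ ((@tpure_bilin K _ _).1 _)).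
Qed.

(** Deconcatenation acts coefficient by coefficient, symmetric tensors are spanned by words x ... x,
    and both pieces of a cut of such a word have the same form. *)
Lemma sh_comul_symmetric a : fps_in (@symmetric_tensor K g) a ->
  fps_in (tens_in (@symmetric_tensor K g)) (sh_comul a).
Proof.
have lD := @sh_comul_linear K g.
pose D0 (t : tensorAlg g) := sh_comul (fconst t) 0%N.
have DE t : sh_comul (fconst t) = fconst (D0 t).
  rewrite /D0; elim/lquot_ind: t => [|c x y IHx IHy|w].
  - by rewrite (@fconst0 K) (lin0 lD) (@fconst0 K).
  - rewrite fconst_linear lD IHx IHy -!fconstZ -!(@fconstD K).
    by apply: fpsP => -[|m].
  rewrite -[gen _ _]/(tword w) -fword_const sh_comulE sweedler_word; last exact: ftens_bilin.
  by rewrite -sh_comul_wordE; apply: fpsP => -[|m].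
move=> sa n; rewrite (fps_lin_coef lD DE).
move: (a n) (sa n); apply: (symmetric_span charK) => [|c x y IHx IHy|m x].
- by rewrite /D0 (@fconst0 K) (lin0 lD); exists [::]; rewrite ?big_nil.
- rewrite /D0 fconst_linear lD fps_addE fps_scale_constE; apply: tens_in_linear => //.
    by move=> *; apply: symmetric_tensorP.
  exact: symmetric_tensor0.
rewrite /D0 -fword_const sh_comulE sweedler_word; last exact: ftens_bilin.
rewrite -sh_comul_wordE /= /sh_comul_word.
exists [seq (tword (take i (nseq m x)), tword (drop i (nseq m x)))
       | i <- index_iota 0 (size (nseq m x)).+1]; last by rewrite big_map.
move=> _ /mapP[i _ ->] /=; rewrite drop_nseq; split; last exact: symmetric_power.
have [leim|ltmi] := leqP i m; first by rewrite take_nseq //; apply: symmetric_power.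
by rewrite take_oversize ?size_nseq ?(ltnW ltmi) //; apply: symmetric_power.
Qed.

(** Except for the coproduct, stability holds because the series of symmetric tensors are the image
    of [ephi], which respects unit, product and antipode. *)
Lemma symmetric_hopf_sub : hopf_sub (sh_hopf B g) (@symmetric_tensor K g).
Proof.
split=> /=.
- exact: symmetric_tensor0.
- exact: symmetric_tensorP.
- by apply/ephi_image; exists (fconst (eword [::])); rewrite (ephiE [::]).
- move=> _ _ /ephi_image[u <-] /ephi_image[v <-]; apply/ephi_image.
  by exists (emul u v); rewrite ephi_mul.
- exact: sh_comul_symmetric.
- move=> _ /ephi_image[u <-]; apply/ephi_image.
  by exists (eanti u); rewrite ephi_anti.
Qed.

End HalfFamily.

Theorem proposition1p1 (K : fieldType) (charK : [pchar K] =i pred0)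
    (B : Bfamily (fps K)) (hB : in_B B) :
  (* (1) *)
  (forall g : lieAlgType K, is_hopf (sh_hopf B g)) /\
  (* (2) *)
  (in_Blambda (fconst (2%:R^-1 : K)) B ->
   forall g : lieAlgType K,
     hopf_sub (sh_hopf B g) (@symmetric_tensor K g) /\
     exists phi : fps (env g) -> fps (tensorAlg g),
       [/\ hopf_morph (env_hopf g) (sh_hopf B g) phi,
           injective phi,
           (forall a, fps_in (@symmetric_tensor K g) a <-> exists u, phi u = a)
         & forall x : g, phi (fconst (eword [:: x])) = fconst (tword [:: x])]) /\
  (* (3) *)
  [/\ (forall (g h : lieAlgType K) (f : {linear g -> h}),
        {morph f : x y / lbr x y} ->
        hopf_morph (sh_hopf B g) (sh_hopf B h) (sh_map f)),
      (forall g : lieAlgType K, sh_map (@idfun g) =1 idfun)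
    & (forall (g h l : lieAlgType K) (f : {linear g -> h}) (f' : {linear h -> l}),
        {morph f : x y / lbr x y} -> {morph f' : x y / lbr x y} ->
        sh_map (f' \o f) =1 sh_map f' \o sh_map f)] /\
  (* (4) *)
  (forall (B' : Bfamily (fps K)) (P : Pfamily (fps K)),
     in_B B' -> in_G P -> transports P B B' ->
     (forall g : lieAlgType K,
        hopf_iso (sh_hopf B g) (sh_hopf B' g) (@sh_twist K g P)) /\
     (forall (g h : lieAlgType K) (f : {linear g -> h}),
        {morph f : x y / lbr x y} ->
        sh_map f \o @sh_twist K g P =1 @sh_twist K h P \o sh_map f)).
Proof.
have [lambda hlB] := hB; split; [|split; [|split]].
- by move=> g; apply: sh_is_hopf hlB.
- move=> hB2 g; split; first exact: (symmetric_hopf_sub charK hB2 g).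
  exists (@ephi K B g); split.
  + exact: (ephi_hopf_morph charK hB2 g).
  + exact: (ephi_inj charK hB2).
  + exact: (ephi_image charK hB2).
  + exact: (ephi_letter charK hB2).
- split=> [g h f fbr||g h l f f' fbr f'br].
  + by apply: (sh_map_hopf_morph _ fbr hlB); apply: linearP.
  + exact: sh_map_id.
  + by apply: sh_map_comp; apply: linearP.
move=> B' P [lambda' hlB'] hP tP; split=> [g|g h f fbr].
  exact: (sh_twist_hopf_iso hlB hlB' hP tP g).
by apply: sh_map_twist => //; apply: linearP.
Qed.
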